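(* Let $\theta>1$. There exist constants $0<c<C<\infty$ depending only on $\theta$ such that the following holds. Let $I$ be a finite or countable index set and let $B_i=B_{R_i}(X_i)\subset\mathbb{R}^3$, $i\in I$, be balls such that $B_{\theta R_i}(X_i)\cap B_{\theta R_j}(X_j)=\emptyset$ for all $i\neq j$. Then for all $\gamma>0$ and all $k\in\mathbb{N}$, $$\|(1-\gamma L)^k-P\|\leq\max\{1-c\gamma,\ |1-C\gamma|\}^k,$$ where $\|\cdot\|$ is the operator norm on $\dot H^1_\sigma(\mathbb{R}^3)$.
   Context: $\dot H^1(\mathbb{R}^3)$ is the homogeneous Sobolev space of $\mathbb{R}^3$-valued functions, i.e. the closure of $C_c^\infty(\mathbb{R}^3)$ with respect to $\|w\|_{\dot H^1(\mathbb{R}^3)}=\|\nabla w\|_{L^2(\mathbb{R}^3)}$, with inner product $\int_{\mathbb{R}^3}\nabla w_1:\nabla w_2$. $\dot H^1_\sigma(\mathbb{R}^3)=\{w\in\dot H^1(\mathbb{R}^3):\operatorname{div}w=0\}$. $e w=\frac12(\nabla w+\nabla w^T)$. $W=\{w\in\dot H^1_\sigma(\mathbb{R}^3): e w=0\text{ in }\bigcup_{i}\overline{B_i}\}$ and $P$ is the orthogonal projection in $\dot H^1_\sigma(\mathbb{R}^3)$ onto $W$. For $i\in I$ let $W_i=\{w\in\dot H^1_\sigma(\mathbb{R}^3): e w=0\text{ in }B_i\}$ and let $Q_i$ be the orthogonal projection in $\dot H^1_\sigma(\mathbb{R}^3)$ onto $W_i^\perp$. $L=\sum_{i\in I}Q_i$,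 which is a bounded self-adjoint operator on $\dot H^1_\sigma(\mathbb{R}^3)$. *)

(* Defs.v *)
From HB Require Import structures.
From mathcomp Require Import all_boot all_order all_algebra finmap.
From mathcomp Require Import all_classical all_reals all_analysis.

Set Implicit Arguments.
Unset Strict Implicit.
Unset Printing Implicit Defensive.

Import Order.TTheory GRing.Theory Num.Theory.
Import numFieldNormedType.Exports.

Local Open Scope classical_set_scope.
Local Open Scope ring_scope.

(* The iterated product carries the product topology and the product (Borel)
   sigma-algebra.  Its library norm is the sup norm: it is used only for the
   topology, and Euclidean balls are introduced separately. *)
Notation R3 R := (measurableTypeR R * measurableTypeR R * measurableTypeR R)%type.
Notation vfield R := (R3 R -> 'rV[R]_3).
Notation mfield R := (R3 R -> 'M[R]_3).

Definition leb3 {R : realType} : {measure set (R3 R) -> \bar R} :=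
  [the measure _ _ of
    ((@lebesgue_measure R \x @lebesgue_measure R) \x @lebesgue_measure R)%E].

Section Space.
Context {R : realType}.
Implicit Types (f phi : R3 R -> R) (v w : vfield R) (V : set (vfield R)).

Definition coord (x : R3 R) (j : 'I_3) : R := nth 0 [:: x.1.1; x.1.2; x.2] j.

Definition basis (j : 'I_3) : R3 R :=
  ((j == 0 :> nat)%:R, (j == 1 :> nat)%:R, (j == 2 :> nat)%:R).

Definition edist (x y : R3 R) : R :=
  Num.sqrt (\sum_(j < 3) (coord x j - coord y j) ^+ 2).

Definition eball (x : R3 R) (r : R) : set (R3 R) := [set y | edist x y < r].

Definition ecball (x : R3 R) (r : R) : set (R3 R) := [set y | edist x y <= r].

Definition comp w (i : 'I_3) : R3 R -> R := fun x => w x 0 i.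

Definition partial (j : 'I_3) f : R3 R -> R := fun x => 'D_(basis j) f x.

(* C^oo, in the form: every iterated partial derivative exists and is
   continuous. *)
Definition smooth f : Prop := forall s : seq 'I_3,
  continuous (foldr partial f s) /\
  forall x j, derivable (foldr partial f s) x (basis j).

Definition Ccinfty f : Prop :=
  smooth f /\ compact (closure [set x | f x != 0]).

Definition vCcinfty w : Prop := forall i, Ccinfty (comp w i).

Definition jacobian w : mfield R :=
  fun x => \matrix_(i, j) partial j (comp w i) x.

Definition loc_integrable f : Prop :=
  forall r : R, leb3.-integrable (eball 0 r) (EFin \o f).

(* G i j is the distributional derivative of w_i in direction j. *)
Definition is_wgrad w (G : mfield R) : Prop :=
  (forall i j, loc_integrable (fun x => G x i j)) /\
  forall phi, Ccinfty phi -> forall i j,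
    \int[leb3]_x (comp w i x * partial j phi x) =
    - \int[leb3]_x (G x i j * phi x).

(* The weak gradient; it is unique almost everywhere, and [xget] picks a
   representative. *)
Definition wgrad w : mfield R := xget (fun=> 0) [set G | is_wgrad w G].

Definition mdot (A B : 'M[R]_3) : R := \sum_(i < 3) \sum_(j < 3) A i j * B i j.

(* The closure of the test fields for the norm of the gradient in L^2.  In
   dimension 3 this norm controls the L^1 norm on each ball (Hardy or Sobolev
   inequality), so that the completion is realized by locally integrable
   fields w: a sequence of test fields tends to w in L^1_loc, and its
   gradients tend to the gradient of w in L^2.  The L^1_loc limit is what
   excludes the nonzero constants.  Elements are representatives; w and w' are
   the same element when w = w' almost everywhere. *)
Definition hdot1 : set (vfield R) := [set w |
  [/\ forall i, loc_integrable (comp w i),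
      exists G, is_wgrad w G,
      forall i j, (fun x => wgrad w x i j) \in Lfun leb3 2%:E
    & exists phi : nat -> vfield R,
      [/\ forall n, vCcinfty (phi n),
          forall (r : R) i, (\int[leb3]_(y in eball 0%R r)
            `|comp (phi n) i y - comp w i y|%:E)%E @[n --> \oo] --> 0%E
        & (\int[leb3]_y (mdot (jacobian (phi n) y - wgrad w y)
                              (jacobian (phi n) y - wgrad w y))%:E)%E
            @[n --> \oo] --> 0%E]]].

Definition hinner v w : R := \int[leb3]_x mdot (wgrad v x) (wgrad w x).

Definition hnorm w : R := Num.sqrt (hinner w w).

(* div w is the trace of the weak gradient. *)
Definition hdot1s : set (vfield R) :=
  [set w | hdot1 w /\ {ae leb3, forall x, \tr (wgrad w x) = 0}].

Definition sgrad w : mfield R := fun x => 2^-1 *: (wgrad w x + (wgrad w x)^T).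

Definition rigid_in (A : set (R3 R)) : set (vfield R) :=
  [set w | hdot1s w /\ {ae leb3, forall x, A x -> sgrad w x = 0}].

Definition orth V : set (vfield R) :=
  [set w | hdot1s w /\ forall v, V v -> hinner w v = 0].

(* For a closed subspace V of hdot1s and w in hdot1s the set below is a single
   element, up to equality almost everywhere. *)
Definition oproj V w : vfield R :=
  xget 0 [set v | V v /\ forall z, V z -> hinner (w - v) z = 0].

(* Unconditional sum, in the norm of hdot1s, of a family indexed by an
   unordered set. *)
Definition is_hsum (I : choiceType) (u : I -> vfield R) (s : vfield R) : Prop :=
  hdot1s s /\ forall e : R, 0 < e -> exists F0 : {fset I},
    forall F : {fset I}, (F0 `<=` F)%fset ->
      hnorm (s - \sum_(i <- F) u i) < e.

Definition hsum (I : choiceType) (u : I -> vfield R) : vfield R :=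
  xget 0 [set s | is_hsum u s].

Definition opnorm (T : vfield R -> vfield R) : \bar R :=
  ereal_sup [set (hnorm (T w))%:E | w in [set w | hdot1s w /\ hnorm w <= 1]].

End Space.

(* The balls are the B_(rho i) (X i). *)
Section Balls.
Context {R : realType} {I : choiceType} (X : I -> R3 R) (rho : I -> R).

Definition Wspace : set (vfield R) :=
  rigid_in (\bigcup_i ecball (X i) (rho i)).

Definition Pop : vfield R -> vfield R := oproj Wspace.

Definition Wsub (i : I) : set (vfield R) := rigid_in (eball (X i) (rho i)).

Definition Qop (i : I) : vfield R -> vfield R := oproj (orth (Wsub i)).

Definition Lop (w : vfield R) : vfield R := hsum (fun i => Qop i w).

End Balls.

(* Main.v *)
From HB Require Import structures.
From mathcomp Require Import all_boot all_order all_algebra finmap.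
From mathcomp Require Import all_classical all_reals all_analysis measurable_realfun.
From mathcomp Require Import ring lra.
Require Import Defs.

Import Order.TTheory GRing.Theory Num.Theory.
Import numFieldNormedType.Exports.

Set Implicit Arguments.
Unset Strict Implicit.
Unset Printing Implicit Defensive.

Local Open Scope classical_set_scope.
Local Open Scope ring_scope.

(* Let E_i z be a divergence-free field that agrees with z, up to a constant, on
   B_i, is supported (up to a constant) in the ball enlarged by theta, and has
   energy at most C times the energy of z in the enlarged ball, C depending only
   on theta.  The enlarged balls are disjoint, so the E_i z are orthogonal,
   E_i z - z lies in W_i and E_i z lies in W_j for j <> i.
   If v_i is orthogonal to W_i, then <v_i, z> = <v_i, E_i z>, and summing over i
   gives |sum v_i|^2 <= C sum |v_i|^2.  For v_i = Q_i w this is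
   |L w|^2 <= C <L w, w>, hence <L w, w> <= C |w|^2.
   With u_i = E_i (Q_i w), the field w - sum u_i lies in W; so for w orthogonal
   to W, |w|^2 = <w, sum u_i> <= |w| (C <L w, w>)^(1/2), i.e.
   |w|^2 <= C <L w, w>.  As L vanishes on W, the bound on the powers of
   1 - gamma L follows.

   The extension is explicit.  On the unit scale, with a radial cutoff chi,
   grad chi = h x, and F_j(x) the integral of t f_j(t x) over 0 < t < 1, put
     u_i = chi f_i + h (|x|^2 F_i - x_i (x . F)).
   The Euler relation 2 F_j + x . grad F_j = f_j gives
     div u = chi div f + h |x|^2 G(x),
   G(x) being the integral of t^2 (div f)(t x).  Thus u is divergence free when
   f is, and the energy bound follows from the Poincare inequality. *)

(** * Semi-inner product spaces *)

(** The obstacle is that the extension formula needs smooth fields, while the test fields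
    approximating a divergence-free field need not be divergence free: their divergences only tend
    to 0 in L^2. The extension is therefore built for all smooth f, and the divergence of u is
    bounded by that of f alone, besides the energy bound; both bounds survive the passage to the
    limit. The formula for u is a curl in disguise. If div f = 0, Poincare's lemma gives f = curl A
    with A = F cross x, and curl (chi A) = chi f + grad chi cross A = chi f + h x cross (F cross x),
    where the double product is |x|^2 F - x (x . F). The words up to a constant in the overview come
    from subtracting from f its mean over the enlarged ball, which makes Poincare's inequality
    applicable. Elements are representatives and operators are picked by choice, so L is linear only
    up to null fields; its symmetry for the inner product is used instead. The two bounds on <L w,
    w> control the quadratic form of 1 - gamma L on the orthogonal complement of W, and polarization
    turns this into a bound on its norm. *)

Lemma inv_nat_lt (R : realType) (e : R) : 0 < e -> exists N : nat, N.+1%:R^-1 < e.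
Proof.
move=> e0; exists (Num.trunc e^-1).
by rewrite invf_plt ?posrE//; exact: truncnS_gt.
Qed.

Section SemiInner.
Context {R : realType} {E : lmodType R}.
Implicit Types (H V : set E) (ip : E -> E -> R).

(** Definiteness is left out: two fields equal almost everywhere are distinct elements at distance
    0. The axioms are relative to a set [H] because the ambient type consists of all functions. *)
Record semi_inner H ip : Prop := SemiInner {
  si0 : H 0;
  siD : forall x y, H x -> H y -> H (x + y);
  siZ : forall a x, H x -> H (a *: x);
  siC : forall x y, H x -> H y -> ip x y = ip y x;
  siDl : forall x y z, H x -> H y -> H z -> ip (x + y) z = ip x z + ip y z;
  siZl : forall a x y, H x -> H y -> ip (a *: x) y = a * ip x y;
  si_ge0 : forall x, H x -> 0 <= ip x x }.

Definition nrm ip x := Num.sqrt (ip x x).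

Definition clim ip (u : nat -> E) l := forall e : R, 0 < e ->
  exists N, forall n, (N <= n)%N -> nrm ip (u n - l) < e.

Definition ccauchy ip (u : nat -> E) := forall e : R, 0 < e ->
  exists N, forall m n, (N <= m)%N -> (N <= n)%N -> nrm ip (u m - u n) < e.

Definition scomplete H ip := forall u : nat -> E, (forall n, H (u n)) ->
  ccauchy ip u -> exists2 l, H l & clim ip u l.

(** Closedness refers to the seminorm, so such a [V] contains every element of [H] of norm 0, see
    [cs_null]. *)
Definition closed_sub H ip V := [/\ V `<=` H, V 0,
  (forall a x y, V x -> V y -> V (a *: x + y)) &
  forall w, H w -> (forall e : R, 0 < e -> exists2 v, V v & nrm ip (w - v) < e) -> V w].

Definition orthc H ip V : set E := [set w | H w /\ forall v, V v -> ip w v = 0].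

Definition is_oproj ip V w v := V v /\ forall z, V z -> ip (w - v) z = 0.

Definition is_usum H ip (I : choiceType) (u : I -> E) s :=
  H s /\ forall e : R, 0 < e -> exists F0 : {fset I},
    forall F : {fset I}, (F0 `<=` F)%fset -> nrm ip (s - \sum_(i <- F) u i) < e.

Section Basic.
Variables (H : set E) (ip : E -> E -> R) (S : semi_inner H ip).
Local Notation nrm := (nrm ip).

Lemma siN x : H x -> H (- x).
Proof. by move=> Hx; rewrite -scaleN1r; exact: (siZ S). Qed.

Lemma siB x y : H x -> H y -> H (x - y).
Proof. by move=> Hx Hy; apply: (siD S) => //; exact: siN. Qed.

Lemma si_sum (I : eqType) (r : seq I) (u : I -> E) :
  (forall i, H (u i)) -> H (\sum_(i <- r) u i).
Proof.
move=> Hu; elim/big_rec : _ => [|i x _ Hx]; first exact: si0 S.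
exact: (siD S (Hu i) Hx).
Qed.

Lemma si0l x : H x -> ip 0 x = 0.
Proof. by move=> Hx; rewrite -(scale0r (0 : E)) (siZl S) ?mul0r//; exact: si0 S. Qed.

Lemma siNl x y : H x -> H y -> ip (- x) y = - ip x y.
Proof. by move=> Hx Hy; rewrite -scaleN1r (siZl S)// mulN1r. Qed.

Lemma siBl x y z : H x -> H y -> H z -> ip (x - y) z = ip x z - ip y z.
Proof. by move=> Hx Hy Hz; rewrite (siDl S)// ?siNl//; exact: siN. Qed.

Lemma siDr x y z : H x -> H y -> H z -> ip z (x + y) = ip z x + ip z y.
Proof.
move=> Hx Hy Hz; rewrite (siC S)// ?(siDl S)//; last exact: (siD S).
by rewrite (siC S Hx)// (siC S Hy).
Qed.

Lemma siZr a x y : H x -> H y -> ip x (a *: y) = a * ip x y.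
Proof. by move=> Hx Hy; rewrite (siC S)// ?(siZl S)// ?(siC S Hx)//; exact: (siZ S). Qed.

Lemma siBr x y z : H x -> H y -> H z -> ip z (x - y) = ip z x - ip z y.
Proof.
move=> Hx Hy Hz; rewrite (siC S)// ?siBl//; last exact: siB.
by rewrite (siC S Hx)// (siC S Hy).
Qed.

Lemma si_suml (I : eqType) (r : seq I) (u : I -> E) z : (forall i, H (u i)) -> H z ->
  ip (\sum_(i <- r) u i) z = \sum_(i <- r) ip (u i) z.
Proof.
move=> Hu Hz; elim: r => [|i r IH]; first by rewrite !big_nil si0l.
by rewrite !big_cons (siDl S)// ?IH//; exact: si_sum.
Qed.

Lemma si_sumr (I : eqType) (r : seq I) (u : I -> E) z : (forall i, H (u i)) -> H z ->
  ip z (\sum_(i <- r) u i) = \sum_(i <- r) ip z (u i).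
Proof.
move=> Hu Hz; rewrite (siC S)//; last exact: si_sum.
by rewrite si_suml//; apply: eq_bigr => i _; rewrite (siC S).
Qed.

Lemma nrm_ge0 x : 0 <= nrm x. Proof. exact: sqrtr_ge0. Qed.

Lemma nrm_sqr x : H x -> nrm x ^+ 2 = ip x x.
Proof. by move=> Hx; rewrite sqr_sqrtr// (si_ge0 S). Qed.

Lemma nrmN x : H x -> nrm (- x) = nrm x.
Proof.
move=> Hx; rewrite /nrm siNl//; last exact: siN.
by rewrite (siC S)//; [rewrite siNl// opprK|exact: siN].
Qed.

Lemma nrmZ a x : H x -> nrm (a *: x) = `|a| * nrm x.
Proof.
move=> Hx; rewrite /nrm (siZl S)//; last exact: (siZ S).
by rewrite siZr// mulrA -expr2 sqrtrM ?sqr_ge0// sqrtr_sqr.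
Qed.

Lemma nrmBC x y : H x -> H y -> nrm (x - y) = nrm (y - x).
Proof. by move=> Hx Hy; rewrite -nrmN ?opprB//; exact: siB. Qed.

Lemma nrmD_sqr x y : H x -> H y ->
  nrm (x + y) ^+ 2 = nrm x ^+ 2 + 2 * ip x y + nrm y ^+ 2.
Proof.
move=> Hx Hy; rewrite !nrm_sqr//; last exact: (siD S).
rewrite (siDl S)//; last exact: (siD S).
by rewrite !siDr// (siC S Hy)//; ring.
Qed.

Lemma nrmB_sqr x y : H x -> H y ->
  nrm (x - y) ^+ 2 = nrm x ^+ 2 - 2 * ip x y + nrm y ^+ 2.
Proof.
move=> Hx Hy; rewrite nrmD_sqr//; last exact: siN.
rewrite nrmN// (siC S)//; last exact: siN.
by rewrite siNl// (siC S Hy)//; ring.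
Qed.

Lemma si_cauchy_schwarz x y : H x -> H y -> `|ip x y| <= nrm x * nrm y.
Proof.
move=> Hx Hy.
have key t : 0 <= ip x x + t * (2 * ip x y) + t ^+ 2 * ip y y.
  have Hty : H (t *: y) by exact: (siZ S).
  have := sqr_ge0 (nrm (x + t *: y)).
  by rewrite nrmD_sqr// siZr// nrm_sqr// nrmZ// exprMn real_normK ?num_real// nrm_sqr//; lra.
have dis : ip x y ^+ 2 <= ip x x * ip y y.
  have yy := si_ge0 S Hy; have xx := si_ge0 S Hx.
  have [y0|yn0] := eqVneq (ip y y) 0.
    have [xy0|xyn0] := eqVneq (ip x y) 0; first by rewrite xy0 expr0n mulr_ge0.
    (* With [ip y y = 0] the polynomial in [key] is affine in [t]; this [t] gives it the value
       -1. *)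
    have := key (- (ip x x + 1) / (2 * ip x y)); rewrite y0 mulr0 addr0.
    rewrite mulfVK ?mulf_neq0 ?pnatr_eq0//; lra.
  have yp : 0 < ip y y by rewrite lt_neqAle eq_sym yn0.
  have := key (- (ip x y / ip y y)).
  have -> : ip x x + - (ip x y / ip y y) * (2 * ip x y) + (- (ip x y / ip y y)) ^+ 2 * ip y y
     = (ip x x * ip y y - ip x y ^+ 2) / ip y y by field.
  by rewrite pmulr_lge0 ?invr_gt0// subr_ge0.
rewrite -(@ler_pXn2r _ 2%N)// ?nnegrE ?mulr_ge0 ?sqrtr_ge0//.
by rewrite real_normK ?num_real// exprMn !nrm_sqr.
Qed.

Lemma nrmD x y : H x -> H y -> nrm (x + y) <= nrm x + nrm y.
Proof.
move=> Hx Hy; rewrite -(@ler_pXn2r _ 2%N)// ?nnegrE ?addr_ge0 ?sqrtr_ge0//.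
rewrite nrmD_sqr//.
have := si_cauchy_schwarz Hx Hy; have := ler_norm (ip x y); lra.
Qed.

Lemma nrmB x y : H x -> H y -> nrm (x - y) <= nrm x + nrm y.
Proof. by move=> Hx Hy; rewrite -(nrmN Hy) nrmD//; exact: siN. Qed.

Lemma nrm_triang x y z : H x -> H y -> H z -> nrm (x - z) <= nrm (x - y) + nrm (y - z).
Proof. by move=> Hx Hy Hz; rewrite -[x - z](subrKA y) nrmD//; exact: siB. Qed.

Lemma nrm_dist0 x y : H x -> H y -> nrm (x - y) = 0 -> nrm x = nrm y.
Proof.
move=> Hx Hy d0; have := nrm_triang Hx Hy (si0 S); have := nrm_triang Hy Hx (si0 S).
by rewrite !subr0 (nrmBC Hy Hx) d0 !add0r => h1 h2; apply/eqP; rewrite eq_le h1 h2.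
Qed.

Lemma si_eq0 x : H x -> ip x x = 0 -> nrm x = 0.
Proof. by move=> Hx x0; rewrite /nrm x0 sqrtr0. Qed.

Lemma si_null x y : H x -> H y -> nrm x = 0 -> ip x y = 0.
Proof.
move=> Hx Hy x0; have := si_cauchy_schwarz Hx Hy.
by rewrite x0 mul0r normr_le0 => /eqP.
Qed.

Lemma closed_orthc V : V `<=` H -> closed_sub H ip (orthc H ip V).
Proof.
move=> VH; split=> [x []//| |a x y [Hx xV] [Hy yV]|w Hw cw].
- by split=> [|v /VH Hv]; [exact: si0 S|rewrite si0l].
- have Hax : H (a *: x) by exact: (siZ S).
  split=> [|v Vv]; first exact: (siD S).
  by rewrite (siDl S) ?(siZl S) ?xV ?yV ?mulr0 ?addr0//; exact: VH.
- split=> // v Vv; have Hv := VH _ Vv.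
  apply/eqP; rewrite -normr_le0; apply/ler_addgt0Pr => e e0; rewrite add0r.
  have [x [Hx xV] wx] := cw (e / (nrm v + 1)) (divr_gt0 e0 (ltr_wpDl (nrm_ge0 _) ltr01)).
  have := si_cauchy_schwarz (siB Hw Hx) Hv.
  rewrite siBl// xV// subr0 => /le_trans; apply.
  move: wx; rewrite ltr_pdivlMr ?ltr_wpDl ?nrm_ge0// => /ltW.
  by apply: le_trans; rewrite ler_wpM2l ?nrm_ge0// lerDl.
Qed.

Section ClosedSub.
Variables (V : set E) (cV : closed_sub H ip V).

Lemma cs_sub x : V x -> H x. Proof. by case: cV => + _ _ _; apply. Qed.
Lemma cs0 : V 0. Proof. by case: cV. Qed.
Lemma csD x y : V x -> V y -> V (x + y).
Proof. by case: cV => _ _ VL _ Vx Vy; rewrite -(scale1r x); exact: VL. Qed.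
Lemma csZ a x : V x -> V (a *: x).
Proof. by case: cV => _ V0 VL _ Vx; rewrite -(addr0 (_ *: _)); exact: VL. Qed.
Lemma csB x y : V x -> V y -> V (x - y).
Proof. by move=> Vx Vy; apply: csD => //; rewrite -scaleN1r; exact: csZ. Qed.
Lemma cs_sum (I : eqType) (r : seq I) (u : I -> E) :
  (forall i, i \in r -> V (u i)) -> V (\sum_(i <- r) u i).
Proof.
move=> Hu; rewrite big_seq; elim/big_rec : _ => [|i x ir Hx]; first exact: cs0.
by apply: csD => //; exact: Hu.
Qed.
Lemma cs_closed w : H w -> (forall e : R, 0 < e -> exists2 v, V v & nrm (w - v) < e) -> V w.
Proof. by case: cV => _ _ _; apply. Qed.
Lemma cs_null x : H x -> nrm x = 0 -> V x.
Proof.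
by move=> Hx x0; apply: cs_closed => // e e0; exists 0; [exact: cs0|rewrite subr0 x0].
Qed.

End ClosedSub.

(** A minimizing sequence is Cauchy by the parallelogram law, its limit attains the distance from
    [w] to [V], and varying the minimizer along [z] gives orthogonality. *)
Lemma oproj_exists V w : scomplete H ip -> closed_sub H ip V -> H w ->
  exists v, is_oproj ip V w v.
Proof.
move=> cplt cV Hw.
pose D := [set nrm (w - v) ^+ 2 | v in V].
have D0 : has_inf D.
  split; first by exists (nrm (w - 0) ^+ 2), 0 => //; exact: cs0 cV.
  by exists 0 => _ [v _ <-]; exact: sqr_ge0.
pose d := inf D.
have dle v : V v -> d <= nrm (w - v) ^+ 2.
  by move=> Vv; apply: ge_inf; [case: D0|exists v].
have apx (n : nat) : exists v, V v /\ nrm (w - v) ^+ 2 < d + n.+1%:R^-1.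
  have /(inf_adherent)/(_ D0)[_ [v Vv <-] vn] : 0 < n.+1%:R^-1 :> R by rewrite invr_gt0.
  by exists v.
pose u n := sval (cid (apx n)).
have uV n : V (u n) by rewrite /u; case: cid => v [].
have ud n : nrm (w - u n) ^+ 2 < d + n.+1%:R^-1 by rewrite /u; case: cid => v [].
have HV x : V x -> H x by exact: (cs_sub cV).
have Hwu n : H (w - u n) by apply: siB => //; exact: HV.
(* Parallelogram law for [w - u n] and [w - u m]: half their sum is [w - mid] with [mid] in [V], so
   its squared norm is at least [d]. *)
have par m n : nrm (u m - u n) ^+ 2 <= 2 * (m.+1%:R^-1 + n.+1%:R^-1).
  have e1 : u m - u n = (w - u n) - (w - u m).
    by rewrite opprB [RHS]addrC subrKA.
  pose mid := 2^-1 *: (u m + u n).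
  have Vmid : V mid by apply: (csZ cV); exact: csD cV _ _ (uV m) (uV n).
  have e2 : (w - u n) + (w - u m) = 2 *: (w - mid).
    rewrite scalerBr scalerA divff ?pnatr_eq0// scale1r scaler_nat mulr2n.
    by rewrite addrACA opprD [- u n - u m]addrC.
  have := congr1 (fun z => nrm z ^+ 2) e2; rewrite /= nrmD_sqr//.
  rewrite nrmZ; last by apply: siB => //; exact: HV.
  rewrite exprMn normr_nat => e3.
  rewrite e1 nrmB_sqr//.
  move: (ud m) (ud n) (dle _ Vmid) e3.
  move: (m.+1%:R^-1) (n.+1%:R^-1) (nrm (w - u n) ^+ 2) (nrm (w - u m) ^+ 2)
    (nrm (w - mid) ^+ 2) (ip _ _) => *; lra.
have [l Hl ul] : exists2 l, H l & clim ip u l.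
  apply: cplt => [n|e e0]; first exact: HV.
  have [N NP] := inv_nat_lt (divr_gt0 (exprn_gt0 2 e0) (ltr0n R 4)).
  exists N => m n Nm Nn.
  rewrite -(@ltr_pXn2r _ 2%N)// ?nnegrE ?sqrtr_ge0 ?ltW//.
  apply: (le_lt_trans (par m n)).
  have im : m.+1%:R^-1 <= N.+1%:R^-1 :> R by rewrite lef_pV2 ?posrE// ler_nat.
  have in_ : n.+1%:R^-1 <= N.+1%:R^-1 :> R by rewrite lef_pV2 ?posrE// ler_nat.
  by move: im in_ NP; move: (m.+1%:R^-1) (n.+1%:R^-1) (N.+1%:R^-1) (e ^+ 2) => *; lra.
have Vl : V l.
  apply: (cs_closed cV) => // e e0; have [N uN] := ul e e0.
  by exists (u N) => //; rewrite nrmBC ?uN//; exact: HV.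
have dl : nrm (w - l) ^+ 2 <= d.
  have d0 : 0 <= d by apply: lb_le_inf => [|_ [v _ <-]]; [case: D0|exact: sqr_ge0].
  rewrite -(sqr_sqrtr d0) ler_pXn2r ?nnegrE ?sqrtr_ge0//.
  rewrite leNgt; apply/negP => sl.
  pose g := nrm (w - l) - Num.sqrt d; have g0 : 0 < g by rewrite subr_gt0.
  have [N1 uN1] := ul (g / 2) (divr_gt0 g0 (ltr0n _ 2)).
  have [N2 NP2] := inv_nat_lt (divr_gt0 (exprn_gt0 2 g0) (ltr0n R 4)).
  pose n := maxn N1 N2.
  have h1 := uN1 n (leq_maxl _ _).
  have h2 : nrm (w - u n) < Num.sqrt d + g / 2.
    have s0 := sqrtr_ge0 d.
    rewrite -(@ltr_pXn2r _ 2%N)// ?nnegrE ?sqrtr_ge0//; last by lra.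
    apply: lt_trans (ud n) _.
    have in_ : n.+1%:R^-1 <= N2.+1%:R^-1 :> R by rewrite lef_pV2 ?posrE// ler_nat ltnS leq_maxr.
    have sg : 0 <= Num.sqrt d * g by rewrite mulr_ge0// ltW.
    have -> : (Num.sqrt d + g / 2) ^+ 2 = Num.sqrt d ^+ 2 + Num.sqrt d * g + g ^+ 2 / 4 by field.
    rewrite sqr_sqrtr//; move: NP2 in_ sg.
    by move: (n.+1%:R^-1) (N2.+1%:R^-1) (_ * g) (g ^+ 2) => *; lra.
  have := nrm_triang Hw (HV _ (uV n)) Hl; rewrite /g in h1 h2; lra.
exists l; split=> // z Vz.
have Hz := HV _ Vz; have Hwl : H (w - l) by exact: siB.
have key t : 0 <= - (2 * t * ip (w - l) z) + t ^+ 2 * ip z z.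
  have := dle (l + t *: z) (csD cV Vl (csZ cV t Vz)).
  rewrite opprD addrA nrmB_sqr//; last exact: (siZ S).
  rewrite siZr// nrmZ// exprMn real_normK ?num_real// (nrm_sqr Hz); lra.
apply/eqP; apply: contraT => p0.
have zz := si_ge0 S Hz.
(* The optimal [t] has denominator [ip z z], which may be 0 for a null [z]; with 1 added the
   right-hand side of [key] is still negative. *)
have := key (ip (w - l) z / (ip z z + 1)).
have -> : - (2 * (ip (w - l) z / (ip z z + 1)) * ip (w - l) z) + (ip (w - l) z / (ip z z + 1)) ^+ 2 * ip z z
  = - ((ip (w - l) z / (ip z z + 1)) ^+ 2 * (ip z z + 2)).
  by field; lra.
rewrite oppr_ge0 leNgt mulr_gt0//; last by lra.
by rewrite exprn_even_gt0//= mulf_neq0// invr_eq0; lra.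
Qed.

(** The weights [a i] control the tails. A finite set [F_ n] whose weight is within 1/(n+1) of the
    supremum leaves at most that weight to any finite set disjoint from it; so the sums over [F_ n]
    are Cauchy, and their limit is the unconditional sum. *)
Lemma usum_exists (I : choiceType) (u : I -> E) (a : I -> R) (C M : R) :
  scomplete H ip -> (forall i, H (u i)) -> 0 <= C -> (forall i, 0 <= a i) ->
  (forall F : {fset I}, \sum_(i <- F) a i <= M) ->
  (forall F : {fset I}, nrm (\sum_(i <- F) u i) ^+ 2 <= C * \sum_(i <- F) a i) ->
  exists s, is_usum H ip u s.
Proof.
move=> cplt Hu C0 a0 aM uC.
have Hs (F : {fset I}) : H (\sum_(i <- F) u i) by exact: si_sum.
pose D := [set \sum_(i <- F) a i | F in [set: {fset I}]].
have D0 : has_sup D.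
  by split; [exists (\sum_(i <- (fset0 : {fset I})) a i), fset0|exists M => _ [F _ <-]].
have apx (n : nat) : exists F : {fset I}, sup D - n.+1%:R^-1 < \sum_(i <- F) a i.
  have /(sup_adherent)/(_ D0)[_ [F _ <-] Fn] : 0 < n.+1%:R^-1 :> R by rewrite invr_gt0.
  by exists F.
pose F_ n := sval (cid (apx n)).
have FP n : sup D - n.+1%:R^-1 < \sum_(i <- F_ n) a i by rewrite /F_; case: cid.
have small n (G : {fset I}) :
    nrm (\sum_(i <- [fset x in G | x \notin F_ n]%fset) u i) ^+ 2 <= C * n.+1%:R^-1.
  apply: le_trans (uC _) _; rewrite ler_wpM2l//.
  have : \sum_(i <- (F_ n `|` G)%fset) a i <= sup D.
    by apply: sup_upper_bound => //; exists (F_ n `|` G)%fset.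
  rewrite (big_fsetID _ (mem (F_ n)) (F_ n `|` G)%fset)/=.
  have -> : [fset x in (F_ n `|` G)%fset | x \in F_ n]%fset = F_ n.
    by apply/fsetP => x; rewrite !inE /=; case: (x \in F_ n); rewrite // ?andbF.
  have -> : [fset x in (F_ n `|` G)%fset | x \notin F_ n]%fset =
            [fset x in G | x \notin F_ n]%fset.
    by apply/fsetP => x; rewrite !inE /=; case: (x \in F_ n); rewrite // ?andbF.
  have := FP n; move: (n.+1%:R^-1) => *; lra.
have diff n (G : {fset I}) : (F_ n `<=` G)%fset ->
    \sum_(i <- G) u i - \sum_(i <- F_ n) u i =
    \sum_(i <- [fset x in G | x \notin F_ n]%fset) u i.
  move=> FG; rewrite (big_fsetID _ (mem (F_ n)))/=.
  have -> : [fset x in G | x \in F_ n]%fset = F_ n.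
    apply/fsetP => x; rewrite !inE /= andbC; case: (boolP (x \in F_ n)) => //= xF.
    by rewrite (fsubsetP FG).
  by rewrite addrAC subrr add0r.
have half n (e : R) : 0 < e -> C * n.+1%:R^-1 < e ^+ 2 -> forall G : {fset I},
    nrm (\sum_(i <- [fset x in G | x \notin F_ n]%fset) u i) < e.
  move=> e0 ne G; rewrite -(@ltr_pXn2r _ 2%N)// ?nnegrE ?sqrtr_ge0 ?ltW//.
  exact: le_lt_trans (small n G) ne.
have exN (e : R) : 0 < e -> exists N, forall n, (N <= n)%N -> C * n.+1%:R^-1 < e ^+ 2.
  move=> e0; have C1 : 0 < C + 1 by lra.
  have [N NP] := inv_nat_lt (divr_gt0 (exprn_gt0 2 e0) C1).
  exists N => n Nn; have in_ : n.+1%:R^-1 <= N.+1%:R^-1 :> R by rewrite lef_pV2 ?posrE// ler_nat.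
  have := le_lt_trans in_ NP; rewrite ltr_pdivlMr// mulrC; apply: le_lt_trans.
  by rewrite ler_wpM2r ?invr_ge0// lerDl.
pose s n := \sum_(i <- F_ n) u i.
have near_s n (e : R) (G : {fset I}) : 0 < e -> C * n.+1%:R^-1 < e ^+ 2 ->
    (F_ n `<=` G)%fset -> nrm (\sum_(i <- G) u i - s n) < e.
  by move=> e0 ne FG; rewrite diff//; exact: half.
have [l Hl sl] : exists2 l, H l & clim ip s l.
  apply: cplt => [n|e e0]; first exact: Hs.
  have e2 : 0 < e / 2 by rewrite divr_gt0.
  have [N NP] := exN _ e2; exists N => m n Nm Nn.
  (* Neither of [F_ m] and [F_ n] need contain the other; both are compared with their union. *)
  apply: le_lt_trans (nrm_triang (Hs (F_ m)) (Hs (F_ m `|` F_ n)%fset) (Hs (F_ n))) _.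
  rewrite [ltRHS](splitr e) ltrD//.
    by rewrite nrmBC//; apply: near_s => //; [exact: NP|exact: fsubsetUl].
  by apply: near_s => //; [exact: NP|exact: fsubsetUr].
exists l; split=> // e e0.
have e2 : 0 < e / 2 by rewrite divr_gt0.
have [N NP] := exN _ e2; have [N' NP'] := sl _ e2.
pose n := maxn N N'; exists (F_ n) => G FG.
rewrite nrmBC//; apply: le_lt_trans (nrm_triang (Hs G) (Hs (F_ n)) Hl) _.
rewrite [ltRHS](splitr e) ltrD//.
  by apply: near_s => //; apply: NP; exact: leq_maxl.
by apply: NP'; exact: leq_maxr.
Qed.

Lemma usum_ip_le (I : choiceType) (u : I -> E) s z : (forall i, H (u i)) -> H z ->
  is_usum H ip u s -> forall e : R, 0 < e -> exists F0 : {fset I},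
    forall F : {fset I}, (F0 `<=` F)%fset -> `|ip s z - \sum_(i <- F) ip (u i) z| < e.
Proof.
move=> Hu Hz [Hs us] e e0.
have z1 : 0 < nrm z + 1 by rewrite ltr_wpDl ?nrm_ge0.
have [F0 FP] := us _ (divr_gt0 e0 z1); exists F0 => F FF.
rewrite -si_suml// -siBl//; last exact: si_sum.
apply: le_lt_trans (si_cauchy_schwarz (siB Hs (si_sum _ Hu)) Hz) _.
have := FP _ FF; rewrite ltr_pdivlMr//; apply: le_lt_trans.
by rewrite ler_wpM2l ?nrm_ge0// lerDl.
Qed.

Lemma usum_ip_unique (I : choiceType) (u : I -> E) s z (l : R) : (forall i, H (u i)) -> H z ->
  is_usum H ip u s -> (forall F : {fset I}, \sum_(i <- F) ip (u i) z <= l) -> ip s z <= l.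
Proof.
move=> Hu Hz us ul; apply/ler_addgt0Pr => e e0.
have [F0 FP] := usum_ip_le Hu Hz us e0.
have := FP F0 (fsubset_refl _); have := ul F0; rewrite ltr_norml => ? /andP[? ?]; lra.
Qed.
End Basic.
End SemiInner.

(** * Abstract bounds on L and the error of the iteration *)

Section Schwarz.
Context {R : realType} {E : lmodType R} {H : set E} {ip : E -> E -> R}.
Variables (S : semi_inner H ip) (cplt : scomplete H ip).
Context {I : choiceType} {Wi : I -> set E} {W : set E}.
Variables (cWi : forall i, closed_sub H ip (Wi i)).
Variables (WP : forall x, W x <-> H x /\ forall i, Wi i x).
(** [ext i] abstracts the extension E_i and [nl i w] the energy of [w] in the i-th enlarged ball. As
    [ext] and [Q] come from choice, they are described by inclusions and inequalities, without
    linearity. *)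
Context {ext : I -> E -> E} {nl : I -> E -> R} {C : R}.
Hypotheses (C0 : 0 < C)
  (nl_sum : forall (F : {fset I}) w, H w -> \sum_(i <- F) nl i w <= nrm ip w ^+ 2)
  (ext_H : forall i w, H w -> H (ext i w))
  (ext_W : forall i w, H w -> Wi i (ext i w - w))
  (ext_W' : forall i j w, i != j -> H w -> Wi j (ext i w))
  (ext_orth : forall i j w z, i != j -> H w -> H z -> ip (ext i w) (ext j z) = 0)
  (ext_le : forall i w, H w -> nrm ip (ext i w) ^+ 2 <= C * nl i w).
Context {Q : I -> E -> E}.
Hypothesis QP : forall i w, H w -> is_oproj ip (orthc H ip (Wi i)) w (Q i w).
Local Notation nrm := (nrm ip).

Let WiH i x : Wi i x -> H x. Proof. exact: (cs_sub (cWi i)). Qed.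

Lemma Q_H i w : H w -> H (Q i w).
Proof. by move=> Hw; case: (QP i Hw) => -[]. Qed.

Lemma Q_orthW i w v : H w -> Wi i v -> ip (Q i w) v = 0.
Proof. by move=> Hw; case: (QP i Hw) => -[_ +] _; apply. Qed.

(** A closed subspace is its own double orthogonal. Concretely, with [p] a projection of [w] on
    [Wi i], both [w - p] and [Q i w] lie in the orthogonal complement and have the same inner
    products with it, so they differ by a null element. *)
Lemma Q_subW i w : H w -> Wi i (w - Q i w).
Proof.
move=> Hw; have HQ := Q_H i Hw.
have [p [Wp pP]] := oproj_exists S cplt (cWi i) Hw.
have Hp := WiH Wp; have Hwp : H (w - p) by exact: (siB S).
have Hd : H (w - p - Q i w) by exact: (siB S).
have orth_d z : orthc H ip (Wi i) z -> ip (w - p - Q i w) z = 0.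
  move=> [Hz zW]; rewrite addrAC (siBl S)//; last exact: (siB S).
  have [_ ->//] := QP i Hw; rewrite sub0r (siC S)// zW// oppr0//.
have nd : nrm (w - p - Q i w) = 0.
  apply: (si_eq0 Hd); apply: orth_d; split=> // v Wv.
  by rewrite (siBl S)//; [rewrite (pP _ Wv) Q_orthW// subrr|exact: WiH Wv].
have -> : w - Q i w = p + (w - p - Q i w) by rewrite addrA subrKC.
by apply: (csD (cWi i)) => //; exact: (cs_null (cWi i)).
Qed.

(** [z - Q i z] lies in [Wi i], to which [Q i w] is orthogonal. *)
Lemma Q_ip i w z : H w -> H z -> ip (Q i w) z = ip (Q i w) (Q i z).
Proof.
move=> Hw Hz; apply/eqP; rewrite -subr_eq0 -(siBr S)//; do ?exact: Q_H.
by rewrite Q_orthW//; exact: Q_subW.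
Qed.

Lemma Q_sym i w z : H w -> H z -> ip (Q i w) z = ip w (Q i z).
Proof.
by move=> Hw Hz; rewrite Q_ip// (siC S (Q_H _ Hw) (Q_H _ Hz)) -Q_ip// (siC S)//; exact: Q_H.
Qed.

Lemma Q_self i w : H w -> ip (Q i w) w = nrm (Q i w) ^+ 2.
Proof. by move=> Hw; rewrite Q_ip// (nrm_sqr S)//; exact: Q_H. Qed.

(** The squared norm of [Q i w] is its inner product with [w], hence with [ext i w], because
    [ext i w - w] lies in [Wi i]. Cauchy-Schwarz then bounds [Q i w] by the local field. *)
Lemma Q_le i w : H w -> nrm (Q i w) ^+ 2 <= C * nl i w.
Proof.
move=> Hw; apply: le_trans (ext_le i Hw).
have HQ := Q_H i Hw; have He := ext_H i Hw.
have : ip (Q i w) (ext i w) = nrm (Q i w) ^+ 2.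
  rewrite -Q_self//; apply/eqP; rewrite -subr_eq0 -(siBr S)//.
  by rewrite Q_orthW//; exact: ext_W.
have := si_cauchy_schwarz S HQ He; move=> /[swap] -> .
rewrite ger0_norm ?sqr_ge0// expr2.
have := nrm_ge0 ip (Q i w); rewrite le_eqVlt => /predU1P[<- _|Q0].
  by rewrite mul0r sqr_ge0.
by rewrite ler_pM2l// => le; apply: ler_pM => //; exact: ltW.
Qed.

Lemma Q_sum_le (F : {fset I}) w : H w -> \sum_(i <- F) nrm (Q i w) ^+ 2 <= C * nrm w ^+ 2.
Proof.
move=> Hw; apply: (@le_trans _ _ (\sum_(i <- F) C * nl i w)).
  by apply: ler_sum => i _; exact: Q_le.
by rewrite -mulr_sumr ler_pM2l// nl_sum.
Qed.

(* By duality with [Q_sum_le], through Young's inequality. *)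
Lemma Q_sum_dual (F : {fset I}) w : H w ->
  nrm (\sum_(i <- F) Q i w) ^+ 2 <= C * \sum_(i <- F) nrm (Q i w) ^+ 2.
Proof.
move=> Hw; set s := \sum_(i <- F) Q i w.
have HQ i : H (Q i w) by exact: Q_H.
have Hs : H s by exact: (si_sum S).
have e : nrm s ^+ 2 = \sum_(i <- F) ip (Q i w) (Q i s).
  rewrite (nrm_sqr S)// {1}/s (si_suml S)//.
  by apply: eq_bigr => i _; rewrite Q_ip.
(* The weight [(2 * C)^-1] is chosen so that [Q_sum_le] applied to [s] produces half of
   [nrm s ^+ 2], which is absorbed on the left. *)
have le : nrm s ^+ 2 <= \sum_(i <- F) (C / 2 * nrm (Q i w) ^+ 2 + (2 * C)^-1 * nrm (Q i s) ^+ 2).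
  rewrite e; apply: ler_sum => i _.
  apply: le_trans (ler_norm _) _; apply: le_trans (si_cauchy_schwarz S (HQ i) (Q_H i Hs)) _.
  have := sqr_ge0 (C * nrm (Q i w) - nrm (Q i s)).
  move: (nrm _) (nrm _) => b a ab.
  have -> : C / 2 * a ^+ 2 + (2 * C)^-1 * b ^+ 2 = ((C * a - b) ^+ 2 / (2 * C)) + a * b.
    by field; rewrite gt_eqF.
  by rewrite lerDr divr_ge0// mulr_ge0// ltW.
move: le; rewrite big_split/= -!mulr_sumr.
have := Q_sum_le F Hs.
have C2 : 0 < (2 * C)^-1 by rewrite invr_gt0 mulr_gt0.
rewrite -(ler_pM2l C2).
have -> : (2 * C)^-1 * (C * nrm s ^+ 2) = nrm s ^+ 2 / 2 by field; rewrite gt_eqF.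
by move: (_ * \sum_(i <- F) _) => *; lra.
Qed.

Lemma Q_usum w : H w -> exists s, is_usum H ip (fun i => Q i w) s.
Proof.
move=> Hw; apply: (@usum_exists _ _ _ _ S _ _ (fun i => nrm (Q i w) ^+ 2) C (C * nrm w ^+ 2)) => //.
- by move=> i; exact: Q_H.
- exact: ltW.
- by move=> i; exact: sqr_ge0.
- by move=> F; exact: Q_sum_le.
- by move=> F; exact: Q_sum_dual.
Qed.

Context {L P : E -> E}.
Hypothesis LP : forall w, H w -> is_usum H ip (fun i => Q i w) (L w).
Hypothesis PP : forall w, H w -> is_oproj ip W w (P w).

Let HL w : H w -> H (L w). Proof. by move=> /LP[]. Qed.

(** Finite partial sums are symmetric by [Q_sym], and one finite set approximates both sides.
    Symmetry later stands in for linearity: [L (x + y)] is expanded only inside an inner product, by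
    moving [L] to the other side. *)
Lemma L_sym w z : H w -> H z -> ip (L w) z = ip w (L z).
Proof.
move=> Hw Hz; apply/eqP; rewrite -subr_eq0 -normr_le0; apply/ler_addgt0Pr => e e0.
rewrite add0r.
have e2 : 0 < e / 2 by rewrite divr_gt0.
have HQ x : H x -> forall i, H (Q i x) by move=> Hx i; exact: Q_H.
have [F FP] := usum_ip_le S (HQ _ Hw) Hz (LP Hw) e2.
have [G GP] := usum_ip_le S (HQ _ Hz) Hw (LP Hz) e2.
have := FP _ (fsubsetUl F G); have := GP _ (fsubsetUr F G).
have -> : \sum_(i <- (F `|` G)%fset) ip (Q i z) w = \sum_(i <- (F `|` G)%fset) ip (Q i w) z.
  by apply: eq_bigr => i _; rewrite Q_sym// (siC S)//; exact: Q_H.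
rewrite (siC S (HL Hz) Hw) => h1 h2.
rewrite -[X in `|X|](subrKA (\sum_(i <- (F `|` G)%fset) ip (Q i w) z)) ltW//.
apply: le_lt_trans (ler_normD _ _) _; rewrite [ltRHS](splitr e) ltrD//.
by rewrite distrC.
Qed.

Lemma L_orthW w p : H w -> W p -> ip (L w) p = 0.
Proof.
move=> Hw Wp; have [Hp Wip] := (WP p).1 Wp; have HQ i : H (Q i w) by exact: Q_H.
apply/eqP; rewrite -normr_le0; apply/ler_addgt0Pr => e e0; rewrite add0r.
have [F FP] := usum_ip_le S HQ Hp (LP Hw) e0.
have := FP _ (fsubset_refl F); rewrite big1 ?subr0 => [/ltW//|i _].
by rewrite Q_orthW.
Qed.

Lemma L_upper w : H w -> ip (L w) w <= C * nrm w ^+ 2.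
Proof.
move=> Hw; apply: (usum_ip_unique S _ Hw (LP Hw)) => [i|F]; first exact: Q_H.
by under eq_bigr do rewrite Q_self//; exact: Q_sum_le.
Qed.

(** The summands are nonnegative, so no finite partial sum exceeds the limit of the unconditional
    sum. *)
Lemma L_partial (F : {fset I}) w : H w -> \sum_(i <- F) nrm (Q i w) ^+ 2 <= ip (L w) w.
Proof.
move=> Hw; apply/ler_addgt0Pr => e e0.
have HQ i : H (Q i w) by exact: Q_H.
have [F0 FP] := usum_ip_le S HQ Hw (LP Hw) e0.
have := FP _ (fsubsetUl F0 F); rewrite (eq_bigr (fun i => nrm (Q i w) ^+ 2)); last first.
  by move=> i _; rewrite Q_self.
have : \sum_(i <- F) nrm (Q i w) ^+ 2 <= \sum_(i <- (F0 `|` F)%fset) nrm (Q i w) ^+ 2.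
  rewrite (big_fsetID _ (mem F) (F0 `|` F)%fset)/=.
  have -> : [fset x in (F0 `|` F)%fset | x \in F]%fset = F.
    by apply/fsetP => x; rewrite !inE /=; case: (x \in F); rewrite // ?andbF ?andbT ?orbT.
  by rewrite lerDl sumr_ge0// => i _; exact: sqr_ge0.
by rewrite ltr_norml => ? /andP[? ?]; lra.
Qed.

(* The sum of the local fields [ext i (Q i w)] differs from [w] by an element
   of [W], hence bounds [w] when [w] is orthogonal to [W]. *)
Lemma L_lower w : H w -> (forall p, W p -> ip w p = 0) -> nrm w ^+ 2 <= C * ip (L w) w.
Proof.
move=> Hw wW; pose u i := ext i (Q i w).
have HQ i : H (Q i w) by exact: Q_H.
have Hu i : H (u i) by exact: ext_H.
pose q := ip (L w) w.
(* Pythagoras for the mutually orthogonal [u i]; [nl_sum] on a singleton bounds the local energy of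
   [Q i w] by its full energy. *)
have sq (F : {fset I}) : nrm (\sum_(i <- F) u i) ^+ 2 <= C * \sum_(i <- F) nrm (Q i w) ^+ 2.
  have -> : nrm (\sum_(i <- F) u i) ^+ 2 = \sum_(i <- F) nrm (u i) ^+ 2.
    rewrite (nrm_sqr S); last exact: (si_sum S).
    rewrite (si_suml S)//; last exact: (si_sum S).
    rewrite [LHS]big_seq [RHS]big_seq; apply: eq_bigr => i iF.
    rewrite (si_sumr S)// (big_fsetD1 i)//= (nrm_sqr S)// big_seq big1 ?addr0// => j.
    by rewrite !inE => /andP[ji _]; apply: ext_orth => //; rewrite eq_sym.
  rewrite mulr_sumr; apply: ler_sum => i _; apply: le_trans (ext_le i (HQ i)) _.
  rewrite ler_pM2l//; have := nl_sum [fset i]%fset (HQ i).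
  by rewrite big_seq_fset1.
have qF (F : {fset I}) : \sum_(i <- F) nrm (Q i w) ^+ 2 <= q by exact: L_partial.
have q0 : 0 <= q by have := qF fset0; rewrite big_seq_fset0.
have [s us] : exists s, is_usum H ip u s.
  apply: (@usum_exists _ _ _ _ S _ _ (fun i => nrm (Q i w) ^+ 2) C q) => //.
  - exact: ltW.
  - by move=> i; exact: sqr_ge0.
have [Hs sP] := us.
have sle : nrm s <= Num.sqrt (C * q).
  apply/ler_addgt0Pr => e /sP[F /(_ _ (fsubset_refl _)) sF].
  have HF : H (\sum_(i <- F) u i) by exact: (si_sum S).
  have := nrmD S (siB S Hs HF) HF; rewrite subrK.
  have : nrm (\sum_(i <- F) u i) <= Num.sqrt (C * q).
    rewrite -(@ler_pXn2r _ 2%N)// ?nnegrE ?sqrtr_ge0//.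
    rewrite (sqr_sqrtr (mulr_ge0 (ltW C0) q0)).
    by apply: le_trans (sq F) _; rewrite ler_pM2l.
  by move: sF; move: (nrm _) (nrm _) (nrm _) (Num.sqrt _) => *; lra.
have Wws : W (w - s).
  apply/WP; split=> [|i]; first exact: (siB S).
  (* The first two terms are in [Wi i] by [Q_subW] and [ext_W]; the third is a limit of finite sums
     of [u j] with [j != i], which are in [Wi i] by [ext_W']. *)
  have -> : w - s = (w - Q i w) - (u i - Q i w) - (s - u i).
    by rewrite !opprB !subrKA.
  apply: (csB (cWi i)); first by apply: (csB (cWi i)); [exact: Q_subW|exact: ext_W].
  apply: (cs_closed (cWi i)) => [|e /sP[F FP]]; first exact: (siB S).
  have Fi := FP (i |` F)%fset (fsubsetU1 _ _).
  exists (\sum_(j <- (i |` F)%fset `\ i) u j)%fset.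
    apply: (cs_sum (cWi i)) => j; rewrite !inE => /andP[ji _].
    by apply: ext_W' => //.
  by move: Fi; rewrite (big_fsetD1 i) ?fset1U1//= opprD addrA.
have : nrm w ^+ 2 <= nrm w * nrm s.
  rewrite (nrm_sqr S)//.
  have -> : ip w w = ip w s.
    by apply/eqP; rewrite -subr_eq0 -(siBr S)// wW.
  exact: le_trans (ler_norm _) (si_cauchy_schwarz S Hw Hs).
have := nrm_ge0 ip w; rewrite le_eqVlt => /predU1P[<- _|w0].
  by rewrite expr0n/= mulr_ge0// ltW.
rewrite expr2 ler_pM2l// => ws.
rewrite -expr2 -(sqr_sqrtr (mulr_ge0 (ltW C0) q0)).
rewrite ler_pXn2r ?nnegrE ?sqrtr_ge0//; exact: (le_trans ws sle).
Qed.

Section Iteration.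
(** The sharp choice would be the inverse of [C] for [c] and [C] for [C']; the slack allows
    [0 < c < C'] whatever the value of [C]. *)
Variables (c C' gamma : R).
Hypotheses (cC : c * C <= 1) (CC' : C <= C') (g0 : 0 < gamma).
Let m := Num.max (1 - c * gamma) `|1 - C' * gamma|.

Let m0 : 0 <= m. Proof. by rewrite le_max normr_ge0 orbT. Qed.

Let B v z := ip v z - gamma * ip (L v) z.

(** On the orthogonal complement of [W], [L_lower] and [L_upper] place the Rayleigh quotient of [L]
    between [c] and [C'], hence that of [1 - gamma L] between [1 - C' * gamma] and
    [1 - c * gamma]. *)
Let B_bound v : H v -> (forall p, W p -> ip v p = 0) -> `|B v v| <= m * nrm v ^+ 2.
Proof.
move=> Hv vW; have lo := L_lower Hv vW; have up := L_upper Hv.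
have n0 : 0 <= nrm v ^+ 2 by exact: sqr_ge0.
rewrite /B -(nrm_sqr S)//; move: lo up n0; set n := nrm v ^+ 2; set q := ip (L v) v => lo up n0.
have q0 : 0 <= q by have := le_trans n0 lo; rewrite pmulr_rge0.
have cq : c * n <= q.
  have [c0|c0] := leP 0 c.
    apply: le_trans (ler_wpM2l c0 lo) _; rewrite mulrA ler_piMl//.
  by apply: le_trans q0; rewrite nmulr_rle0.
have Cq : q <= C' * n by apply: le_trans up _; rewrite ler_wpM2r.
have h1 : n - gamma * q <= m * n.
  apply: (@le_trans _ _ ((1 - c * gamma) * n)).
    by rewrite mulrBl mul1r lerD2l lerN2 mulrAC mulrC ler_pM2l.
  by rewrite ler_wpM2r// le_max lexx.
have h2 : gamma * q - n <= m * n.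
  apply: (@le_trans _ _ (`|1 - C' * gamma| * n)); last first.
    by rewrite ler_wpM2r// le_max lexx orbT.
  apply: (@le_trans _ _ ((C' * gamma - 1) * n)).
    by rewrite mulrBl mul1r lerD2r mulrAC mulrC ler_pM2r.
  by rewrite ler_wpM2r// distrC ler_norm.
by rewrite ler_norml; apply/andP; split; lra.
Qed.

(** [r] is the current error and [r + p] the current iterate. Against any [z], [L (r + p)] gives the
    inner product of [r + p] with [L z], where [p] disappears because [L z] is orthogonal to [W]; so
    the new error represents the form [B r]. Its norm is then bounded as for a self-adjoint
    operator, from the diagonal values of [B]. *)
Let step r p : H r -> W p -> (forall z, W z -> ip r z = 0) ->
  [/\ H (r - gamma *: L (r + p)), (forall z, W z -> ip (r - gamma *: L (r + p)) z = 0)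
    & nrm (r - gamma *: L (r + p)) <= m * nrm r].
Proof.
move=> Hr Wp rW; have [Hp _] := (WP p).1 Wp.
have Hrp : H (r + p) by exact: (siD S).
have HLrp := HL Hrp; have HgL := siZ S gamma HLrp.
set r' := r - _; have Hr' : H r' by exact: (siB S).
have r'W z : W z -> ip r' z = 0.
  move=> Wz; have [Hz _] := (WP z).1 Wz.
  by rewrite (siBl S)// (siZl S)// L_orthW// rW// mulr0 subr0.
split=> //.
have r'E z : H z -> ip r' z = B r z.
  move=> Hz; rewrite (siBl S)// (siZl S)// /B; congr (_ - _ * _).
  rewrite !L_sym// (siDl S)//; last exact: HL.
  by rewrite [ip p _](siC S)//; [rewrite L_orthW// addr0|exact: HL].
have [r0|rn0] := eqVneq (nrm r) 0.
  rewrite r0 mulr0 (si_eq0 (ip:=ip) (H:=H))// r'E// /B L_sym//.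
  by rewrite !(si_null S Hr)// ?mulr0 ?subr0//; exact: HL.
have rp : 0 < nrm r by rewrite lt_neqAle eq_sym rn0 nrm_ge0.
have [->|r'n0] := eqVneq (nrm r') 0; first by rewrite mulr_ge0// ltW.
have r'p : 0 < nrm r' by rewrite lt_neqAle eq_sym r'n0 nrm_ge0.
(* [z] is the new error rescaled to the norm of [r]. Then [B r z = nrm r * nrm r'], while the two
   diagonal terms of the polarization identity have squared norms adding up to [4 * nrm r ^+ 2]. *)
pose t := nrm r / nrm r'; pose z := t *: r'.
have t0 : 0 < t by rewrite divr_gt0.
have Hz : H z by exact: (siZ S).
have zW y : W y -> ip z y = 0.
  by move=> Wy; have [Hy _] := (WP y).1 Wy; rewrite (siZl S)// r'W// mulr0.
have Hrz : H (r + z) by exact: (siD S).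
have Hrz' : H (r - z) by exact: (siB S).
(* Polarization needs a symmetric bilinear [B]; additivity of [L] under the inner product is
   obtained from [L_sym]. *)
have pol : 4 * B r z = B (r + z) (r + z) - B (r - z) (r - z).
  have LL x : H x -> ip (L (r + z)) x = ip (L r) x + ip (L z) x.
    by move=> Hx; rewrite !L_sym// (siDl S)//; exact: HL.
  have LL' x : H x -> ip (L (r - z)) x = ip (L r) x - ip (L z) x.
    by move=> Hx; rewrite !L_sym// (siBl S)//; exact: HL.
  have HLr := HL Hr; have HLz := HL Hz.
  rewrite /B LL// LL'// !(siDr S Hr Hz)// !(siBr S Hr Hz)// (siDl S)// (siBl S)//.
  rewrite (siDl S Hr)// (siBl S Hr)// (siC S Hz Hr) (L_sym Hz Hr) (siC S Hz HLr); ring.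
have zn : nrm z = nrm r.
  by rewrite (nrmZ S)// gtr0_norm// /t mulfVK.
have h1 := B_bound Hrz; have h2 := B_bound Hrz'.
have rzW y : W y -> ip (r + z) y = 0.
  by move=> Wy; have [Hy _] := (WP y).1 Wy; rewrite (siDl S)// rW// zW// addr0.
have rzW' y : W y -> ip (r - z) y = 0.
  by move=> Wy; have [Hy _] := (WP y).1 Wy; rewrite (siBl S)// rW// zW// subr0.
have {}h1 := h1 rzW; have {}h2 := h2 rzW'.
have Brz : B r z = nrm r * nrm r'.
  by rewrite -r'E// (siZr S)// -(nrm_sqr S)// /t expr2 mulrA mulfVK.
have par : nrm (r + z) ^+ 2 + nrm (r - z) ^+ 2 = 4 * nrm r ^+ 2.
  rewrite (nrmD_sqr S)// (nrmB_sqr S)// zn; ring.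
have : 4 * B r z <= 4 * (m * nrm r ^+ 2).
  rewrite pol mulrCA -par mulrDr.
  move: h1 h2; rewrite !ler_norml; move: (m * _) (m * _) (B _ _) (B _ _).
  by move=> a b d e /andP[? ?] /andP[? ?]; lra.
rewrite ler_pM2l// Brz expr2 mulrCA ler_pM2l//.
Qed.

Theorem iterate_bound k w : H w ->
  nrm (iter k (fun v => v - gamma *: L v) w - P w) <= m ^+ k * nrm w.
Proof.
move=> Hw; have [WPw PwP] := PP Hw; have [HPw _] := (WP _).1 WPw.
have Hr : H (w - P w) by exact: (siB S).
have le0 : nrm (w - P w) <= nrm w.
  rewrite -(@ler_pXn2r _ 2%N)// ?nnegrE ?sqrtr_ge0//.
  have := nrmD_sqr S Hr HPw; rewrite subrK PwP// mulr0 addr0 => ->.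
  by rewrite lerDl sqr_ge0.
apply: (@le_trans _ _ (m ^+ k * nrm (w - P w))); last by rewrite ler_wpM2l// exprn_ge0.
suff [_ _ //] : [/\ H (iter k (fun v => v - gamma *: L v) w - P w),
    (forall z, W z -> ip (iter k (fun v => v - gamma *: L v) w - P w) z = 0)
  & nrm (iter k (fun v => v - gamma *: L v) w - P w) <= m ^+ k * nrm (w - P w)].
elim: k => [|k [Hk kW kle]]; first by rewrite expr0 mul1r.
have [] := step Hk WPw kW; rewrite subrK.
rewrite iterS; set x := iter k _ w in Hk kW kle *.
rewrite -addrA [- P w - _]addrC addrA => H1 H2 H3.
split=> //; apply: le_trans H3 _; by rewrite exprS -mulrA ler_wpM2l.
Qed.

End Iteration.
End Schwarz.

(** * Differential calculus on R3 *)

Section SmoothReal.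
Context {R : realType}.
Implicit Types (f g : R -> R) (n : nat).

(** C^n on the line, with a derivative supplied as a function at each level, so that the calculus
    rules are proved by induction on [n] instead of through iterated derivatives. *)
Fixpoint Dk n f : Prop :=
  if n is m.+1 then exists2 g : R -> R, (forall x : R, is_derive x 1 f (g x)) & Dk m g
  else continuous f.

Lemma is_derive_continuous f g : (forall x : R, is_derive x 1 f (g x)) -> continuous f.
Proof.
move=> df x; apply: differentiable_continuous; apply/derivable1_diffP.
by case: (df x).
Qed.

Lemma Dk_le n f : Dk n.+1 f -> Dk n f.
Proof.
elim: n f => [|n IH] f [g dfg Dg]; first exact: is_derive_continuous dfg.
by exists g => //; exact: IH.
Qed.

Lemma Dk_continuous n f : Dk n f -> continuous f.
Proof. by elim: n f => // n IH f /Dk_le /IH. Qed.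

Lemma Dk_cst n (c : R) : Dk n (cst c).
Proof.
elim: n c => [|n IH] c; first exact: cst_continuous.
by exists (cst 0) => // x; exact: is_derive_cst.
Qed.

Lemma Dk_id n : Dk n id.
Proof.
case: n => [|n]; first by move=> x; exact: cvg_id.
by exists (cst 1) => [x|]; [exact: is_derive_id|exact: Dk_cst].
Qed.

Lemma DkD n f g : Dk n f -> Dk n g -> Dk n (fun x => f x + g x).
Proof.
elim: n f g => [|n IH] f g; first by move=> cf cg x; exact: (continuousD (cf x) (cg x)).
move=> [f' df Df'] [g' dg Dg']; exists (fun x => f' x + g' x); last exact: IH.
by move=> x; exact: is_deriveD.
Qed.

Lemma DkM n f g : Dk n f -> Dk n g -> Dk n (fun x => f x * g x).
Proof.
elim: n f g => [|n IH] f g; first by move=> cf cg x; exact: (continuousM (cf x) (cg x)).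
move=> Df Dg; have [f' df Df'] := Df; have [g' dg Dg'] := Dg.
exists (fun x => f x * g' x + g x * f' x).
  by move=> x; exact: is_deriveM.
by apply: DkD; apply: IH => //; exact: Dk_le.
Qed.

Lemma DkZ n (c : R) f : Dk n f -> Dk n (fun x => c * f x).
Proof. by move=> Df; apply: DkM => //; exact: Dk_cst. Qed.

Lemma DkN n f : Dk n f -> Dk n (fun x => - f x).
Proof.
by move=> Df; under eq_fun do rewrite -mulN1r; exact: DkZ.
Qed.

Lemma Dk_comp n f g : Dk n f -> Dk n g -> Dk n (f \o g).
Proof.
elim: n f g => [|n IH] f g; first by move=> cf cg x; exact: (continuous_comp (cg x) (cf _)).
move=> Df Dg; have [f' df Df'] := Df; have [g' dg Dg'] := Dg.
exists (fun x => f' (g x) * g' x).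
  by move=> x; have := @is_derive1_comp _ f g x _ _ (df (g x)) (dg x).
by apply: DkM => //; apply: (IH f' g) => //; exact: Dk_le.
Qed.

Lemma Dk_inv n f : (forall x, f x != 0) -> Dk n f -> Dk n (fun x => (f x)^-1).
Proof.
move=> f0; elim: n => [|n IH].
  by move=> cf x; apply: continuousV; [exact: f0|exact: cf].
move=> Df; have [f' df Df'] := Df.
exists (fun x => - ((f x)^-1 * (f x)^-1) * f' x).
  move=> x; have := is_deriveV (f0 x) (df x).
  by rewrite -exprVn expr2.
by apply: DkM => //; apply: DkN; apply: DkM; exact: IH (Dk_le Df).
Qed.

(** The factor [x^-1 ^+ n] makes the family stable under differentiation: the derivative of a member
    is a combination of the next two, see [is_derive_bump]. Smoothness of the flat function [bump 0]
    follows by induction. *)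
Definition bump n (x : R) : R := if 0 < x then x^-1 ^+ n * expR (- x^-1) else 0.

(** From exp y >= y^(n+1) / (n+1)! at y = 1/x. *)
Lemma bump_le n (x : R) : 0 < x -> bump n x <= n.+1`!%:R * x.
Proof.
move=> x0; rewrite /bump x0 expRN.
have := expR_ge1Dxn n (ltW (_ : 0 < x^-1)); rewrite invr_gt0 => /(_ x0) le.
have le' : x^-1 ^+ n.+1 / n.+1`!%:R <= expR x^-1 by apply: le_trans le; rewrite lerDr.
rewrite ler_pdivrMr ?expR_gt0//.
have f0 : 0 < n.+1`!%:R :> R by rewrite ltr0n fact_gt0.
move: le'; rewrite ler_pdivrMr// mulrC => le'.
rewrite mulrAC -ler_pdivrMr//.
by apply: le_trans le'; rewrite exprSr.
Qed.

Lemma bump_ge0 n (x : R) : 0 <= bump n x.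
Proof.
rewrite /bump; case: ifPn => // x0.
by rewrite mulr_ge0 ?expR_ge0// exprn_ge0// invr_ge0 ltW.
Qed.

Lemma bump_gt0 n (x : R) : 0 < x -> 0 < bump n x.
Proof. by move=> x0; rewrite /bump x0 mulr_gt0 ?expR_gt0// exprn_gt0// invr_gt0. Qed.

Lemma is_derive_bump n (x : R) :
  is_derive x 1 (bump n) (bump n.+2 x - n%:R * bump n.+1 x).
Proof.
have [x0|x0|<-] := ltgtP 0 x.
- have E : is_derive x 1 (fun y : R => y^-1 ^+ n * expR (- y^-1))
      (bump n.+2 x - n%:R * bump n.+1 x).
    have iV : is_derive x 1 (fun y : R => y^-1) (- x ^- 2).
      have xn0 : (@id R) x != 0 by rewrite gt_eqF.
      by have := is_deriveV xn0 (is_derive_id x 1); rewrite [_ *: _]mulr1.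
    have iN : is_derive x 1 (fun y : R => expR (- y^-1)) (expR (- x^-1) * x ^- 2).
      have := @is_derive1_comp _ expR (fun y : R => - y^-1) x _ _ _ (is_deriveN iV).
      by rewrite opprK; apply; exact: is_derive_expR.
    have iX : is_derive x 1 (fun y : R => y^-1 ^+ n) (n%:R * x^-1 ^+ n.-1 * (- x ^- 2)).
      have -> : (fun y : R => y^-1 ^+ n) = (fun y : R => y^-1) ^+ n.
        by elim: n => [|k IH]; rewrite ?expr0// exprS -IH; apply/funext => y; rewrite exprS.
      exact: (is_deriveX n iV).
    have := is_deriveM iX iN.
    move/is_derive_eq; apply; rewrite /bump x0 /GRing.scale/=.
    case: n {iX} => [|n]; rewrite -!exprVn ?mul0r ?subr0 ?expr0/=; first by ring.
    rewrite !exprS; ring.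
  apply: (near_eq_is_derive _ E).
  near=> y; rewrite /bump ifT//.
  by near: y; exact: lt_nbhsr.
- have -> : bump n.+2 x - n%:R * bump n.+1 x = 0.
    by rewrite /bump !ifF ?mulr0 ?subrr// ltNge ltW.
  apply: (near_eq_is_derive _ (is_derive_cst 0 x 1)).
  near=> y; rewrite /bump ifF// ltNge ltW//.
  by near: y; exact: lt_nbhsl.
(* At 0 the difference quotient is [bump n.+1 h] for positive [h] and 0 for negative [h]; it tends
   to 0 by [bump_le]. *)
- have b0 k : bump k 0 = 0 by rewrite /bump ltxx.
  rewrite !b0 mulr0 subr0.
  have lim : h^-1 *: ((bump n \o shift 0) (h *: 1) - bump n 0) @[h --> 0^'] --> (0 : R).
    apply/cvgrPdist_le => e e0.
    have K0 : 0 < n.+2`!%:R :> R by rewrite ltr0n fact_gt0.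
    near=> h; rewrite sub0r normrN b0 subr0 /= addr0 [_ *: 1]mulr1 [_ *: _]mulrC.
    have [h0|h0] := ltP 0 h; last by rewrite /bump ifF ?mul0r ?normr0 ?ltW// ltNge h0.
    have -> : bump n h / h = bump n.+1 h by rewrite /bump h0 exprSr mulrAC.
    rewrite ger0_norm ?bump_ge0//; apply: le_trans (bump_le _ h0) _.
    rewrite mulrC -ler_pdivlMr//.
    apply: le_trans (ler_norm _) _.
    near: h; apply: dnbhs0_le; by rewrite divr_gt0.
  have cv : derivable (bump n) 0 1 by apply/cvg_ex; exists 0.
  by apply: DeriveDef => //; exact: cvg_lim lim.
Unshelve. all: by end_near. Qed.

Lemma Dk_bump m n : Dk m (bump n).
Proof.
elim: m n => [|m IH] n; first exact: is_derive_continuous (is_derive_bump n).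
exists (fun x => bump n.+2 x - n%:R * bump n.+1 x); first exact: is_derive_bump.
apply: DkD => //; under [X in Dk _ X]eq_fun do rewrite -mulNr.
exact: DkZ.
Qed.

Section Cutoff.
Variables (a b : R) (ab : a < b).

Definition cutoff (s : R) : R := bump 0 (b - s) / (bump 0 (b - s) + bump 0 (s - a)).

Let den s : 0 < bump 0 (b - s) + bump 0 (s - a).
Proof.
have [sb|bs] := ltP s b; first by rewrite ltr_pwDl ?bump_ge0// bump_gt0// subr_gt0.
by rewrite ltr_wpDl ?bump_ge0// bump_gt0// subr_gt0 (lt_le_trans ab).
Qed.

Lemma Dk_cutoff n : Dk n cutoff.
Proof.
have d1 : Dk n (fun s => bump 0 (b - s)).
  apply: (Dk_comp (Dk_bump n 0)); apply: DkD; first exact: Dk_cst.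
  by apply: DkN; exact: Dk_id.
apply: DkM => //; apply: Dk_inv => [s|]; first by rewrite gt_eqF// den.
apply: DkD => //; apply: (Dk_comp (Dk_bump n 0)); apply: DkD; last exact: Dk_cst.
exact: Dk_id.
Qed.

Lemma cutoff_eq1 s : s <= a -> cutoff s = 1.
Proof.
move=> sa; rewrite /cutoff [bump 0 (s - a)]/bump ifF; last by rewrite subr_gt0 ltNge sa.
by rewrite addr0 divff// gt_eqF// bump_gt0// subr_gt0 (le_lt_trans sa).
Qed.

Lemma cutoff_eq0 s : b <= s -> cutoff s = 0.
Proof.
move=> bs; rewrite /cutoff {1}/bump ifF ?mul0r//.
by rewrite subr_gt0 ltNge bs.
Qed.

End Cutoff.
End SmoothReal.

(** * Partial derivatives on R3 *)

Section SmoothR3.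
Context {R : realType}.
Implicit Types (f g : R3 R -> R) (n : nat) (x y v : R3 R) (j k : 'I_3).

(** The same encoding as [Dk], for partial derivatives. All the [Ck n] together amount to [smooth],
    by [smoothP]; the recursive form is the one suited to induction. *)
Fixpoint Ck n f : Prop := continuous f /\
  if n is m.+1 then forall j,
    exists2 g : R3 R -> R, (forall x, is_derive x (basis j) f (g x)) & Ck m g
  else True.

Lemma Ck_continuous n f : Ck n f -> continuous f.
Proof. by case: n => [|n] []. Qed.

Lemma Ck_le n f : Ck n.+1 f -> Ck n f.
Proof.
elim: n f => [|n IH] f [cf df]; split=> // j.
by have [g dg Cg] := df j; exists g => //; exact: IH.
Qed.

Lemma CkS n f : Ck n.+1 f -> forall j,
  (forall x, is_derive x (basis j) f (partial j f x)) /\ Ck n (partial j f).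
Proof.
move=> [_ df] j; have [g dg Cg] := df j.
suff -> : partial j f = g by [].
by apply/funext => x; exact: derive_val.
Qed.

Lemma smoothP f : smooth f <-> forall n, Ck n f.
Proof.
split=> [sf n|Cf].
  have H m : forall s, Ck m (foldr partial f s).
    elim: m => [|m IH] s; first by split=> //; case: (sf s).
    split=> [|j]; first by case: (sf s).
    exists (foldr partial f (j :: s)); last exact: IH.
    by move=> x; case: (sf s) => _ /(_ x j); exact: derivableP.
  exact: H n [::].
have H s : forall m, Ck m (foldr partial f s).
  elim: s => [//|j s IH] m /=.
  by have [_] := CkS (IH m.+1) j.
move=> s; split; first exact: Ck_continuous (H s 0%N).
by move=> x j; have [+ _] := CkS (H s 1%N) j => /(_ x)[].
Qed.

Lemma smooth_Ck n f : smooth f -> Ck n f. Proof. by move/smoothP. Qed.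

Lemma smooth_continuous f : smooth f -> continuous f.
Proof. by move=> /(smooth_Ck 0) /Ck_continuous. Qed.

Lemma smooth_is_derive f j x : smooth f -> is_derive x (basis j) f (partial j f x).
Proof. by move=> sf; have [] := CkS (smooth_Ck 1 sf) j. Qed.

Lemma smooth_partial f j : smooth f -> smooth (partial j f).
Proof. by move/smoothP => Cf; apply/smoothP => n; have [] := CkS (Cf n.+1) j. Qed.

Lemma Ck_cst n (c : R) : Ck n (fun=> c).
Proof.
elim: n c => [|n IH] c; (split; first exact: cst_continuous) => // j.
by exists (fun=> 0) => // x; exact: is_derive_cst.
Qed.

Lemma CkD n f g : Ck n f -> Ck n g -> Ck n (fun x => f x + g x).
Proof.
elim: n f g => [|n IH] f g Cf Cg; have cf := Ck_continuous Cf; have cg := Ck_continuous Cg;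
  (split; first by move=> x; exact: (continuousD (cf x) (cg x))) => // j.
have [_ /(_ j)[f' df Cf']] := Cf; have [_ /(_ j)[g' dg Cg']] := Cg.
exists (fun x => f' x + g' x); last exact: IH.
by move=> x; exact: is_deriveD.
Qed.

Lemma CkM n f g : Ck n f -> Ck n g -> Ck n (fun x => f x * g x).
Proof.
elim: n f g => [|n IH] f g Cf Cg; have cf := Ck_continuous Cf; have cg := Ck_continuous Cg;
  (split; first by move=> x; exact: (continuousM (cf x) (cg x))) => // j.
have [_ /(_ j)[f' df Cf']] := Cf; have [_ /(_ j)[g' dg Cg']] := Cg.
exists (fun x => f x * g' x + g x * f' x); last by apply: CkD; apply: IH => //; exact: Ck_le.
by move=> x; exact: is_deriveM.
Qed.

Lemma CkZ n (c : R) f : Ck n f -> Ck n (fun x => c * f x).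
Proof. by move=> Cf; apply: CkM => //; exact: Ck_cst. Qed.

Lemma CkN n f : Ck n f -> Ck n (fun x => - f x).
Proof. by move=> Cf; under eq_fun do rewrite -mulN1r; exact: CkZ. Qed.

Lemma Ck_sum n (I : Type) (r : seq I) (F : I -> R3 R -> R) : (forall i, Ck n (F i)) ->
  Ck n (fun x => \sum_(i <- r) F i x).
Proof.
move=> CF; elim: r => [|i r IH].
  by under eq_fun do rewrite big_nil; exact: Ck_cst.
by under eq_fun do rewrite big_cons; exact: CkD.
Qed.

Lemma coordD x y j : coord (x + y) j = coord x j + coord y j.
Proof. by rewrite /coord; case: j => -[|[|[|]]]//= i; rewrite addr0. Qed.

Lemma coordZ (a : R) x j : coord (a *: x) j = a * coord x j.
Proof. by rewrite /coord; case: j => -[|[|[|]]]//= i; rewrite mulr0. Qed.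

Lemma coordN x j : coord (- x) j = - coord x j.
Proof. by rewrite -scaleN1r coordZ mulN1r. Qed.

Lemma coordB x y j : coord (x - y) j = coord x j - coord y j.
Proof. by rewrite coordD coordN. Qed.

Lemma coord_basis j k : coord (basis j : R3 R) k = (j == k)%:R.
Proof.
by rewrite /coord /basis; case: k => -[|[|[|]]]//= i; case: j => -[|[|[|]]]//= i'.
Qed.

Lemma continuous_coord j : continuous (fun x : R3 R => coord x j).
Proof.
rewrite /coord; case: j => -[|[|[|]]]//= i x.
- by apply: continuous_comp; exact: cvg_fst.
- by apply: continuous_comp; [exact: cvg_fst|exact: cvg_snd].
- exact: cvg_snd.
Qed.

Lemma is_derive_affine (f : R3 R -> R) x v (c : R) :
  (forall h : R, f (h *: v + x) = h * c + f x) -> is_derive x v f c.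
Proof.
move=> fE.
have lim : h^-1 *: ((f \o shift x) (h *: v) - f x) @[h --> 0^'] --> c.
  apply: cvg_near_cst; near=> h; rewrite /= fE addrK [_ *: _]mulrA mulVf ?mul1r//.
  by near: h; exact: nbhs_dnbhs_neq.
have cv : derivable f x v by apply/cvg_ex; exists c.
by apply: DeriveDef => //; exact: cvg_lim lim.
Unshelve. all: by end_near. Qed.

Lemma Ck_coord n j : Ck n (fun x => coord x j).
Proof.
case: n => [|n]; (split; first exact: continuous_coord) => // k.
exists (fun=> (k == j)%:R); last exact: Ck_cst.
by move=> x; apply: is_derive_affine => h; rewrite coordD coordZ coord_basis.
Qed.

Lemma is_derive_line (f : R3 R -> R) y v (s d : R) :
  is_derive (y + s *: v) v f d -> is_derive s 1 (fun s => f (y + s *: v)) d.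
Proof.
move=> [df dE].
have E : (fun h : R => h^-1 *: (((fun s => f (y + s *: v)) \o shift s) (h *: 1) - f (y + s *: v)))
    = (fun h : R => h^-1 *: ((f \o shift (y + s *: v)) (h *: v) - f (y + s *: v))).
  apply/funext => h /=; congr (_ *: (f _ - _)).
  by rewrite [h *: 1]mulr1 scalerDl addrCA.
apply: DeriveDef; first by rewrite /derivable E.
by rewrite /derive E.
Qed.

(** Restricting [f] to the line [x + s *: v] reduces this to the chain rule in one variable. *)
Lemma is_derive_scalar_comp (e e' : R -> R) f x v (d : R) :
  (forall s : R, is_derive s 1 e (e' s)) -> is_derive x v f d ->
  is_derive x v (e \o f) (e' (f x) * d).
Proof.
move=> de df; have d0 : is_derive (x + 0 *: v) v f d by rewrite scale0r addr0.
have := is_derive1_comp _ (is_derive_line d0).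
rewrite scale0r addr0 => /(_ e (e' (f x)) (de _)) [de1 de2].
have E : (fun h : R => h^-1 *: (((e \o (fun s => f (x + s *: v))) \o shift 0) (h *: 1)
      - (e \o (fun s => f (x + s *: v))) 0))
    = (fun h : R => h^-1 *: (((e \o f) \o shift x) (h *: v) - (e \o f) x)).
  by apply/funext => h /=; rewrite [h *: 1]mulr1 addr0 scale0r addr0 [x + _]addrC.
apply: DeriveDef; first by move: de1; rewrite /derivable E.
by move: de2; rewrite /derive E.
Qed.

Lemma Ck_comp n (e : R -> R) f : Dk n e -> Ck n f -> Ck n (e \o f).
Proof.
elim: n e f => [|n IH] e f De Cf; have ce := Dk_continuous De; have cf := Ck_continuous Cf;
  (split; first by move=> x; exact: (continuous_comp (cf x) (ce _))) => // j.
have [e' de De'] := De; have [_ /(_ j)[f' df Cf']] := Cf.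
exists (fun x => e' (f x) * f' x); last first.
  by apply: CkM => //; apply: (IH e' f) => //; exact: Ck_le.
by move=> x; exact: is_derive_scalar_comp.
Qed.

Lemma mean_value_line f g y v (s : R) : (forall x, is_derive x v f (g x)) ->
  exists2 t : R, `|t| <= `|s| & f (y + s *: v) - f y = s * g (y + t *: v).
Proof.
move=> df.
have dl (t : R) : is_derive t 1 (fun s => f (y + s *: v)) (g (y + t *: v)).
  exact: is_derive_line.
have cl : continuous (fun s : R => f (y + s *: v)) by exact: is_derive_continuous dl.
have [s0|s0] := leP 0 s.
  have [c cs e] := @MVT_segment _ _ _ 0 s s0 (fun t _ => dl t) (continuous_subspaceT cl).
  move: cs; rewrite in_itv/= => /andP[c0 cs].
  exists c; first by rewrite !ger0_norm.
  by move: e; rewrite scale0r addr0 subr0 mulrC.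
have [c cs e] := @MVT_segment _ _ _ s 0 (ltW s0) (fun t _ => dl t) (continuous_subspaceT cl).
move: cs; rewrite in_itv/= => /andP[sc c0].
exists c; first by rewrite (ler0_norm c0) ltr0_norm// lerN2.
by move: e; rewrite scale0r addr0 sub0r => e; rewrite -opprB e mulrN opprK mulrC.
Qed.

Lemma sum3 (V : nmodType) (F : 'I_3 -> V) :
  \sum_(j < 3) F j = F (@Ordinal 3 0 isT) + F (@Ordinal 3 1 isT) + F (@Ordinal 3 2 isT).
Proof.
rewrite !big_ord_recl big_ord0 addr0 addrA.
by congr (F _ + F _ + F _); apply/val_inj.
Qed.

Lemma forall3 (P : 'I_3 -> Prop) :
  P (@Ordinal 3 0 isT) -> P (@Ordinal 3 1 isT) -> P (@Ordinal 3 2 isT) -> forall j, P j.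
Proof.
move=> P0 P1 P2 [[|[|[|//]]] i]; [move: P0|move: P1|move: P2];
  by congr (P _); exact/val_inj.
Qed.

Lemma normR3P x (M : R) : `|x| <= M <-> forall j, `|coord x j| <= M.
Proof.
split=> [|H].
  rewrite /Num.norm/= !ge_max -andbA => /and3P[h1 h2 h3].
  by case => -[|[|[|]]].
by rewrite /Num.norm/= !ge_max (H (@Ordinal 3 0 isT)) (H (@Ordinal 3 1 isT)) (H (@Ordinal 3 2 isT)).
Qed.

Lemma coord_norm x j : `|coord x j| <= `|x|.
Proof. exact: (normR3P x _).1. Qed.

Lemma R3_eqP x y : (forall j, coord x j = coord y j) -> x = y.
Proof.
move: x y => [[a b] c] [[a' b'] c'] H.
by have := H (@Ordinal 3 0 isT); have := H (@Ordinal 3 1 isT); have := H (@Ordinal 3 2 isT);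
  rewrite /coord /= => -> -> ->.
Qed.

(** Go from [x] to [x + v] one coordinate at a time, with the mean value theorem on each edge. As
    the norm is the sup norm, the intermediate points stay within the norm of [v] from [x]. *)
Lemma increment f (g : 'I_3 -> R3 R -> R) x v :
  (forall j y, is_derive y (basis j) f (g j y)) ->
  exists2 p : 'I_3 -> R3 R, (forall j, `|p j - x| <= `|v|) &
    f (x + v) - f x = \sum_(j < 3) coord v j * g j (p j).
Proof.
move=> df.
pose i0 := @Ordinal 3 0 isT; pose i1 := @Ordinal 3 1 isT; pose i2 := @Ordinal 3 2 isT.
pose y1 : R3 R := x + coord v i0 *: basis i0.
pose y2 : R3 R := y1 + coord v i1 *: basis i1.
have [t0 l0 e0] := mean_value_line x (coord v i0) (df i0).
have [t1 l1 e1] := mean_value_line y1 (coord v i1) (df i1).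
have [t2 l2 e2] := mean_value_line y2 (coord v i2) (df i2).
pose p j := if j == i0 then x + t0 *: basis i0 else
  if j == i1 then y1 + t1 *: basis i1 else y2 + t2 *: basis i2.
have ex : y2 + coord v i2 *: basis i2 = x + v.
  rewrite /y2 /y1 -!addrA; congr (x + _).
  apply: R3_eqP; apply: forall3; rewrite !(coordD, coordZ, coord_basis)/=;
    by rewrite !(mulr0, mulr1, addr0, add0r).
have nv i : `|coord v i| <= `|v| by exact: coord_norm.
exists p; last first.
  by rewrite sum3 /p /= -e0 -e1 -e2 ex -/y1 -/y2; ring.
have {}l0 := le_trans l0 (nv _); have {}l1 := le_trans l1 (nv _); have {}l2 := le_trans l2 (nv _).
by apply: forall3; apply/normR3P; apply: forall3;
  rewrite coordB /p/= /y2 /y1 !(coordD, coordZ, coord_basis)/= !(mulr0, mulr1, addr0)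
    ?[coord x _ + _]addrC ?addrK ?addNr ?normr0.
Qed.

Lemma continuous_near_dist f x (e : R) : continuous f -> 0 < e ->
  exists2 d : R, 0 < d & forall y, `|y - x| <= d -> `|f y - f x| <= e.
Proof.
move=> cf e0; have /cvgrPdist_le/(_ _ e0) := cf x.
move=> /nbhs_ballP[d /= d0 H]; exists (d / 2); first by rewrite divr_gt0.
move=> y yx; rewrite distrC; apply: H; rewrite -ball_normE/= distrC.
by apply: (le_lt_trans yx); rewrite ltr_pdivrMr// ltr_pMr// ltr1n.
Qed.

(** In [increment] applied to [h *: v] the intermediate points tend to [x], where the partial
    derivatives are continuous. *)
Lemma is_derive_dir f x v : Ck 1 f ->
  is_derive x v f (\sum_(j < 3) coord v j * partial j f x).
Proof.
move=> Cf; have df j := (CkS Cf j).1; have cp j : continuous (partial j f) := Ck_continuous (CkS Cf j).2.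
set l := \sum_j _.
have lim : h^-1 *: ((f \o shift x) (h *: v) - f x) @[h --> 0^'] --> l.
  apply/cvgrPdist_le => e e0.
  (* Each of the three coordinates contributes at most the norm of [v] times [e']; the added 1
     covers [v = 0]. *)
  pose e' := e / (3 * (`|v| + 1)).
  have v1 : 0 < `|v| + 1 by rewrite ltr_wpDl.
  have e'0 : 0 < e' by rewrite divr_gt0// mulr_gt0.
  have [d d0 dP] : exists2 d : R, 0 < d & forall j y, `|y - x| <= d ->
      `|partial j f y - partial j f x| <= e'.
    have H j : exists d : R, 0 < d /\ forall y, `|y - x| <= d ->
        `|partial j f y - partial j f x| <= e'.
      by have [d] := continuous_near_dist x (cp j) e'0; exists d.
    have [d_ dP] := choice H.
    exists (\big[Num.min/1]_(j < 3) d_ j).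
      by elim/big_ind : _ => [//|a b a0 b0|j _]; [rewrite lt_min a0|case: (dP j)].
    move=> j y yx; have [_] := dP j; apply; apply: (le_trans yx).
    by rewrite (bigD1 j)//= ge_min lexx.
  near=> h.
  have hn0 : h != 0 by near: h; exact: nbhs_dnbhs_neq.
  have [p pP E] := increment x (h *: v) df.
  rewrite /= [h *: v + x]addrC E scaler_sumr /l -sumrB.
  apply: le_trans (ler_norm_sum _ _ _) _.
  apply: (@le_trans _ _ (\sum_(j < 3) (`|v| * e'))).
    apply: ler_sum => j _; rewrite coordZ -mulrA [_ *: _]mulrA mulVf// mul1r -mulrBr normrM.
    apply: ler_pM => //; first exact: coord_norm.
    rewrite distrC; apply: dP; apply: (le_trans (pP j)).
    rewrite normrZ; apply: (@le_trans _ _ (`|h| * (`|v| + 1))).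
      by rewrite ler_wpM2l// lerDl.
    rewrite -ler_pdivlMr//.
    by near: h; apply: dnbhs0_le; rewrite divr_gt0.
  rewrite sumr_const card_ord /e'.
  have -> : `|v| * (e / (3 * (`|v| + 1))) *+ 3 = e * (`|v| / (`|v| + 1)).
    by field; rewrite gt_eqF.
  by rewrite ler_piMr ?(ltW e0)// ler_pdivrMr// mul1r lerDl.
have cv : derivable f x v by apply/cvg_ex; exists l.
by apply: DeriveDef => //; exact: cvg_lim lim.
Unshelve. all: by end_near. Qed.

Lemma compact_boxR3 (M : R) : compact [set x : R3 R | `|x| <= M].
Proof.
have -> : [set x : R3 R | `|x| <= M] =
    (`[-M, M] : set R) `*` (`[-M, M] : set R) `*` (`[-M, M] : set R).
  apply/seteqP; split=> -[[a b] c]/=.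
    by rewrite /Num.norm/= !ge_max !ler_norml -andbA => /and3P[] *; rewrite !in_itv.
  by rewrite !in_itv/= /Num.norm/= !ge_max !ler_norml => -[[-> ->] ->].
by apply: compact_setX; [apply: compact_setX|]; exact: segment_compact.
Qed.

Lemma continuous_bounded f (M : R) : continuous f ->
  exists2 K : R, 0 <= K & forall x, `|x| <= M -> `|f x| <= K.
Proof.
move=> cf; have [M0|M0] := leP 0 M; last first.
  by exists 0 => // x xM; have := le_lt_trans (le_trans (normr_ge0 _) xM) M0; rewrite ltxx.
have [||c _ cP] := @compact_EVT_max _ _ (fun x => `|f x|) _ _ (compact_boxR3 (M := M)).
- by exists 0; rewrite /= normr0.
- apply: continuous_subspaceT => x.
  by apply: cvg_norm; exact: cf.
by exists `|f c| => // x xM; apply: cP; rewrite inE.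
Qed.
End SmoothR3.

(** * Integrals over the unit interval and averages along rays *)

Section UnitInterval.
Context {R : realType}.
Local Notation mu := (@lebesgue_measure R).
Implicit Types (f g : R -> R).

Definition uint f : R := \int[mu]_(t in `[0, 1]) f t.

Lemma continuous_uintegrable f : continuous f -> mu.-integrable `[0, 1] (EFin \o f).
Proof.
move=> cf; apply: continuous_compact_integrable; first exact: segment_compact.
exact: continuous_subspaceT.
Qed.

Lemma uintB f g : continuous f -> continuous g ->
  uint (fun t => f t - g t) = uint f - uint g.
Proof. by move=> cf cg; rewrite /uint RintegralB//; exact: continuous_uintegrable. Qed.

Lemma uintD f g : continuous f -> continuous g ->
  uint (fun t => f t + g t) = uint f + uint g.
Proof. by move=> cf cg; rewrite /uint RintegralD//; exact: continuous_uintegrable. Qed.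

Lemma uintZ (c : R) f : continuous f -> uint (fun t => c * f t) = c * uint f.
Proof. by move=> cf; rewrite /uint RintegralZl//; exact: continuous_uintegrable. Qed.

Lemma uint_cst (c : R) : uint (fun=> c) = c.
Proof.
rewrite /uint Rintegral_cst// [X in fine X](@lebesgue_measure_itv R `[0, 1]) /=.
by rewrite lte01 oppr0 adde0 mulr1.
Qed.

Lemma eq_uint f g : (forall t, 0 <= t <= 1 -> f t = g t) -> uint f = uint g.
Proof.
by move=> fg; apply: eq_Rintegral => t; rewrite inE/= in_itv/=; exact: fg.
Qed.

Lemma le_uint f g : continuous f -> continuous g ->
  (forall t, 0 <= t <= 1 -> f t <= g t) -> uint f <= uint g.
Proof.
move=> cf cg fg; apply: le_Rintegral => //; try exact: continuous_uintegrable.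
Qed.

Lemma uint_norm_le f (K : R) : continuous f ->
  (forall t, 0 <= t <= 1 -> `|f t| <= K) -> `|uint f| <= K.
Proof.
move=> cf fK; rewrite ler_norml -{1}(uint_cst (- K)) -{2}(uint_cst K).
have cc (c : R) : continuous (fun _ : R => c) by move=> t; exact: cvg_cst.
apply/andP; split.
  by apply: (le_uint (cc _) cf) => t /fK; rewrite ler_norml => /andP[].
by apply: (le_uint cf (cc _)) => t /fK; rewrite ler_norml => /andP[].
Qed.

Lemma continuous_sum3 {T : topologicalType} (F : 'I_3 -> T -> R) :
  (forall j, continuous (F j)) -> continuous (fun t => \sum_(j < 3) F j t).
Proof.
move=> cF; have -> : (fun t => \sum_(j < 3) F j t) =
    (fun t => F (@Ordinal 3 0 isT) t + F (@Ordinal 3 1 isT) t + F (@Ordinal 3 2 isT) t).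
  by apply/funext => t; exact: sum3.
by move=> t; apply: cvgD; [apply: cvgD|]; exact: cF.
Qed.

Lemma uint_sum3 (F : 'I_3 -> R -> R) : (forall j, continuous (F j)) ->
  uint (fun t => \sum_(j < 3) F j t) = \sum_(j < 3) uint (F j).
Proof.
move=> cF; rewrite sum3.
have c01 : continuous (fun t => F (@Ordinal 3 0 isT) t + F (@Ordinal 3 1 isT) t).
  by move=> t; apply: continuousD; exact: cF.
rewrite -(uintD (cF _) (cF _)) -(uintD c01 (cF _)).
by apply: eq_uint => t _; rewrite sum3.
Qed.

(* [uint] is only used on continuous functions; the variance is nonnegative. *)
Lemma uint_jensen f : continuous f -> uint f ^+ 2 <= uint (fun t => f t ^+ 2).
Proof.
move=> cf; set m := uint f.
have c2 : continuous (fun t => f t ^+ 2).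
  by under eq_fun do rewrite expr2; move=> t; exact: (continuousM (cf t) (cf t)).
have cm : continuous (fun t => 2 * m * f t).
  by move=> t; apply: cvgM; [exact: cvg_cst|exact: cf].
have : 0 <= uint (fun t => f t ^+ 2 - 2 * m * f t + m ^+ 2).
  rewrite -[0](uint_cst 0); apply: le_uint; first exact: cst_continuous.
    by move=> t; apply: cvgD; [apply: cvgB; [exact: c2|exact: cm]|exact: cvg_cst].
  move=> t _; have := sqr_ge0 (f t - m); rewrite sqrrB; lra.
have cB : continuous (fun t => f t ^+ 2 - 2 * m * f t).
  by move=> t; exact: (continuousB (c2 t) (cm t)).
have cc : continuous (fun _ : R => m ^+ 2) by move=> t; exact: cvg_cst.
by rewrite (uintD cB cc) (uintB c2 cm) (uintZ _ cf) uint_cst -/m; lra.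
Qed.

Lemma uint_FTC f g : (forall t : R, is_derive t 1 f (g t)) -> continuous g ->
  uint g = f 1 - f 0.
Proof.
move=> df cg; have cf := is_derive_continuous df.
rewrite /uint /Rintegral (@continuous_FTC2 _ g f)//.
- exact: continuous_subspaceT.
- split; first by move=> x _; case: (df x).
    by apply: cvg_at_right_filter; exact: cf.
  by apply: cvg_at_left_filter; exact: cf.
- by move=> x _; rewrite derive1E; exact: derive_val.
Qed.

End UnitInterval.

Section ParamIntegral.
Context {R : realType}.
Implicit Types (f g : R3 R -> R) (n m : nat) (x y v : R3 R) (j k : 'I_3).

(** Average along the segment from 0 to [x]; [pint 1 (f j)] is F_j. Each differentiation in [x]
    raises the weight [m] by one, so the derivatives of F_j are of the form [pint 2], as is G. *)
Definition pint m f x : R := uint (fun t => t ^+ m * f (t *: x)).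

Lemma pint_integrand_continuous m f x : continuous f -> continuous (fun t : R => t ^+ m * f (t *: x)).
Proof.
move=> cf t; apply: cvgM; first by apply: exprn_continuous.
apply: (@continuous_comp _ _ _ (fun t : R => t *: x) f); last exact: cf.
exact: scalel_continuous.
Qed.

Lemma pintD m f g x : continuous f -> continuous g ->
  pint m (fun y => f y + g y) x = pint m f x + pint m g x.
Proof.
move=> cf cg; rewrite -uintD; do ?exact: pint_integrand_continuous.
by apply: eq_uint => t _; rewrite mulrDr.
Qed.

Lemma norm_scale_le (t M : R) x : 0 <= t <= 1 -> `|x| <= M -> `|t *: x| <= M.
Proof.
move=> /andP[t0 t1] xM; rewrite normrZ ger0_norm//.
by apply: le_trans xM; rewrite ler_piMl.
Qed.

Lemma pint_continuous m f : Ck 1 f -> continuous (pint m f).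
Proof.
move=> Cf x; have cf := Ck_continuous Cf.
have K_ j : exists K : R, 0 <= K /\ forall y, `|y| <= `|x| + 1 -> `|partial j f y| <= K.
  by have [K] := continuous_bounded (`|x| + 1) (Ck_continuous (CkS Cf j).2); exists K.
have [K KP] := choice K_; pose K0 := \sum_(j < 3) K j.
have K00 : 0 <= K0 by apply: sumr_ge0 => j _; case: (KP j).
apply/cvgrPdist_le => e e0; near=> y.
have yx1 : `|y - x| <= 1.
  by rewrite distrC; near: y; apply: cvgr_dist_le => //; exact: cvg_id.
have yx2 : `|y - x| <= e / (K0 + 1).
  rewrite distrC; near: y; apply: cvgr_dist_le; first exact: cvg_id.
  by rewrite divr_gt0// ltr_wpDl.
rewrite distrC /pint -uintB; do ?exact: pint_integrand_continuous.
apply: uint_norm_le.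
  by move=> t; apply: cvgB; exact: pint_integrand_continuous.
move=> t t01; have /andP[t0 t1] := t01.
rewrite -mulrBr normrM ger0_norm ?exprn_ge0//.
apply: (@le_trans _ _ `|f (t *: y) - f (t *: x)|).
  by rewrite ler_piMl// exprn_ile1.
have [p pP] := increment (t *: x) (t *: (y - x)) (fun j => (CkS Cf j).1).
rewrite -scalerDr subrKC => ->.
apply: le_trans (ler_norm_sum _ _ _) _.
apply: (@le_trans _ _ (\sum_(j < 3) `|y - x| * K j)); last first.
  rewrite -mulr_sumr -/K0; apply: (@le_trans _ _ (`|y - x| * (K0 + 1))).
    by rewrite ler_wpM2l// lerDl.
  by rewrite -ler_pdivlMr// ltr_wpDl.
apply: ler_sum => j _; rewrite normrM; apply: ler_pM => //.
  by apply: le_trans (coord_norm _ _) _; exact: norm_scale_le.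
have [_] := KP j; apply.
rewrite -[p j](subrK (t *: x)) addrC; apply: le_trans (ler_normD _ _) _; apply: lerD.
  exact: norm_scale_le.
by apply: le_trans (pP j) _; exact: norm_scale_le.
Unshelve. all: by end_near. Qed.

(** Differentiation under the integral sign, justified by a second-order remainder that is uniform
    over the segment; this is where two derivatives of [f] enter. *)
Lemma is_derive_pint m f j x : Ck 2 f ->
  is_derive x (basis j) (pint m f) (pint m.+1 (partial j f) x).
Proof.
move=> Cf; have [df Cp] := CkS Cf j; have [dp Cpp] := CkS Cp j.
have cf := Ck_continuous Cf; have cp := Ck_continuous Cp.
have [K K0 KP] := continuous_bounded (`|x| + 1) (Ck_continuous Cpp).
(* Two uses of the mean value theorem: the remainder is [s * t] times a second derivative taken
   within distance 1 of [y], with [t] no larger than [s] in absolute value. *)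
have second y (s : R) : `|y| <= `|x| -> `|s| <= 1 ->
    `|f (y + s *: basis j) - f y - s * partial j f y| <= K * s ^+ 2.
  move=> yx s1.
  have [t ts ->] := mean_value_line y s df.
  have [r rt e] := mean_value_line y t dp.
  rewrite -mulrBr e !normrM.
  have : `|t| * `|partial j (partial j f) (y + r *: basis j)| <= `|s| * K.
    apply: ler_pM => //; apply: KP.
    apply: le_trans (ler_normD _ _) _; apply: lerD => //.
    rewrite normrZ; apply: (@le_trans _ _ (`|r| * 1)).
      rewrite ler_wpM2l//; apply/normR3P => k; rewrite coord_basis.
      by case: (j == k); rewrite ?normr1 ?normr0.
    by rewrite mulr1; apply: le_trans rt (le_trans ts s1).
  move=> /(ler_wpM2l (normr_ge0 s)) /le_trans; apply.
  by rewrite -[s ^+ 2]real_normK ?num_real// expr2 mulrA mulrC.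
have lim : h^-1 *: ((pint m f \o shift x) (h *: basis j) - pint m f x) @[h --> 0^'] -->
    pint m.+1 (partial j f) x.
  apply/cvgrPdist_le => e e0; near=> h.
  have hn0 : h != 0 by near: h; exact: nbhs_dnbhs_neq.
  have h1 : `|h| <= 1 by near: h; apply: dnbhs0_le.
  have hK : `|h| <= e / (K + 1).
    by near: h; apply: dnbhs0_le; rewrite divr_gt0// ltr_wpDl.
  rewrite distrC /= [h *: basis j + x]addrC /pint -uintB; do ?exact: pint_integrand_continuous.
  have cB : continuous (fun t : R => t ^+ m * f (t *: (x + h *: basis j)) - t ^+ m * f (t *: x)).
    by move=> t; apply: cvgB; exact: pint_integrand_continuous.
  rewrite [_ *: _](_ : _ = h^-1 * uint (fun t : R => t ^+ m * f (t *: (x + h *: basis j)) - t ^+ m * f (t *: x)))//.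
  rewrite -uintZ// -uintB; first last.
  - exact: pint_integrand_continuous.
  - by move=> t; apply: cvgM; [exact: cvg_cst|exact: cB].
  apply: uint_norm_le.
    move=> t; apply: cvgB; last exact: pint_integrand_continuous.
    by apply: cvgM; [exact: cvg_cst|exact: cB].
  move=> t t01; have /andP[t0 t1] := t01.
  have -> : h^-1 * (t ^+ m * f (t *: (x + h *: basis j)) - t ^+ m * f (t *: x))
      - t ^+ m.+1 * partial j f (t *: x) =
      t ^+ m * (h^-1 * (f (t *: x + (t * h) *: basis j) - f (t *: x) - (t * h) * partial j f (t *: x))).
    by rewrite scalerDr scalerA exprS; field.
  rewrite normrM ger0_norm ?exprn_ge0//.
  apply: le_trans (_ : _ <= `|h^-1 * (f (t *: x + (t * h) *: basis j) - f (t *: x) - (t * h) * partial j f (t *: x))|) _.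
    by rewrite ler_piMl// exprn_ile1.
  rewrite normrM normfV ler_pdivrMl ?normr_gt0//.
  apply: le_trans (second _ _ _ _) _.
  - exact: norm_scale_le.
  - by rewrite normrM ger0_norm// mulr_ile1.
  apply: (@le_trans _ _ (K * `|h| ^+ 2)).
    rewrite ler_wpM2l// exprMn -[h ^+ 2]real_normK ?num_real//.
    by rewrite ler_piMl ?sqr_ge0// exprn_ile1.
  rewrite expr2 mulrA mulrC ler_wpM2l//.
  apply: (@le_trans _ _ (`|h| * (K + 1))); first by rewrite mulrC ler_wpM2l// lerDl.
  by rewrite -ler_pdivlMr// ltr_wpDl.
have cv : derivable (pint m f) x (basis j) by apply/cvg_ex; exists (pint m.+1 (partial j f) x).
by apply: DeriveDef => //; exact: cvg_lim lim.
Unshelve. all: by end_near. Qed.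

(** The two extra orders are those consumed by [is_derive_pint]. The loss is the same at every
    level, so [smooth] is preserved. *)
Lemma Ck_pint n m f : Ck n.+2 f -> Ck n (pint m f).
Proof.
elim: n m f => [|n IH] m f Cf.
  by split=> //; apply: pint_continuous; exact: Ck_le.
split; first by apply: pint_continuous; elim: n {IH} Cf => [|n IH] /Ck_le//; exact: Ck_le.
move=> j; exists (pint m.+1 (partial j f)); last first.
  by apply: IH; have [] := CkS Cf j.
by move=> x; apply: is_derive_pint; elim: n {IH} Cf => [|n IH] /Ck_le.
Qed.

Lemma smooth_pint m f : smooth f -> smooth (pint m f).
Proof. by move/smoothP => Cf; apply/smoothP => n; exact: Ck_pint. Qed.

Lemma partial_pint m f j x : smooth f -> partial j (pint m f) x = pint m.+1 (partial j f) x.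
Proof.
by move/smoothP => Cf; have := is_derive_pint m j x (Cf 2%N) => -[].
Qed.

Lemma is_derive_ray f x (t : R) : Ck 1 f ->
  is_derive t 1 (fun t : R => f (t *: x)) (\sum_(j < 3) coord x j * partial j f (t *: x)).
Proof.
move=> Cf; have := is_derive_dir (0 + t *: x) x Cf => /is_derive_line.
by rewrite add0r; under eq_fun do rewrite add0r.
Qed.

(* Euler's relation, from d/dt (t^(m+1) f(tx)) = (m+1) t^m f(tx) + t^(m+1) x.grad f(tx). *)
Lemma pint_euler m f x : smooth f ->
  m.+1%:R * pint m f x + \sum_(j < 3) coord x j * partial j (pint m f) x = f x.
Proof.
move=> sf; have Cf := smooth_Ck 1 sf; have cf := Ck_continuous Cf.
have cp j : continuous (partial j f) := Ck_continuous (CkS Cf j).2.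
have dt (t : R) : is_derive t 1 (fun t : R => t ^+ m.+1 * f (t *: x))
    (m.+1%:R * (t ^+ m * f (t *: x)) + \sum_(j < 3) coord x j * (t ^+ m.+1 * partial j f (t *: x))).
  have d1 : is_derive t 1 (fun t : R => t ^+ m.+1) (m.+1%:R * t ^+ m).
    apply: DeriveDef; first exact: exprn_derivable.
    by rewrite exp_derive /GRing.scale/= mulr1.
  have := is_deriveM d1 (is_derive_ray x t Cf) => /is_derive_eq; apply.
  rewrite /GRing.scale/= mulr_sumr addrC; congr (_ + _); first by ring.
  by apply: eq_bigr => j _; rewrite mulrCA.
have cs (j : 'I_3) : continuous (fun t : R => coord x j * (t ^+ m.+1 * partial j f (t *: x))).
  by move=> t; apply: cvgM; [exact: cvg_cst|exact: pint_integrand_continuous].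
have cm : continuous (fun t : R => m.+1%:R * (t ^+ m * f (t *: x))).
  by move=> t; apply: cvgM; [exact: cvg_cst|exact: pint_integrand_continuous].
have cS := continuous_sum3 cs.
have cg : continuous (fun t : R => m.+1%:R * (t ^+ m * f (t *: x)) +
    \sum_(j < 3) coord x j * (t ^+ m.+1 * partial j f (t *: x))).
  by move=> t; exact: (continuousD (cm t) (cS t)).
have := uint_FTC dt cg; rewrite expr1n expr0n/= mul0r mul1r subr0 scale1r => <-.
rewrite (uintD cm cS) (uint_sum3 cs) uintZ; last exact: pint_integrand_continuous.
congr (_ + _); apply: eq_bigr => j _.
rewrite partial_pint// uintZ//; exact: pint_integrand_continuous.
Qed.

End ParamIntegral.

(** * Integration on R3 *)

Section SquareIntegrable.
Context d (T : measurableType d) (R : realType) (mu : {measure set T -> \bar R}).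
Implicit Types f g : T -> R.

(** Functions and not classes: the seminorm vanishes on functions that are 0 almost everywhere, as
    [semi_inner] permits. [Lfun_L2] relates this set to the library space occurring in [hdot1]. *)
Definition L2 : set (T -> R) := [set f : T -> R | measurable_fun setT f /\
  (\int[mu]_x (f x ^+ 2)%:E < +oo)%E].

Definition ipL2 f g : R := \int[mu]_x (f x * g x).

Lemma Lfun_L2 f : f \in Lfun mu 2%:E <-> L2 f.
Proof.
have eqN : measurable_fun setT f ->
    ('N[mu]_2%:E[EFin \o f] < +oo)%E = (\int[mu]_x (f x ^+ 2)%:E < +oo)%E.
  move=> mf; rewrite unlock /=.
  have -> : (\int[mu]_x (`|(f x)%:E| `^ 2))%E = (\int[mu]_x (f x ^+ 2)%:E)%E.
    by apply: eq_integral => x _; rewrite /= powR_mulrn// real_normK// num_real.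
  have : (0 <= \int[mu]_x (f x ^+ 2)%:E)%E.
    by apply: integral_ge0 => x _; rewrite lee_fin sqr_ge0.
  case: (\int[mu]_x (f x ^+ 2)%:E)%E => [r||] //=.
  - by move=> r0; rewrite !ltry.
  - by move=> _; rewrite ltxx invr_eq0 pnatr_eq0.
split=> [Lf|[mf ff]].
  have /set_mem mf := sub_Lfun_mfun Lf; have /set_mem := sub_Lfun_finLfun Lf.
  by rewrite /= /finite_norm eqN.
by apply/andP; split; apply/mem_set => //=; rewrite /finite_norm eqN.
Qed.

Lemma L2_measurable f : L2 f -> measurable_fun setT f. Proof. by case. Qed.

Lemma L2_integrable f : L2 f -> mu.-integrable setT (EFin \o (fun x => f x ^+ 2)).
Proof.
move=> [mf ff]; apply/integrableP; split.
  by apply/measurable_EFinP; exact: measurable_funX.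
by under eq_integral do rewrite /= ger0_norm ?sqr_ge0//.
Qed.

Lemma L2_intro f : measurable_fun setT f ->
  mu.-integrable setT (EFin \o (fun x => f x ^+ 2)) -> L2 f.
Proof.
move=> mf /integrableP[_]; split=> //.
by under eq_integral do rewrite -[X in X%:E]ger0_norm ?sqr_ge0//.
Qed.

Lemma L2M_integrable f g : L2 f -> L2 g -> mu.-integrable setT (EFin \o (fun x => f x * g x)).
Proof.
move=> Lf Lg; have mf := L2_measurable Lf; have mg := L2_measurable Lg.
apply: (le_integrable measurableT _ _ (integrableD measurableT (L2_integrable Lf) (L2_integrable Lg))).
  by apply/measurable_EFinP; exact: measurable_funM.
move=> x _ /=; rewrite lee_fin [leRHS]ger0_norm ?addr_ge0 ?sqr_ge0// ler_norml.
have := sqr_ge0 (f x + g x); have := sqr_ge0 (f x - g x).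
rewrite sqrrB sqrrD => h1 h2.
have := sqr_ge0 (f x); have := sqr_ge0 (g x) => h3 h4.
apply/andP; split; lra.
Qed.

Lemma L2_le f g : measurable_fun setT f -> L2 g -> (forall x, `|f x| <= `|g x|) -> L2 f.
Proof.
move=> mf Lg fg; apply: L2_intro => //.
apply: (le_integrable measurableT _ _ (L2_integrable Lg)).
  by apply/measurable_EFinP; exact: measurable_funX.
move=> x _ /=; rewrite lee_fin !normrX.
by rewrite ler_pXn2r ?nnegrE.
Qed.

Lemma L2D f g : L2 f -> L2 g -> L2 (f + g).
Proof.
move=> Lf Lg; have mf := L2_measurable Lf; have mg := L2_measurable Lg.
have mfg : measurable_fun setT (f + g) by exact: measurable_funD.
apply: L2_intro => //.
have i2 := integrableZl measurableT 2 (integrableD measurableT (L2_integrable Lf) (L2_integrable Lg)).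
apply: (le_integrable measurableT _ _ i2).
  by apply/measurable_EFinP; exact: measurable_funX.
move=> x _ /=; rewrite lee_fin !ger0_norm ?sqr_ge0//; last first.
  by rewrite mulr_ge0// addr_ge0// sqr_ge0.
have := sqr_ge0 (f x - g x); rewrite sqrrB sqrrD => *; lra.
Qed.

Lemma L2Z (a : R) f : L2 f -> L2 (a *: f).
Proof.
move=> Lf; have mf := L2_measurable Lf; apply: L2_intro.
  exact: (measurable_funM (measurable_cst a) mf).
have -> : EFin \o (fun x => (a *: f) x ^+ 2) = (fun x => (a ^+ 2)%:E * (f x ^+ 2)%:E)%E.
  by apply/funext => x /=; rewrite -EFinM exprMn.
exact: (integrableZl measurableT _ (L2_integrable Lf)).
Qed.

Lemma L2_0 : L2 0.
Proof.
split; first exact: measurable_cst.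
by rewrite integral0_eq ?ltry// => x _; rewrite expr0n.
Qed.

Lemma semi_inner_L2 : semi_inner L2 ipL2.
Proof.
split; [exact: L2_0|exact: L2D|exact: L2Z| | | |].
- by move=> f g _ _; apply: eq_Rintegral => x _; rewrite mulrC.
- move=> f g h Lf Lg Lh; rewrite /ipL2 -RintegralD//; try exact: L2M_integrable.
  by apply: eq_Rintegral => x _; rewrite mulrDl.
- move=> a f g Lf Lg; rewrite /ipL2 -RintegralZl//; last exact: L2M_integrable.
  by apply: eq_Rintegral => x _; rewrite -mulrA.
- by move=> f Lf; apply: Rintegral_ge0 => x _; rewrite -expr2 sqr_ge0.
Qed.

Lemma ipL2_sqr f : L2 f -> (ipL2 f f)%:E = (\int[mu]_x (f x ^+ 2)%:E)%E.
Proof.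
move=> Lf; rewrite /ipL2 /Rintegral fineK; last first.
  have := integrable_fin_num measurableT (L2_integrable Lf).
  by under eq_integral do rewrite /= expr2.
by under eq_integral do rewrite -expr2.
Qed.

Lemma nrmL2 f : L2 f -> ((nrm ipL2 f ^+ 2)%:E = \int[mu]_x (f x ^+ 2)%:E)%E.
Proof. by move=> Lf; rewrite (nrm_sqr semi_inner_L2)// ipL2_sqr. Qed.

Lemma nrmL2_abs f : L2 f -> L2 (fun x => `|f x|) /\ nrm ipL2 (fun x => `|f x|) = nrm ipL2 f.
Proof.
move=> Lf; split.
  apply: (L2_le _ Lf) => [|x]; last by rewrite normr_id.
  by apply: measurableT_comp => //; exact: L2_measurable.
rewrite /nrm /ipL2; congr Num.sqrt; apply: eq_Rintegral => x _.
by rewrite -!expr2 real_normK// num_real.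
Qed.

Lemma nrmL2_le f (M : R) : measurable_fun setT f -> 0 <= M ->
  (\int[mu]_x (f x ^+ 2)%:E <= (M ^+ 2)%:E)%E -> L2 f /\ nrm ipL2 f <= M.
Proof.
move=> mf M0 fM; have Lf : L2 f by split=> //; apply: le_lt_trans fM (ltry _).
split=> //; rewrite -(@ler_pXn2r _ 2%N) ?nnegrE ?sqrtr_ge0//.
by rewrite -lee_fin nrmL2.
Qed.

(** The partial sums of the absolute increments have norm at most 2. By monotone convergence the
    limit of their squares is integrable, hence finite almost everywhere, and there the telescoping
    series converges absolutely. *)
Lemma L2_rapid_cvg (v : nat -> T -> R) : (forall k, L2 (v k)) ->
  (forall k, nrm ipL2 (v k.+1 - v k) <= 2^-1 ^+ k) ->
  {ae mu, forall x, cvgn (v ^~ x)}.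
Proof.
move=> Lv vd; pose D k : T -> R := v k.+1 - v k.
have SI := semi_inner_L2.
have LD k : L2 (D k) by exact: (siB SI).
pose A k x := `|D k x|; have LA k : L2 (A k) := (nrmL2_abs (LD k)).1.
pose S n : T -> R := \sum_(0 <= k < n) A k.
have SE n x : S n x = \sum_(0 <= k < n) A k x by rewrite /S; elim/big_rec2: _ => // i y z _ <-.
have LS n : L2 (S n) by exact: (si_sum SI).
(* The right-hand side is the sum of [2^-1 ^+ k] over [k < n]. *)
have nS n : nrm ipL2 (S n) <= 2 - 2 * 2^-1 ^+ n.
  elim: n => [|n IH].
    by rewrite /S big_geq// expr0 mulr1 subrr (si_eq0 (L2_0))// (si0l SI)//; exact: L2_0.
  have -> : S n.+1 = S n + A n by rewrite /S big_nat_recr.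
  apply: le_trans (nrmD SI (LS n) (LA n)) _.
  have := vd n; rewrite -(nrmL2_abs (LD n)).2 -/(A n) => h.
  rewrite exprS; lra.
pose G n x := (S n x ^+ 2)%:E.
have S0 n x : 0 <= S n x by rewrite SE; apply: sumr_ge0 => k _; exact: normr_ge0.
have ndS x m n : (m <= n)%N -> S m x <= S n x.
  move=> mn; rewrite !SE [leRHS](big_cat_nat (n := m))//= lerDl.
  by apply: sumr_ge0 => k _; exact: normr_ge0.
have mG n : measurable_fun setT (G n).
  by apply/measurable_EFinP; apply: measurable_funX; exact: (LS n).1.
have ndG x : {homo G ^~ x : n m / (n <= m)%N >-> (n <= m)%E}.
  by move=> m n mn; rewrite lee_fin ler_pXn2r ?nnegrE// ndS.
have cG x : cvgn (G ^~ x) by apply: ereal_nondecreasing_is_cvgn; exact: ndG.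
have iG : (\int[mu]_x limn (G ^~ x) <= 4%:E)%E.
  rewrite monotone_convergence//; last by move=> n x _; rewrite lee_fin sqr_ge0.
  apply: lime_le.
    apply: ereal_nondecreasing_is_cvgn => m n mn; apply: ge0_le_integral => //.
    - by move=> x _; rewrite lee_fin sqr_ge0.
    - by move=> x _; exact: ndG.
  near=> n; rewrite /G -nrmL2// lee_fin.
  have : nrm ipL2 (S n) <= 2.
    by apply: le_trans (nS n) _; rewrite lerBlDr lerDl mulr_ge0// exprn_ge0.
  move=> h; have -> : 4 = 2 ^+ 2 :> R by rewrite expr2 -natrM.
  by rewrite ler_pXn2r ?nnegrE ?sqrtr_ge0.
have mlim : measurable_fun setT (fun x => limn (G ^~ x)).
  by apply: (emeasurable_fun_cvg G) => // x _; exact: cG.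
have intG : mu.-integrable setT (fun x => limn (G ^~ x)).
  apply/integrableP; split=> //.
  under eq_integral => x _.
    rewrite gee0_abs; first over.
    by apply: lime_ge => //; apply: nearW => n; rewrite lee_fin sqr_ge0.
  exact: le_lt_trans iG (ltry _).
apply: filterS (integrable_ae measurableT intG) => x /(_ I) fin.
set L := fine (limn (G ^~ x)).
have GL n : S n x <= L + 1.
  have : (G n x <= L%:E)%E.
    by rewrite /L fineK//; apply: lime_ge => //; exists n => // m; exact: ndG.
  rewrite lee_fin => h; have := sqr_ge0 (S n x - 1); have := sqr_ge0 (S n x).
  rewrite sqrrB; move: h; have := S0 n x; nra.
have cD : cvgn (series (fun k => D k x)).
  apply: normed_cvg; apply: nondecreasing_is_cvgn.
    by move=> m n mn; have := ndS x m n mn; rewrite !SE.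
  by exists (L + 1) => _ [n _ <-]; have := GL n; rewrite SE.
have -> : v ^~ x = (fun n => v 0%N x + series (fun k => D k x) n).
  apply/funext => n; rewrite /series/=; elim: n => [|n IH]; first by rewrite big_geq// addr0.
  by rewrite big_nat_recr//= addrA -IH /D addrC subrK.
by apply: is_cvgD => //; exact: is_cvg_cst.
Unshelve. all: by end_near. Qed.

(** A subsequence with geometrically small increments converges almost everywhere, and Fatou's lemma
    shows that the whole sequence tends to that limit in norm. *)
Lemma scomplete_L2 : scomplete L2 ipL2.
Proof.
have SI := semi_inner_L2.
move=> u Lu cu.
have half0 k : 0 < 2^-1 ^+ k :> R by rewrite exprn_gt0.
have [N_ NP] := choice (fun k => cu _ (half0 k)).
pose idx := fix F k := if k is k'.+1 then maxn (F k').+1 (N_ k) else N_ 0%N.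
have idxN k : (N_ k <= idx k)%N by case: k => //= k; exact: leq_maxr.
have idx_mono k : (idx k <= idx k.+1)%N by rewrite /=; apply: leq_trans (leq_maxl _ _); exact: leqnSn.
have idx_ge k : (k <= idx k)%N.
  by elim: k => // k IH; apply: leq_trans (leq_maxl _ _); rewrite ltnS.
pose v k := u (idx k).
have Lv k : L2 (v k) by exact: Lu.
have vd k : nrm ipL2 (v k.+1 - v k) <= 2^-1 ^+ k.
  by rewrite ltW// NP//; apply: leq_trans (idx_mono k).
have cv := L2_rapid_cvg Lv vd.
(* [w] is [v] set to 0 on the exceptional null set, so that it converges everywhere and its limit
   [f] is measurable. *)
have [w [f [mw mf wf vw]]] : exists (w : nat -> T -> R) (f : T -> R),
    [/\ forall k, measurable_fun setT (w k), measurable_fun setT f,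
      forall x, w ^~ x @ \oo --> f x & {ae mu, forall x k, w k x = v k x}].
  have [N [mN N0 sub]] := cv.
  pose w k x := v k x * \1_(~` N) x.
  have mw k : measurable_fun setT (w k).
    apply: measurable_funM; first exact: (Lv k).1.
    by apply: measurable_indic; exact: measurableC.
  have wc x : cvgn (w ^~ x).
    rewrite /w indicE; case: (boolP (x \in ~` N)) => [/set_mem xN|_].
      apply: is_cvgM; last exact: is_cvg_cst.
      by apply: contrapT => ?; apply: xN; exact: sub.
    by under eq_fun do rewrite mulr0; exact: is_cvg_cst.
  exists w, (fun x => limn (w ^~ x)); split=> //.
    by apply: (measurable_fun_cvg (h := w)) => // x _; exact: wc.
  exists N; split=> // x /= nx; apply: contrapT => xN; apply: nx => k.
  by rewrite /w indicE mem_set// mulr1.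
have key (e : R) : 0 < e -> exists N, forall m, (N <= m)%N ->
    L2 (u m - f) /\ nrm ipL2 (u m - f) <= e.
  move=> e0; have [N NPe] := cu _ e0; exists N => m Nm.
  have mum : measurable_fun setT (u m) := (Lu m).1.
  have mmf : measurable_fun setT (u m - f) by exact: measurable_funB.
  apply: nrmL2_le => //; first exact: ltW.
  pose h k x := ((u m x - w k x) ^+ 2)%:E.
  have mh k : measurable_fun setT (h k).
    by apply/measurable_EFinP; apply: measurable_funX; apply: measurable_funB.
  have h0 k x : setT x -> (0 <= h k x)%E by rewrite lee_fin sqr_ge0.
  have hl x : h ^~ x @ \oo --> ((u m x - f x) ^+ 2)%:E.
    apply: cvg_EFin; first exact: nearW.
    rewrite [X in X @ _ --> _](_ : _ = (fun k => (u m x - w k x) * (u m x - w k x))).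
      rewrite expr2; apply: cvgM; apply: cvgB => //; exact: cvg_cst.
    by apply/funext => k; rewrite -expr2.
  have -> : (\int[mu]_x ((u m - f) x ^+ 2)%:E = \int[mu]_x limn_einf (h ^~ x))%E.
    by apply: eq_integral => x _; rewrite (cvg_limn_einf_sup (hl x)).1.
  apply: le_trans (fatou mu measurableT mh h0) _.
  rewrite limn_einf_lim; apply: lime_le; first exact: is_cvg_einfs.
  exists N => // k /= Nk; apply: le_trans (_ : _ <= \int[mu]_x h k x)%E _.
    by apply: ereal_inf_lbound; exists k => /=.
  have -> : (\int[mu]_x h k x = \int[mu]_x ((u m - v k) x ^+ 2)%:E)%E.
    apply: ge0_ae_eq_integral => //.
    - by apply/measurable_EFinP; apply: measurable_funX; apply: measurable_funB => //; exact: (Lv k).1.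
    - by move=> x _; rewrite lee_fin sqr_ge0.
    - by move=> x _; rewrite lee_fin sqr_ge0.
    - by apply: filterS vw => x wv _; rewrite /h wv.
  have Luv : L2 (u m - v k) by exact: (siB SI).
  rewrite -nrmL2// lee_fin ler_pXn2r ?nnegrE ?sqrtr_ge0 ?(ltW e0)//.
  by apply/ltW/NPe => //; exact: leq_trans Nk (idx_ge k).
have [N0 N0P] := key 1 ltr01.
have Lf : L2 f.
  have [Ld _] := N0P _ (leqnn _).
  have -> : f = u N0 - (u N0 - f) by rewrite subKr.
  exact: (siB SI).
exists f => // e e0; have e2 : 0 < e / 2 by rewrite divr_gt0.
have [N NPe] := key _ e2; exists N => n Nn; have [_] := NPe n Nn => h.
by apply: le_lt_trans h _; rewrite ltr_pdivrMr// ltr_pMr// ltr1n.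
Qed.

End SquareIntegrable.

(** * Change of variables and Tonelli in dimension three *)

Section AffineR.
Context {R : realType}.
Local Notation mu := (@lebesgue_measure R).

Lemma measurable_affine (a r : R) :
  measurable_fun setT (fun t : measurableTypeR R => (a + r * t : measurableTypeR R)).
Proof.
apply: (measurable_funD (f := fun=> a)); first exact: measurable_cst.
by apply: measurable_funM; [exact: measurable_cst|exact: measurable_id].
Qed.

(** [r] times the image of Lebesgue measure under the affine map agrees with Lebesgue measure on
    half-open intervals, hence on all measurable sets. *)
Lemma ge0_integral_affine (a r : R) (f : measurableTypeR R -> \bar R) : 0 < r ->
  measurable_fun setT f -> (forall x, 0 <= f x)%E ->
  (\int[mu]_t f (a + r * t)%R = (r^-1)%:E * \int[mu]_t f t)%E.
Proof.
move=> r0 mf f0; pose phi (t : measurableTypeR R) : measurableTypeR R := a + r * t.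
have mphi : measurable_fun setT phi := measurable_affine a r.
pose mphi_pack : {mfun _ >-> _} := HB.pack phi (isMeasurableFun.Build _ _ _ _ _ mphi).
pose pf0 : {measure set (measurableTypeR R) -> \bar R} := pushforward mu mphi_pack.
pose pf := pf0 mphi.
have rn : 0 <= r by exact: ltW.
pose m : {measure set (measurableTypeR R) -> \bar R} := mscale (NngNum rn) pf.
have mE A : measurable A -> mu A = m A.
  apply: lebesgue_measure_unique => X [[x y]/= _ <-].
  rewrite /m /mscale/= /pushforward/=.
  have -> : phi @^-1` `]x, y] = `]((x - a) / r), ((y - a) / r)]%classic.
    apply/seteqP; split=> t /=; rewrite !in_itv/= /phi ltr_pdivrMr// ler_pdivlMr// ltrBlDl lerBrDl [t * r]mulrC//.
  rewrite !lebesgue_measure_itv/= !lte_fin ltr_pM2r ?invr_gt0// ltrD2r.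
  case: ifPn => // xy; last by rewrite mule0.
  by rewrite -!EFinD -EFinM; congr (_%:E); field; rewrite gt_eqF.
have -> : (\int[mu]_t f t = r%:E * \int[pf]_t f t)%E.
  rewrite (eq_measure_integral m) => [|A mA _]; last exact: mE.
  by rewrite ge0_integral_mscale//= => x _; exact: f0.
rewrite muleA -EFinM mulVf ?gt_eqF// mul1e.
by rewrite ge0_integral_pushforward// => x _; exact: f0.
Qed.
End AffineR.

(** A name for the measure on the first two factors, to which a sigma-finite structure can be
    attached, so that Tonelli applies one factor at a time. *)
Definition lebm2 {R : realType} : set (measurableTypeR R * measurableTypeR R) -> \bar R :=
  (@lebesgue_measure R \x @lebesgue_measure R)%E.
HB.instance Definition _ (R : realType) := Measure.copy (@lebm2 R)
  (@lebesgue_measure R \x @lebesgue_measure R)%E.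

(* A copy of [leb3] that also carries the sigma-finite structure. *)
Definition lebm3 {R : realType} : set (R3 R) -> \bar R := leb3.
HB.instance Definition _ (R : realType) := Measure.copy (@lebm3 R) (@leb3 R).

Section Boxes.
Context {R : realType}.
Local Notation mu := (@lebesgue_measure R).

Definition box (n : R) : set (R3 R) := [set x | `|x| <= n].

Let sq (n : R) : set (measurableTypeR R * measurableTypeR R) :=
  (`[- n, n] : set (measurableTypeR R)) `*` (`[- n, n] : set (measurableTypeR R)).

Lemma boxE (n : R) : box n = sq n `*` (`[- n, n] : set (measurableTypeR R)).
Proof.
apply/seteqP; split=> -[[a b] c]/=; rewrite /box /sq.
  by move=> /normR3P H; split; [split|]; rewrite /= in_itv/= -ler_norml;
    [have := H (@Ordinal 3 0 isT)|have := H (@Ordinal 3 1 isT)|have := H (@Ordinal 3 2 isT)].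
by move=> [[/= h1 h2] h3]; apply/normR3P; apply: forall3; rewrite /coord/= ler_norml.
Qed.

Lemma measurable_box n : measurable (box n).
Proof. by rewrite boxE; apply: measurableX => //; apply: measurableX. Qed.

Let mu_itv (n : R) : (mu `[(- n)%R, n]%classic < +oo)%E.
Proof. by rewrite lebesgue_measure_itv/=; case: ifP => _; rewrite -?EFinD ltry. Qed.

Let lebm2_sq n : (lebm2 (sq n) < +oo)%E.
Proof.
rewrite /lebm2 product_measure1E// lte_mul_pinfty//; last exact: mu_itv.
by rewrite ge0_fin_numE//; exact: mu_itv.
Qed.

Lemma leb3_box n : (leb3 (box n) < +oo)%E.
Proof.
rewrite boxE /leb3/= product_measure1E//; last exact: measurableX.
rewrite lte_mul_pinfty//; first by rewrite ge0_fin_numE//; exact: lebm2_sq.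
exact: mu_itv.
Qed.

Lemma lebm2_sigma_finite : sigma_finite setT (@lebm2 R).
Proof.
exists (fun n => sq n%:R) => [|n]; last by split; [exact: measurableX|exact: lebm2_sq].
rewrite predeqE => -[a b]; split=> // _.
exists (Num.trunc (Num.max `|a| `|b|)).+1 => //.
have := truncnS_gt (Num.max `|a| `|b|); rewrite gt_max => /andP[/ltW ha /ltW hb].
by rewrite /sq; split; rewrite /= in_itv/= -ler_norml.
Qed.

Lemma box_cover : \bigcup_(n : nat) box n%:R = [set: R3 R].
Proof.
rewrite predeqE => x; split=> // _.
by exists (Num.trunc `|x|).+1 => //; rewrite /box/= ltW// truncnS_gt.
Qed.

Lemma lebm3_sigma_finite : sigma_finite setT (@lebm3 R).
Proof.
exists (fun n => box n%:R) => [|n]; first by rewrite box_cover.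
by split; [exact: measurable_box|exact: leb3_box].
Qed.
End Boxes.

HB.instance Definition _ (R : realType) :=
  @Measure_isSigmaFinite.Build _ _ _ (@lebm2 R) lebm2_sigma_finite.
HB.instance Definition _ (R : realType) :=
  @Measure_isSigmaFinite.Build _ _ _ (@lebm3 R) lebm3_sigma_finite.

Section MeasureR3.
Context {R : realType}.
Local Notation mu := (@lebesgue_measure R).

Lemma leb3_tonelli (f : R3 R -> \bar R) : measurable_fun setT f -> (forall x, 0 <= f x)%E ->
  (\int[leb3]_x f x = \int[mu]_a \int[mu]_b \int[mu]_c f (a, b, c))%E.
Proof.
move=> mf f0.
rewrite [LHS](@fubini_tonelli1 _ _ _ _ _ (@lebm2 R) mu f mf f0).
rewrite [LHS](@fubini_tonelli1 _ _ _ _ _ mu mu)//.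
- exact: (@measurable_fun_fubini_tonelli_F _ _ _ _ _ mu f mf f0).
- by move=> x; exact: integral_ge0.
Qed.

Lemma measurable_mapR3 d (T : measurableType d) (h : T -> R3 R) :
  (forall j, measurable_fun setT (fun t => coord (h t) j : measurableTypeR R)) ->
  measurable_fun setT h.
Proof.
move=> mh.
have -> : h = (fun t => (coord (h t) (@Ordinal 3 0 isT), coord (h t) (@Ordinal 3 1 isT),
   coord (h t) (@Ordinal 3 2 isT))).
  by apply/funext => t; rewrite /coord/=; case: (h t) => -[].
apply: measurable_fun_pair; last exact: mh.
by apply: measurable_fun_pair; exact: mh.
Qed.

Lemma measurable_coord j : measurable_fun setT (fun x : R3 R => coord x j : measurableTypeR R).
Proof.
rewrite /coord; case: j => -[|[|[|]]]//= i.
- exact: (measurableT_comp measurable_fst measurable_fst).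
- exact: (measurableT_comp measurable_snd measurable_fst).
- exact: measurable_snd.
Qed.

Lemma measurable_coord_comp d (T : measurableType d) (h : T -> R3 R) j :
  measurable_fun setT h -> measurable_fun setT (fun t => coord (h t) j : measurableTypeR R).
Proof. by move=> mh; exact: (measurableT_comp (measurable_coord j) mh). Qed.

Lemma measurable_affineR3 d (T : measurableType d) (g h : T -> R3 R) (r s : T -> measurableTypeR R) :
  measurable_fun setT g -> measurable_fun setT h -> measurable_fun setT r ->
  measurable_fun setT s ->
  measurable_fun setT (fun t => (r t : R) *: g t + (s t : R) *: h t : R3 R).
Proof.
move=> mg mh mr ms; apply: measurable_mapR3 => j.
under eq_fun do rewrite coordD !coordZ.
apply: measurable_funD; apply: measurable_funM => //; exact: measurable_coord_comp.
Qed.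

(** Tonelli reduces this to three substitutions on the line, each contributing a factor [r^-1]. *)
Lemma ge0_integral_leb3_affine (a : R3 R) (r : R) (f : R3 R -> \bar R) : 0 < r ->
  measurable_fun setT f -> (forall x, 0 <= f x)%E ->
  (\int[leb3]_x f (a + r *: x)%R = (r^-1 ^+ 3)%:E * \int[leb3]_x f x)%E.
Proof.
move=> r0 mf f0; have ri0 : (0 <= (r^-1)%:E)%E by rewrite lee_fin invr_ge0 ltW.
have mphi : measurable_fun setT (fun x : R3 R => a + r *: x : R3 R).
  have -> : (fun x : R3 R => a + r *: x : R3 R) = (fun x => 1 *: a + r *: x).
    by apply/funext => x; rewrite scale1r.
  apply: (@measurable_affineR3 _ (R3 R) (fun=> a) id (fun=> 1) (fun=> r)); try exact: measurable_cst.
  exact: measurable_id.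
have mfa : measurable_fun setT (fun x : R3 R => f (a + r *: x)).
  exact: (measurableT_comp mf mphi).
have i0 (g : measurableTypeR R -> \bar R) : (forall x, 0 <= g x)%E -> (0 <= \int[mu]_x g x)%E.
  by move=> g0; exact: integral_ge0.
rewrite !leb3_tonelli//.
have m2 (x y : measurableTypeR R) : measurable_fun setT (fun z : measurableTypeR R => f (x, y, z)).
  apply: (measurableT_comp mf); apply: measurable_fun_pair; first exact: measurable_cst.
  exact: measurable_id.
have mF := @measurable_fun_fubini_tonelli_F _ _ _ _ _ mu f mf f0.
have F0 x : (0 <= fubini_F mu f x)%E by exact: i0.
have m1 (x : measurableTypeR R) : measurable_fun setT (fun y : measurableTypeR R => \int[mu]_z f (x, y, z))%E.
  apply: (measurableT_comp mF (g := fun y => (x, y))); apply: measurable_fun_pair; first exact: measurable_cst.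
  exact: measurable_id.
have m0 : measurable_fun setT (fun x : measurableTypeR R => \int[mu]_y \int[mu]_z f (x, y, z))%E.
  exact: (@measurable_fun_fubini_tonelli_F _ _ _ _ _ mu _ mF F0).
transitivity (\int[mu]_x \int[mu]_y \int[mu]_z
   f ((a.1.1 + r * x)%R, (a.1.2 + r * y)%R, (a.2 + r * z)%R))%E => //.
under eq_integral => x _.
  under eq_integral => y _.
    rewrite (ge0_integral_affine a.2 (f := fun z => f (_, _, z)) r0 (m2 _ _) (fun z => f0 _)); over.
  rewrite ge0_integralZl//; first last.
    by move=> y _; apply: i0.
    exact: (measurableT_comp (m1 _) (measurable_affine a.1.2 r)).
  rewrite (ge0_integral_affine a.1.2 (f := fun y => \int[mu]_z f (_, y, z))%E r0 (m1 _) (fun z => i0 _ (fun=> f0 _))).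
  over.
have mZ : measurable_fun setT (fun x : measurableTypeR R => (\int[mu]_y \int[mu]_z f (x, y, z)))%E by [].
have mY := measurableT_comp m0 (measurable_affine a.1.1 r).
have Y0 x : (0 <= \int[mu]_y \int[mu]_z f ((a.1.1 + r * x)%R, y, z))%E := i0 _ (fun=> i0 _ (fun=> f0 _)).
have mrY := measurable_funeM (r^-1)%:E mY.
rewrite (ge0_integralZl mu measurableT mrY (fun x _ => mule_ge0 ri0 (Y0 x)) ri0).
rewrite (ge0_integralZl mu measurableT mY (fun x _ => Y0 x) ri0).
rewrite (ge0_integral_affine a.1.1 (f := fun x => \int[mu]_y \int[mu]_z f (x, y, z))%E r0 m0 (fun z => i0 _ (fun=> i0 _ (fun=> f0 _)))).
by rewrite !muleA -!EFinM; congr (_%:E * _)%E; ring.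
Qed.

End MeasureR3.

Section Caratheodory.
Context d (T : measurableType d) (R : realType).

(* Approximate the second variable by the multiples of [1/(n+1)]. *)
Lemma caratheodory_measurable (f : T * measurableTypeR R -> R) :
  (forall s, measurable_fun setT (fun x => f (x, s))) ->
  (forall x, continuous (fun s : R => f (x, s))) -> measurable_fun setT f.
Proof.
move=> mf cf.
pose q n (s : R) : R := (Num.floor (s * n.+1%:R))%:~R / n.+1%:R.
have mq n : measurable_fun setT (q n : measurableTypeR R -> measurableTypeR R).
  apply: nondecreasing_measurable => // s t st.
  by rewrite /q ler_pM2r ?invr_gt0// ler_int le_floor// ler_pM2r.
have q_cvg (s : R) : q n s @[n --> \oo] --> s.
  apply/cvgrPdist_le => e e0; have [N NP] := inv_nat_lt e0.
  exists N => // n /= Nn.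
  have : n.+1%:R^-1 <= N.+1%:R^-1 :> R by rewrite lef_pV2 ?posrE// ler_nat.
  have n0 : 0 < n.+1%:R :> R by [].
  have /andP[f1 f2] := floor_itv (s * n.+1%:R).
  have -> : s - q n s = (s * n.+1%:R - (Num.floor (s * n.+1%:R))%:~R) / n.+1%:R.
    by rewrite /q; field.
  move=> h; rewrite normrM ger0_norm ?subr_ge0// gtr0_norm ?invr_gt0//.
  apply: le_trans (le_trans h (ltW NP)); rewrite ler_piMl ?invr_ge0//.
  by rewrite lerBlDl; apply: ltW; move: f2; rewrite intrD.
apply: (measurable_fun_cvg (h := fun n z => f (z.1, q n z.2))) => [n|[x s] _]; last first.
  by apply: (@continuous_cvg _ _ _ _ _ _ (fun s : R => f (x, s))); [exact: cf|exact: q_cvg].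
move=> _ Y mY; rewrite setTI.
have -> : (fun z : T * measurableTypeR R => f (z.1, q n z.2)) @^-1` Y =
    \bigcup_(r : rat) (((fun x => f (x, ratr r)) @^-1` Y) `*` [set s | q n s = ratr r]).
  apply/seteqP; split=> [[x s] /= Yf|[x s] [r _ [/= Yf ->//]]].
  exists ((Num.floor (s * n.+1%:R))%:~R / n.+1%:R) => //; split=> /=.
    by rewrite rmorphM/= fmorphV/= ratr_int ratr_nat.
  by rewrite rmorphM/= fmorphV/= ratr_int ratr_nat.
apply: bigcupT_measurable_rat => r; apply: measurableX.
  by rewrite -[X in measurable X]setTI; exact: mf.
have := mq n measurableT [set ratr r] (measurable_set1 _).
by rewrite setTI.
Qed.
End Caratheodory.

(** * Continuous functions, test functions and Euclidean balls *)

Section ContinuousR3.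
Context {R : realType}.
Implicit Types (f g : R3 R -> R) (j : 'I_3).

(** The sigma-algebra is the product one and is not given through the open sets of the product.
    Continuity in each variable, with [caratheodory_measurable] applied twice, yields joint
    measurability. *)
Lemma continuous_measurableR3 f : continuous f -> measurable_fun setT f.
Proof.
move=> cf; apply: (@caratheodory_measurable _ (measurableTypeR R * measurableTypeR R)%type R f).
  move=> c; apply: (@caratheodory_measurable _ (measurableTypeR R) R (fun p => f (p, c))).
    move=> b; apply: (@continuous_measurable_fun _ (fun a => f ((a, b), c))) => a.
    apply: (@continuous_comp _ _ _ (fun a : R => ((a, b), c) : R3 R) f); last exact: cf.
    exact: (cvg_pair (cvg_pair (@cvg_id _ _) (cvg_cst _)) (cvg_cst _)).
  move=> a b; apply: (@continuous_comp _ _ _ (fun b : R => ((a, b), c) : R3 R) f); last exact: cf.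
  exact: (cvg_pair (cvg_pair (cvg_cst _) (@cvg_id _ _)) (cvg_cst _)).
move=> [a b] c; apply: (@continuous_comp _ _ _ (fun c : R => ((a, b), c) : R3 R) f); last exact: cf.
exact: (cvg_pair (cvg_cst _) (@cvg_id _ _)).
Qed.

Definition bsupp f := exists M : R, forall x, M < `|x| -> f x = 0.

Lemma integrable_box f (M K : R) : measurable_fun setT f ->
  (forall x, `|x| <= M -> `|f x| <= K) -> leb3.-integrable (box M) (EFin \o f).
Proof.
move=> mf fK; apply: measurable_bounded_integrable.
- exact: measurable_box.
- exact: leb3_box.
- exact: measurable_funTS.
- exists K; split; first exact: num_real.
  by move=> r Kr x /= xM; apply: le_trans (fK _ xM) (ltW Kr).
Qed.

Lemma integrable_bounded_supp f (M K : R) : measurable_fun setT f ->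
  (forall x, M < `|x| -> f x = 0) -> (forall x, `|x| <= M -> `|f x| <= K) ->
  leb3.-integrable setT (EFin \o f).
Proof.
move=> mf f0 fK; have := integrable_box mf fK.
move=> /(integrable_mkcond _ (measurable_box M)).1.
apply: eq_integrable => // x _ /=; rewrite patchE; case: ifPn => //.
rewrite notin_setE /box/= => /negP; rewrite -ltNge => xM.
by rewrite f0.
Qed.

Lemma continuous_integrable f : continuous f -> bsupp f -> leb3.-integrable setT (EFin \o f).
Proof.
move=> cf [M f0]; have [K K0 fK] := continuous_bounded M cf.
by apply: (integrable_bounded_supp (M := M) (K := K)) => //; exact: continuous_measurableR3.
Qed.

Lemma Rintegral_translate f (a : R3 R) : continuous f -> bsupp f ->
  \int[leb3]_x f (x + a) = \int[leb3]_x f x.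
Proof.
move=> cf sf; have mf : measurable_fun setT (EFin \o f).
  by apply/measurable_EFinP; exact: continuous_measurableR3.
rewrite /Rintegral; congr fine; rewrite [LHS]integralE [RHS]integralE.
have tr (g : R3 R -> \bar R) : measurable_fun setT g -> (forall x, 0 <= g x)%E ->
    (\int[leb3]_x g (x + a)%R = \int[leb3]_x g x)%E.
  move=> mg g0; have := ge0_integral_leb3_affine a ltr01 mg g0.
  rewrite invr1 expr1n mul1e => <-; apply: eq_integral => x _.
  by rewrite scale1r addrC.
have mp := measurable_funepos mf; have mn := measurable_funeneg mf.
congr (_ - _)%E.
  have e := tr _ mp (fun x => funepos_ge0 _ x).
  by rewrite -e; apply: eq_integral => x _; rewrite !funeposE.
have e := tr _ mn (fun x => funeneg_ge0 _ x).
by rewrite -e; apply: eq_integral => x _; rewrite !funenegE.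
Qed.

Lemma bsupp_partial f j : Ck 1 f -> bsupp f -> bsupp (partial j f).
Proof.
move=> Cf [M f0]; exists M => x xM.
rewrite /partial -[RHS](derive_cst 0 x (basis j)); apply: near_eq_derive.
have : \forall y \near x, M < `|y|.
  apply: (@cvgr_gt _ _ (nbhs x) _ (fun y => `|y|) `|x|) => //.
  exact: norm_continuous.
by apply: filterS => y /f0 ->.
Qed.

Lemma bsuppMl f g : bsupp f -> bsupp (fun x => f x * g x).
Proof. by move=> [M f0]; exists M => x /f0 ->; rewrite mul0r. Qed.

Lemma bsuppMr f g : bsupp g -> bsupp (fun x => f x * g x).
Proof. by move=> [M f0]; exists M => x /f0 ->; rewrite mulr0. Qed.

(* Difference quotients have zero integral by translation invariance. *)
Lemma Rintegral_partial f j : Ck 1 f -> bsupp f -> \int[leb3]_x partial j f x = 0.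
Proof.
move=> Cf sf; have cf := Ck_continuous Cf; have [df Cp] := CkS Cf j; have cp := Ck_continuous Cp.
have [K K0 pK] : exists2 K : R, 0 <= K & forall x, `|partial j f x| <= K.
  have [M' pf0] := bsupp_partial j Cf sf.
  have [K K0 pK] := continuous_bounded M' cp; exists K => // x.
  by have [/pK//|/pf0 ->] := leP `|x| M'; rewrite normr0.
have [M pf0] := bsupp_partial j Cf sf.
pose s n : R := n.+1%:R^-1.
have s0 n : 0 < s n by rewrite /s invr_gt0.
have s1 n : s n <= 1 by rewrite /s invf_le1// ler1n.
pose q n (x : R3 R) := (s n)^-1 * (f (x + s n *: basis j) - f x).
have qE n x : exists2 t : R, `|t| <= s n & q n x = partial j f (x + t *: basis j).
  have [t ts e] := mean_value_line x (s n) df; exists t; first by rewrite -[s n]gtr0_norm.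
  by rewrite /q e mulKf// gt_eqF.
have nb t : `|t *: basis j : R3 R| <= `|t|.
  apply/normR3P => k; rewrite coordZ coord_basis.
  by case: (j == k); rewrite ?mulr1// mulr0 normr0.
have trb n : bsupp (fun x : R3 R => f (x + s n *: basis j)).
  have [M' f0] := sf; exists (M' + 1) => x xM; apply: f0.
  rewrite -(ltrD2r 1); apply: lt_le_trans xM _.
  rewrite -[X in `|X| <= _](addrK (s n *: basis j)); apply: le_trans (ler_normB _ _) _.
  by rewrite lerD2l; apply: le_trans (nb _) _; rewrite gtr0_norm.
have ctr n : continuous (fun x : R3 R => f (x + s n *: basis j)).
  move=> x; apply: (@continuous_comp _ _ _ (fun x : R3 R => x + s n *: basis j) f); last exact: cf.
  by apply: cvgD; [exact: cvg_id|exact: cvg_cst].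
have iB n : leb3.-integrable setT (EFin \o (fun x : R3 R => f (x + s n *: basis j) - f x)).
  apply: (@integrableB _ _ _ _ _ measurableT (EFin \o (fun x : R3 R => f (x + s n *: basis j))) (EFin \o f));
    exact: continuous_integrable.
have qint n : \int[leb3]_x q n x = 0.
  rewrite /q (RintegralZl _ measurableT (iB n)).
  rewrite RintegralB//; try exact: continuous_integrable.
  by rewrite Rintegral_translate// subrr mulr0.
have qM n x : M + 1 < `|x| -> q n x = 0.
  move=> xM; have [t ts ->] := qE n x; apply: pf0.
  rewrite -(ltrD2r 1); apply: lt_le_trans xM _.
  rewrite -[X in `|X| <= _](addrK (t *: basis j)); apply: le_trans (ler_normB _ _) _.
  by rewrite lerD2l; apply: le_trans (nb _) _; apply: le_trans ts (s1 n).
have qK n x : `|q n x| <= K by have [t ts ->] := qE n x.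
have qc x : q n x @[n --> \oo] --> partial j f x.
  apply/cvgrPdist_le => e e0; have [dl d0 dP] := continuous_near_dist x cp e0.
  have [N NP] := inv_nat_lt d0; exists N => // n /= Nn.
  have [t ts ->] := qE n x; rewrite distrC; apply: dP; rewrite addrAC subrr add0r.
  apply: le_trans (nb _) _; apply: le_trans ts _; apply: le_trans (ltW NP).
  by rewrite /s lef_pV2 ?posrE// ler_nat.
have mq n : measurable_fun setT (q n).
  apply: measurable_funM; first exact: measurable_cst.
  by apply: measurable_funB; apply: continuous_measurableR3.
have mqE n : measurable_fun setT (fun x => (q n x)%:E) by apply/measurable_EFinP.
have mpE : measurable_fun setT (fun x => (partial j f x)%:E).
  by apply/measurable_EFinP; exact: continuous_measurableR3.
(* Domination: the shifts have length at most 1, so every difference quotient vanishes outside the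
   box of size [M + 1], and by the mean value theorem [K] bounds it inside. *)
have iK : leb3.-integrable setT (EFin \o (fun x => K * \1_(box (M + 1)) x)).
  apply: (integrable_bounded_supp (M := M + 1) (K := K)).
  - apply: measurable_funM; first exact: measurable_cst.
    by apply: measurable_indic; exact: measurable_box.
  - by move=> x xM; rewrite indicE memNset ?mulr0// /box/= => /(lt_le_trans xM); rewrite ltxx.
  - by move=> x xM; rewrite indicE mem_set// mulr1 ger0_norm.
have bd (x : R3 R) n : setT x -> (`|(q n x)%:E| <= (K * \1_(box (M + 1)) x)%:E)%E.
  move=> _; rewrite lee_fin indicE; case: (boolP (x \in _)) => [_|]; first by rewrite mulr1.
  rewrite notin_setE /box/= => /negP; rewrite -ltNge => xM.
  by rewrite qM// normr0 mulr0.
have qcE x : setT x -> (q n x)%:E @[n --> \oo] --> (partial j f x)%:E.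
  by move=> _; apply: cvg_EFin; [exact: nearW|exact: qc].
have [_ _] := @dominated_convergence _ _ _ leb3 setT measurableT _ _ _ mqE mpE
  (aeW _ qcE) iK (aeW _ bd).
have -> : [sequence (\int[leb3]_x (q n x)%:E)%E]_n = (fun=> 0%E).
  apply/funext => n /=.
  have iq : leb3.-integrable setT (EFin \o q n).
    rewrite (_ : EFin \o q n = fun x : R3 R => ((s n)^-1)%:E * (f (x + s n *: basis j) - f x)%:E)%E.
      exact: (integrableZl measurableT _ (iB n)).
    by apply/funext => x /=; rewrite -EFinM.
  rewrite -(fineK (integrable_fin_num measurableT iq)).
  by have := qint n; rewrite /Rintegral => ->.
by move=> /(cvg_unique (@ereal_hausdorff R) (cvg_cst 0%E)); rewrite /Rintegral => <-.
Qed.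

End ContinuousR3.

Section TestFields.
Context {R : realType}.
Implicit Types (f g phi : R3 R -> R) (j : 'I_3).

Lemma closed_box (M : R) : closed (box M).
Proof.
have -> : box M = (fun x : R3 R => `|x|) @^-1` [set y : R | y <= M] by [].
apply: closed_comp; last exact: closed_le.
by move=> x _; exact: norm_continuous.
Qed.

(** Closed bounded sets are compact here, and bounded support is much easier to propagate through
    sums, products and derivatives. *)
Lemma CcinftyP f : Ccinfty f <-> smooth f /\ bsupp f.
Proof.
split=> -[sf supp]; split=> //.
  have [M MP] : exists M : R, forall x, closure [set x | f x != 0] x -> `|x| <= M.
    have [->|/set0P ne] := eqVneq (closure [set x | f x != 0]) set0.
      by exists 0 => x.
    have [|c _ cP] := @compact_EVT_max _ _ (fun x : R3 R => `|x|) _ ne supp.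
      by apply: continuous_subspaceT => x; exact: norm_continuous.
    by exists `|c| => x fx; apply: cP; rewrite inE.
  exists M => x Mx; apply/eqP; apply: contraTT Mx => fx; rewrite -leNgt.
  by apply: MP; exact: subset_closure.
have [M f0] := supp.
have sub : closure [set x | f x != 0] `<=` box M.
  rewrite (closure_id (box M)).1; last exact: closed_box.
  apply: closure_subset => x /= fx; rewrite /box/= leNgt; apply: contra fx.
  by move=> /f0 ->.
apply: (subclosed_compact _ _ sub); [exact: closed_closure|exact: compact_boxR3].
Qed.

Lemma Ccinfty_smooth f : Ccinfty f -> smooth f. Proof. by move/CcinftyP => []. Qed.
Lemma Ccinfty_bsupp f : Ccinfty f -> bsupp f. Proof. by move/CcinftyP => []. Qed.

Lemma Ccinfty_partial f j : Ccinfty f -> Ccinfty (partial j f).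
Proof.
move=> /CcinftyP[sf bf]; apply/CcinftyP; split; first exact: smooth_partial.
by apply: bsupp_partial => //; exact: smooth_Ck.
Qed.

Lemma smoothM f g : smooth f -> smooth g -> smooth (fun x => f x * g x).
Proof. by move=> /smoothP sf /smoothP sg; apply/smoothP => n; exact: CkM. Qed.

Lemma smoothD f g : smooth f -> smooth g -> smooth (fun x => f x + g x).
Proof. by move=> /smoothP sf /smoothP sg; apply/smoothP => n; exact: CkD. Qed.

Lemma smooth_cst (c : R) : smooth (fun=> c).
Proof. by apply/smoothP => n; exact: Ck_cst. Qed.

Lemma smoothZ (c : R) f : smooth f -> smooth (fun x => c * f x).
Proof. exact: (smoothM (smooth_cst c)). Qed.

Lemma smoothN f : smooth f -> smooth (fun x => - f x).
Proof. by move=> /smoothP sf; apply/smoothP => n; exact: CkN. Qed.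

Lemma smoothB f g : smooth f -> smooth g -> smooth (fun x => f x - g x).
Proof. by move=> sf sg; exact: (smoothD sf (smoothN sg)). Qed.

Lemma smooth_sum (I : Type) (r : seq I) (F : I -> R3 R -> R) :
  (forall i, smooth (F i)) -> smooth (fun x => \sum_(i <- r) F i x).
Proof.
move=> sF; apply/smoothP => n; apply: Ck_sum => i; exact: smooth_Ck.
Qed.

Lemma smooth_coord j : smooth (fun x : R3 R => coord x j).
Proof. by apply/smoothP => n; exact: Ck_coord. Qed.

Lemma smooth_comp (e : R -> R) f : (forall n, Dk n e) -> smooth f -> smooth (e \o f).
Proof. by move=> De /smoothP sf; apply/smoothP => n; exact: Ck_comp. Qed.

Lemma bsuppD f g : bsupp f -> bsupp g -> bsupp (fun x => f x + g x).
Proof.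
move=> [M f0] [N g0]; exists (Num.max M N) => x; rewrite gt_max => /andP[Mx Nx].
by rewrite f0// g0// addr0.
Qed.

Lemma partialD f g j x : smooth f -> smooth g ->
  partial j (fun x => f x + g x) x = partial j f x + partial j g x.
Proof.
move=> sf sg; have := is_deriveD (smooth_is_derive j x sf) (smooth_is_derive j x sg).
by move=> [].
Qed.

Lemma partialM f g j x : smooth f -> smooth g ->
  partial j (fun x => f x * g x) x = f x * partial j g x + g x * partial j f x.
Proof.
move=> sf sg; have := is_deriveM (smooth_is_derive j x sf) (smooth_is_derive j x sg).
by move=> [].
Qed.

Lemma partial_cst (c : R) j x : partial j (fun=> c) x = 0.
Proof. exact: derive_cst. Qed.

Lemma partialZ (c : R) f j x : smooth f -> partial j (fun x => c * f x) x = c * partial j f x.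
Proof.
by move=> sf; rewrite (partialM j x (smooth_cst c) sf) partial_cst mulr0 addr0.
Qed.

Lemma partialB f g j x : smooth f -> smooth g ->
  partial j (fun x => f x - g x) x = partial j f x - partial j g x.
Proof.
move=> sf sg; have -> : (fun x => f x - g x) = (fun x => f x + -1 * g x).
  by apply/funext => y; rewrite mulN1r.
by rewrite (partialD j x sf (smoothZ (-1) sg)) (partialZ _ j x sg) mulN1r.
Qed.

Lemma partial_sum (I : Type) (r : seq I) (F : I -> R3 R -> R) j x :
  (forall i, smooth (F i)) ->
  partial j (fun x => \sum_(i <- r) F i x) x = \sum_(i <- r) partial j (F i) x.
Proof.
move=> sF; elim: r => [|i r IH].
  by under eq_fun do rewrite big_nil; rewrite partial_cst big_nil.
under eq_fun do rewrite big_cons; rewrite partialD//; last exact: smooth_sum.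
by rewrite IH big_cons.
Qed.

Lemma partial_coord i j (x : R3 R) : partial j (fun x : R3 R => coord x i) x = (j == i)%:R.
Proof.
have : is_derive x (basis j) (fun x : R3 R => coord x i) (j == i)%:R.
  by apply: is_derive_affine => h; rewrite coordD coordZ coord_basis.
by move=> [].
Qed.

Lemma partial_comp (e e' : R -> R) f j x : (forall s : R, is_derive s 1 e (e' s)) ->
  smooth f -> partial j (e \o f) x = e' (f x) * partial j f x.
Proof.
by move=> de sf; have [] := is_derive_scalar_comp de (smooth_is_derive j x sf).
Qed.

Lemma Rintegral_by_parts f g j : Ck 1 f -> Ck 1 g -> bsupp g ->
  \int[leb3]_x (f x * partial j g x) = - \int[leb3]_x (partial j f x * g x).
Proof.
move=> Cf Cg bg.
have [df Cpf] := CkS Cf j; have [dg Cpg] := CkS Cg j.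
have [cf cg] := (Ck_continuous Cf, Ck_continuous Cg).
have [cpf cpg] := (Ck_continuous Cpf, Ck_continuous Cpg).
have := Rintegral_partial j (CkM Cf Cg) (bsuppMr f bg).
have -> : partial j (fun x => f x * g x) = (fun x => f x * partial j g x + partial j f x * g x).
  apply/funext => x; have [_ +] := is_deriveM (df x) (dg x).
  by rewrite /partial => ->; congr (_ + _); rewrite [RHS]mulrC.
rewrite RintegralD//.
- by move/eqP; rewrite addr_eq0 => /eqP.
- apply: continuous_integrable; first by move=> x; exact: (continuousM (cf x) (cpg x)).
  by apply: bsuppMr; exact: bsupp_partial.
- apply: continuous_integrable; first by move=> x; exact: (continuousM (cpf x) (cg x)).
  exact: bsuppMr.
Qed.

End TestFields.

Section Balls.
Context {R : realType}.
Implicit Types (f g : R3 R -> R) (j : 'I_3).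

Definition nsq (x : R3 R) : R := \sum_(j < 3) coord x j ^+ 2.

Lemma nsq_ge0 x : 0 <= nsq x. Proof. by apply: sumr_ge0 => j _; exact: sqr_ge0. Qed.

Lemma smooth_nsq : smooth nsq.
Proof.
rewrite /nsq; apply: smooth_sum => j.
by under eq_fun do rewrite expr2; apply: smoothM; exact: smooth_coord.
Qed.

Lemma continuous_nsq : continuous nsq.
Proof. exact: smooth_continuous smooth_nsq. Qed.

Lemma nsq_norm x (M : R) : nsq x < M ^+ 2 -> 0 < M -> `|x| <= M.
Proof.
move=> xM M0; apply/normR3P => j; rewrite -(@ler_pXn2r _ 2%N) ?nnegrE ?(ltW M0)//.
rewrite real_normK ?num_real//; apply: le_trans (ltW xM).
by rewrite /nsq (bigD1 j)//= lerDl sumr_ge0// => i _; exact: sqr_ge0.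
Qed.

Lemma norm_nsq x (M : R) : `|x| <= M -> nsq x <= 3 * M ^+ 2.
Proof.
move=> xM; have M0 : 0 <= M := le_trans (normr_ge0 _) xM.
have h j : coord x j ^+ 2 <= M ^+ 2.
  rewrite -[coord x j ^+ 2]real_normK ?num_real// ler_pXn2r ?nnegrE//.
  by apply: le_trans xM; exact: coord_norm.
rewrite /nsq sum3; have := h (@Ordinal 3 0 isT); have := h (@Ordinal 3 1 isT).
have := h (@Ordinal 3 2 isT); lra.
Qed.

Lemma nsqZ (t : R) x : nsq (t *: x) = t ^+ 2 * nsq x.
Proof. by rewrite /nsq mulr_sumr; apply: eq_bigr => j _; rewrite coordZ exprMn. Qed.

Lemma edistE (x y : R3 R) : edist x y = Num.sqrt (nsq (y - x)).
Proof.
rewrite /edist /nsq; congr Num.sqrt; apply: eq_bigr => j _.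
by rewrite coordB -sqrrN opprB.
Qed.

Lemma eballP (x : R3 R) (r : R) y : 0 < r -> eball x r y <-> nsq (y - x) < r ^+ 2.
Proof.
move=> r0; rewrite /eball/= edistE -(@ltr_pXn2r _ 2%N) ?nnegrE ?sqrtr_ge0 ?(ltW r0)//.
by rewrite sqr_sqrtr ?nsq_ge0.
Qed.

Lemma eball_le0 (x : R3 R) (r : R) : r <= 0 -> eball x r = set0.
Proof.
move=> r0; apply/seteqP; split=> // y; rewrite /eball/= edistE => h.
by have := lt_le_trans h r0; rewrite ltNge sqrtr_ge0.
Qed.

Lemma measurable_eball (x : R3 R) (r : R) : measurable (eball x r).
Proof.
have [r0|r0] := leP r 0; first by rewrite eball_le0.
have -> : eball x r = (fun y => nsq (y - x)) @^-1` `]-oo, (r ^+ 2)[.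
  apply/seteqP; split=> y /=; first by move=> /(eballP x y r0); rewrite in_itv.
  by rewrite in_itv/= => h; apply/eballP.
rewrite -[X in measurable X]setTI.
apply: (continuous_measurableR3 (f := fun y => nsq (y - x))) => //.
move=> y; apply: (@continuous_comp _ _ _ (fun y : R3 R => y - x) nsq); last exact: continuous_nsq.
by apply: cvgB; [exact: cvg_id|exact: cvg_cst].
Qed.

Lemma eball_box (r : R) : eball 0 r `<=` box r.
Proof.
have [r0|r0] := leP r 0; first by rewrite eball_le0.
by move=> y /(eballP 0 y r0); rewrite subr0 => /nsq_norm; apply.
Qed.

Lemma box_eball (M : R) : 0 <= M -> box M `<=` eball 0 (2 * M + 1).
Proof.
move=> M0 x /norm_nsq h; apply/eballP; first lra.
rewrite subr0; apply: le_lt_trans h _.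
rewrite sqrrD exprMn; have := sqr_ge0 M; lra.
Qed.

Lemma loc_integrable_box f : loc_integrable f <-> forall M : R, leb3.-integrable (box M) (EFin \o f).
Proof.
split=> H r.
  have [r0|r0] := leP 0 r; last first.
    have -> : box r = set0.
      by apply/seteqP; split=> // x; rewrite /box/= => h; have := le_trans (normr_ge0 _) h; rewrite leNgt r0.
    exact: integrable_set0.
  apply: (integrableS _ _ (box_eball r0)) => //; [exact: measurable_eball|exact: measurable_box].
apply: (integrableS _ _ (@eball_box r)) => //; [exact: measurable_box|exact: measurable_eball].
Qed.

Lemma continuous_loc_integrable f : continuous f -> loc_integrable f.
Proof.
move=> cf; apply/loc_integrable_box => M; have [K K0 fK] := continuous_bounded M cf.
by apply: (integrable_box (K := K)) => //; exact: continuous_measurableR3.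
Qed.

Lemma loc_integrable_measurable f : loc_integrable f -> measurable_fun setT f.
Proof.
move=> /loc_integrable_box H; rewrite -box_cover; apply/measurable_fun_bigcup => n.
  exact: measurable_box.
by apply/measurable_EFinP; exact: measurable_int (H _).
Qed.

Lemma is_wgrad_jacobian (phi : vfield R) : vCcinfty phi -> is_wgrad phi (jacobian phi).
Proof.
move=> Cphi; split=> [i j|psi /CcinftyP[spsi bpsi] i j].
  under eq_fun do rewrite mxE; apply: continuous_loc_integrable.
  by apply/smooth_continuous/smooth_partial; apply/Ccinfty_smooth/Cphi.
rewrite Rintegral_by_parts//; [|by apply/smooth_Ck/Ccinfty_smooth/Cphi|exact: smooth_Ck].
by congr (- _); apply: eq_Rintegral => x _; rewrite mxE.
Qed.

End Balls.

(** * Hardy inequality and weak gradients *)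

Section Hardy.
Context {R : realType}.
Implicit Types (f g phi : R3 R -> R) (j : 'I_3).

Lemma Ck_inv n f : (forall x, f x != 0) -> Ck n f -> Ck n (fun x => (f x)^-1).
Proof.
move=> f0; elim: n => [|n IH] Cf; have cf := Ck_continuous Cf;
  (split; first by move=> x; apply: cvgV; [exact: f0|exact: cf]) => // j.
have [df Cp] := CkS Cf j.
exists (fun x => - ((f x)^-1 * (f x)^-1) * partial j f x).
  move=> x; have [d1 d2] := df x; apply: DeriveDef; first exact: derivableV.
  by rewrite deriveV; [rewrite -exprVn expr2|exact: f0|exact: d1].
by apply: CkM => //; apply: CkN; apply: CkM; exact: IH (Ck_le Cf).
Qed.

(** A smooth substitute for the singular weight 1/|x| of the classical Hardy inequality. It is
    bounded below on bounded sets, so a weighted L^2 bound still gives local control. *)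
Definition hweight (x : R3 R) : R := (1 + nsq x)^-1.

Lemma hweight_den (x : R3 R) : 0 < 1 + nsq x.
Proof. by rewrite ltr_pwDl// nsq_ge0. Qed.

Lemma smooth_hweight : smooth hweight.
Proof.
apply/smoothP => n; apply: Ck_inv => [x|]; first by rewrite gt_eqF// hweight_den.
by apply: CkD; [exact: Ck_cst|exact/smooth_Ck/smooth_nsq].
Qed.

Lemma partial_sqr f j x : smooth f -> partial j (fun x => f x ^+ 2) x = 2 * f x * partial j f x.
Proof.
move=> sf; have -> : (fun x => f x ^+ 2) = (fun x => f x * f x).
  by apply/funext => y; rewrite expr2.
by rewrite partialM//; ring.
Qed.

Lemma smooth_sqr f : smooth f -> smooth (fun x => f x ^+ 2).
Proof. by move=> sf; under eq_fun do rewrite expr2; exact: smoothM. Qed.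

Lemma partial_nsq j x : partial j (@nsq R) x = 2 * coord x j.
Proof.
have sc i : smooth (fun y : R3 R => coord y i ^+ 2) by apply: smooth_sqr; exact: smooth_coord.
rewrite /nsq partial_sum// (bigD1 j)//= big1 ?addr0 => [|i ij].
  by rewrite (partial_sqr _ _ (smooth_coord j)) partial_coord eqxx mulr1.
by rewrite (partial_sqr _ _ (smooth_coord i)) partial_coord eq_sym (negbTE ij) mulr0.
Qed.

Lemma partial_hweight j x : partial j hweight x = - 2 * coord x j * hweight x ^+ 2.
Proof.
have s1 : smooth (fun y : R3 R => 1 + nsq y) by apply: smoothD; [exact: smooth_cst|exact: smooth_nsq].
have [d1 d2] := smooth_is_derive j x s1.
rewrite /partial /hweight deriveV//; last by rewrite gt_eqF// hweight_den.
rewrite -/(partial j _ x) partialD; [|exact: smooth_cst|exact: smooth_nsq].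
by rewrite partial_cst partial_nsq -exprVn /GRing.scale/=; ring.
Qed.

Lemma continuous_sqr f : continuous f -> continuous (fun x => f x ^+ 2).
Proof. by move=> cf; under eq_fun do rewrite expr2; move=> x; exact: (continuousM (cf x) (cf x)). Qed.

Lemma bsupp_sqr f : bsupp f -> bsupp (fun x => f x ^+ 2).
Proof. by move=> [M f0]; exists M => x /f0 ->; rewrite expr0n. Qed.

Lemma integrable_sqr f : continuous f -> bsupp f ->
  leb3.-integrable setT (EFin \o (fun x => f x ^+ 2)).
Proof. by move=> cf bf; apply: continuous_integrable; [exact: continuous_sqr|exact: bsupp_sqr]. Qed.

Lemma continuous_L2 f : continuous f -> bsupp f -> L2 leb3 f.
Proof.
move=> cf bf; apply: L2_intro; last exact: integrable_sqr.
exact: continuous_measurableR3.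
Qed.

Lemma Rintegral_sum3 (F : 'I_3 -> R3 R -> R) :
  (forall j, leb3.-integrable setT (EFin \o F j)) ->
  \int[leb3]_x (\sum_(j < 3) F j x) = \sum_(j < 3) \int[leb3]_x F j x.
Proof.
move=> iF; under eq_Rintegral do rewrite sum3.
have i2 : leb3.-integrable setT (EFin \o (fun x => F (@Ordinal 3 0 isT) x + F (@Ordinal 3 1 isT) x)).
  exact: (integrableD measurableT (iF _) (iF _)).
by rewrite sum3 (RintegralD measurableT i2 (iF _)) (RintegralD measurableT (iF _) (iF _)).
Qed.

Lemma integrable_sum3 (F : 'I_3 -> R3 R -> R) :
  (forall j, leb3.-integrable setT (EFin \o F j)) ->
  leb3.-integrable setT (EFin \o (fun x => \sum_(j < 3) F j x)).
Proof.
move=> iF; have -> : EFin \o (fun x => \sum_(j < 3) F j x) =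
   (fun x => (F (@Ordinal 3 0 isT) x)%:E + (F (@Ordinal 3 1 isT) x)%:E + (F (@Ordinal 3 2 isT) x)%:E)%E.
  by apply/funext => x /=; rewrite sum3.
exact: (integrableD measurableT (integrableD measurableT (iF _) (iF _)) (iF _)).
Qed.

(* Integrate the divergence of [phi^2 w x], where [w] is the weight; the
   difference between the two sides below is a sum of squares. *)
Lemma hardy phi : smooth phi -> bsupp phi ->
  \int[leb3]_x (phi x * hweight x) ^+ 2 <= 4 * \sum_(j < 3) \int[leb3]_x partial j phi x ^+ 2.
Proof.
move=> sp bp; have sw := smooth_hweight.
have cp := smooth_continuous sp; have cw := smooth_continuous sw.
pose X j x := coord x j * (phi x * (phi x * hweight x)).
have sX j : smooth (X j) := smoothM (smooth_coord j) (smoothM sp (smoothM sp sw)).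
have bX j : bsupp (X j) by apply: bsuppMr; exact: bsuppMl.
have cpw : continuous (fun x => phi x * hweight x) := smooth_continuous (smoothM sp sw).
have ipw := integrable_sqr cpw (bsuppMl hweight bp).
have cpp j := smooth_continuous (smooth_partial j sp).
have ipp j := integrable_sqr (cpp j) (bsupp_partial j (smooth_Ck 1 sp) bp).
have iX j : leb3.-integrable setT (EFin \o partial j (X j)).
  apply: continuous_integrable; first exact: (smooth_continuous (smooth_partial j (sX j))).
  exact: (bsupp_partial j (smooth_Ck 1 (sX j)) (bX j)).
have D0 : \int[leb3]_x (\sum_(j < 3) partial j (X j) x) = 0.
  by rewrite (Rintegral_sum3 iX) big1// => j _; exact: (Rintegral_partial j (smooth_Ck 1 (sX j)) (bX j)).
have pw x : 2^-1 * (phi x * hweight x) ^+ 2 - 2 * (\sum_(j < 3) partial j phi x ^+ 2)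
    <= \sum_(j < 3) partial j (X j) x.
  have XE j : partial j (X j) x = phi x * (phi x * hweight x) +
     coord x j * (2 * phi x * hweight x * partial j phi x - 2 * coord x j * hweight x ^+ 2 * phi x ^+ 2).
    have s1 := smoothM sp sw; have s2 := smoothM sp s1.
    rewrite /X (partialM _ _ (smooth_coord j) s2) (partialM _ _ sp s1) (partialM _ _ sp sw).
    by rewrite partial_hweight partial_coord eqxx mulr1; ring.
  under [leRHS]eq_bigr do rewrite XE.
  have wE : hweight x * (1 + nsq x) = 1 by rewrite mulVf// gt_eqF// hweight_den.
  rewrite -subr_ge0 !sum3.
  move: wE; rewrite /nsq sum3.
  set w := hweight x; set p := phi x; set x0 := coord x _; set x1 := coord x _; set x2 := coord x _.
  set a0 := partial _ _ _; set a1 := partial _ _ _; set a2 := partial _ _ _ => wE.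
  (* This identity cancels the last term of the decomposition below, leaving squares and a multiple
     of [p ^+ 2 * w]. *)
  have N : w * (x0 ^+ 2 + x1 ^+ 2 + x2 ^+ 2) = 1 - w by rewrite -wE; ring.
  rewrite [X in 0 <= X](_ : _ = 2 * ((a0 + 2^-1 * p * w * x0) ^+ 2 + (a1 + 2^-1 * p * w * x1) ^+ 2
     + (a2 + 2^-1 * p * w * x2) ^+ 2) + 2^-1 * p ^+ 2 * w + 2 * (p * w) ^+ 2
     + 5 / 2 * p ^+ 2 * w * (1 - w - w * (x0 ^+ 2 + x1 ^+ 2 + x2 ^+ 2))); last by field.
  have w0 : 0 <= w by rewrite invr_ge0 ltW// hweight_den.
  rewrite N subrr mulr0 addr0.
  have hS : 0 <= (a0 + 2^-1 * p * w * x0) ^+ 2 + (a1 + 2^-1 * p * w * x1) ^+ 2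
     + (a2 + 2^-1 * p * w * x2) ^+ 2 by rewrite !addr_ge0 ?sqr_ge0.
  have hT := mulr_ge0 (sqr_ge0 p) w0; have hU := sqr_ge0 (p * w); rewrite -mulrA; lra.
have iL : leb3.-integrable setT (EFin \o (fun x => 2^-1 * (phi x * hweight x) ^+ 2)).
  exact: (integrableZl measurableT 2^-1 ipw).
have iS := integrable_sum3 ipp.
have iR : leb3.-integrable setT (EFin \o (fun x => 2 * \sum_(j < 3) partial j phi x ^+ 2)).
  exact: (integrableZl measurableT 2 iS).
have := le_Rintegral measurableT (integrableB measurableT iL iR) (integrable_sum3 iX) (fun x _ => pw x).
rewrite D0 (RintegralB measurableT iL iR) (RintegralZl _ measurableT ipw).
by rewrite (RintegralZl _ measurableT iS) (Rintegral_sum3 ipp); lra.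
Qed.

End Hardy.

(** * The fundamental lemma of the calculus of variations *)

Section Fundamental.
Context {R : realType}.
Implicit Types (f g h phi : R3 R -> R) (a b : 'I_3 -> R).

Definition obox a b : set (R3 R) := [set x | forall j, a j < coord x j < b j].

Definition oboxes : set (set (R3 R)) := [set A | exists a b, A = obox a b].

Lemma measurable_obox a b : measurable (obox a b).
Proof.
have -> : obox a b = \bigcap_(j : 'I_3) (fun x : R3 R => coord x j) @^-1` `](a j), (b j)[.
  apply/seteqP; split=> [x H j _|x H j]; first by rewrite /= in_itv/=.
  by have := H j I; rewrite /= in_itv.
apply: fin_bigcap_measurable => // j _; rewrite -[X in measurable X]setTI.
exact: (measurable_coord j).
Qed.

Lemma oboxes_setI : setI_closed oboxes.
Proof.
move=> _ _ [a [b ->]] [a' [b' ->]].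
exists (fun j => Num.max (a j) (a' j)), (fun j => Num.min (b j) (b' j)).
apply/seteqP; split=> [x [H H'] j|x H].
  by rewrite gt_max lt_min; have /andP[-> ->] := H j; have /andP[-> ->] := H' j.
by split=> j; have := H j; rewrite gt_max lt_min => /andP[/andP[? ?] /andP[? ?]]; apply/andP.
Qed.

(** A coordinate half-space is a countable union of open boxes, so the boxes generate the
    sigma-algebra. Being stable under intersection, they start the Dynkin argument in
    [fundamental_lemma]. *)
Lemma measurable_oboxes : @measurable _ (R3 R) = <<s oboxes >>.
Proof.
apply/seteqP; split; last first.
  apply: smallest_sub; first exact: sigma_algebra_measurable.
  by move=> _ [a [b ->]]; exact: measurable_obox.
pose T := g_sigma_algebraType oboxes.
have mid : measurable_fun setT (id : T -> R3 R).
  apply: measurable_mapR3 => j.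
  apply: (measurability (@RGenOInfty.G R)); first exact: RGenOInfty.measurableE.
  move=> _ [_ [c ->] <-]; rewrite setTI.
  have -> : (fun t : T => coord (t : R3 R) j) @^-1` `]c, +oo[%classic =
      \bigcup_(n : nat) obox (fun k => if k == j then c else - n%:R) (fun=> n%:R).
    apply/seteqP; split=> x.
      rewrite /= in_itv/= andbT => cx; exists (Num.trunc `|(x : R3 R)|).+1 => // k.
      have := le_lt_trans (coord_norm (x : R3 R) k) (truncnS_gt _); rewrite ltr_norml => /andP[h1 h2].
      by rewrite h2 andbT; case: eqP => // ->.
    by move=> [n _ /(_ j)]; rewrite eqxx /= in_itv/= andbT => /andP[].
  apply: bigcup_measurable => n _; apply: sub_sigma_algebra.
  by eexists; eexists.
move=> A mA; have := mid measurableT A mA; by rewrite setTI preimage_id.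
Qed.

Lemma loc_integrableM f g : loc_integrable f -> continuous g -> bsupp g ->
  leb3.-integrable setT (EFin \o (fun x => f x * g x)).
Proof.
move=> lf cg [M g0]; have [K K0 gK] := continuous_bounded M cg.
have /loc_integrable_box/(_ M) iM := lf.
have mf := loc_integrable_measurable lf.
have mg := continuous_measurableR3 cg.
have iK : leb3.-integrable setT ((EFin \o (fun x => K * f x)) \_ (box M)).
  apply/(integrable_mkcond _ (measurable_box M)).
  exact: (integrableZl (measurable_box M) K iM).
apply: (le_integrable measurableT _ _ iK).
  by apply/measurable_EFinP; exact: measurable_funM.
move=> x _ /=; rewrite patchE; case: ifPn => [/set_mem xM|].
  rewrite lee_fin !normrM mulrC ler_wpM2r// (ger0_norm K0).
  exact: gK.
rewrite notin_setE /box/= => /negP; rewrite -ltNge => /g0 ->.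
by rewrite mulr0.
Qed.

(** A smooth approximation from below of the indicator of [obox a b]: for [s > 0] the factor
    [bump 0 (n.+1%:R * s)] is exp (- 1 / ((n+1) s)), which tends to 1, and it is 0 for [s <= 0]. *)
Definition bbump a b n (x : R3 R) : R :=
  \prod_(j < 3) (bump 0 (n.+1%:R * (coord x j - a j)) * bump 0 (n.+1%:R * (b j - coord x j))).

Lemma smooth_prod (I : Type) (r : seq I) (F : I -> R3 R -> R) :
  (forall i, smooth (F i)) -> smooth (fun x => \prod_(i <- r) F i x).
Proof.
move=> sF; elim: r => [|i r IH].
  by under eq_fun do rewrite big_nil; exact: smooth_cst.
by under eq_fun do rewrite big_cons; exact: (smoothM (sF i) IH).
Qed.

Lemma smooth_bbump a b n : smooth (bbump a b n).
Proof.
have s1 j (c : R) : smooth (fun x : R3 R => bump 0 (n.+1%:R * (coord x j - c))).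
  apply: (smooth_comp (e := bump 0)); first by move=> m; exact: Dk_bump.
  by apply: smoothZ; apply: smoothB; [exact: smooth_coord|exact: smooth_cst].
have s2 j (c : R) : smooth (fun x : R3 R => bump 0 (n.+1%:R * (c - coord x j))).
  apply: (smooth_comp (e := bump 0)); first by move=> m; exact: Dk_bump.
  by apply: smoothZ; apply: smoothB; [exact: smooth_cst|exact: smooth_coord].
by apply: smooth_prod => j; exact: smoothM.
Qed.

Lemma bump0_le1 (s : R) : 0 <= bump 0 s <= 1.
Proof.
rewrite bump_ge0 /bump; case: ifPn => s0; last by rewrite ler01.
by rewrite expr0 mul1r expR_le1 oppr_le0 invr_ge0 ltW.
Qed.

Lemma bbump_le1 a b n x : 0 <= bbump a b n x <= 1.
Proof.
rewrite /bbump; apply/andP; split.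
  by apply: prodr_ge0 => j _; rewrite mulr_ge0// bump_ge0.
apply: prodr_ile1 => j _; rewrite mulr_ge0 ?bump_ge0//=.
have /andP[_ h1] := bump0_le1 (n.+1%:R * (coord x j - a j)).
have /andP[_ h2] := bump0_le1 (n.+1%:R * (b j - coord x j)).
by apply: mulr_ile1; rewrite ?bump_ge0.
Qed.

Lemma bbump_out a b n x : ~ obox a b x -> bbump a b n x = 0.
Proof.
move=> /existsNP[j /negP]; rewrite negb_and -!leNgt => H.
rewrite /bbump (bigD1 j)//=.
have z (s : R) : s <= 0 -> bump 0 (n.+1%:R * s) = 0.
  by move=> s0; rewrite /bump ifF// ltNge mulr_ge0_le0.
case/orP: H => h; first by rewrite z ?mul0r// subr_le0.
by rewrite [X in _ * X * _]z ?mulr0 ?mul0r// subr_le0.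
Qed.

Lemma bsupp_bbump a b n : bsupp (bbump a b n).
Proof.
exists (\sum_(j < 3) (`|a j| + `|b j|)) => x xM; apply: bbump_out => H.
suff : `|x| <= \sum_(j < 3) (`|a j| + `|b j|) by rewrite leNgt xM.
apply/normR3P => j; apply: (@le_trans _ _ (`|a j| + `|b j|)).
  have /andP[h1 h2] := H j; rewrite ler_norml.
  have := ler_norm (- a j); have := ler_norm (b j); rewrite normrN.
  have := normr_ge0 (a j); have := normr_ge0 (b j).
  by move=> *; apply/andP; split; lra.
by rewrite (bigD1 j)//= lerDl sumr_ge0// => i _; rewrite addr_ge0.
Qed.

Lemma bbump_cvg a b x : bbump a b n x @[n --> \oo] --> (\1_(obox a b) x : R).
Proof.
rewrite indicE; case: (boolP (x \in _)) => [/set_mem H|].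
  have z (s : R) : 0 < s -> bump 0 (n.+1%:R * s) @[n --> \oo] --> (1 : R).
    move=> s0; have E n : bump 0 (n.+1%:R * s) = expR (- (s^-1 * n.+1%:R^-1)).
      by rewrite /bump mulr_gt0// expr0 mul1r invfM mulrC.
    under eq_fun do rewrite E.
    have c0 : - (s^-1 / n.+1%:R) @[n --> \oo] --> - (s^-1 * 0).
      by apply: cvgN; apply: cvgM; [exact: cvg_cst|exact: cvg_harmonic].
    have e1 : expR (- (s^-1 * 0)) = 1 by rewrite mulr0 oppr0 expR0.
    by have := cvg_comp _ _ c0 (@continuous_expR R (- (s^-1 * 0))); rewrite e1.
  have zz j : (bump 0 (n.+1%:R * (coord x j - a j)) * bump 0 (n.+1%:R * (b j - coord x j))) @[n --> \oo] --> (1 : R).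
    have /andP[h1 h2] := H j.
    have := cvgM (z _ (_ : 0 < coord x j - a j)) (z _ (_ : 0 < b j - coord x j)).
    by rewrite !subr_gt0 mulr1; apply.
  rewrite /bbump; under eq_fun do rewrite !big_ord_recl big_ord0.
  have -> : true%:R = 1 * (1 * (1 * 1)) :> R by rewrite !mul1r.
  by apply: cvgM; [exact: zz|apply: cvgM; [exact: zz|apply: cvgM; [exact: zz|exact: cvg_cst]]].
rewrite notin_setE => H; under eq_fun do rewrite bbump_out//.
exact: cvg_cst.
Qed.

(** Testing with [bbump] and dominated convergence show that [h] has integral 0 over every open box.
    A Dynkin argument inside a bounded box extends this to all its measurable subsets, which forces
    [h] to vanish almost everywhere there. *)
Lemma fundamental_lemma h : loc_integrable h ->
  (forall phi, Ccinfty phi -> \int[leb3]_x (h x * phi x) = 0) ->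
  {ae leb3, forall x, h x = 0}.
Proof.
move=> lh h0; have mh := loc_integrable_measurable lh.
have bx a b : \int[leb3]_(x in obox a b) h x = 0.
  (* [bbump a b 0] is positive on the whole open box, so [M] bounds that box and hence the supports
     for every [n]. *)
  have [M out] := bsupp_bbump a b 0.
  have sub : obox a b `<=` box M.
    move=> x xab; rewrite /box/= leNgt; apply/negP => /out.
    rewrite /bbump => /eqP; rewrite gt_eqF//; apply: prodr_gt0 => j _.
    by have /andP[h1 h2] := xab j; rewrite mulr_gt0// bump_gt0// mul1r subr_gt0.
  have /loc_integrable_box/(_ M) iM := lh.
  have ih : leb3.-integrable setT ((EFin \o h) \_ (box M)).
    by apply/(integrable_mkcond _ (measurable_box M)).
  have mf n : measurable_fun setT (fun x => (h x * bbump a b n x)%:E).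
    apply/measurable_EFinP; apply: measurable_funM => //.
    by apply: continuous_measurableR3; apply: smooth_continuous; exact: smooth_bbump.
  have ml : measurable_fun setT (fun x => (h x * \1_(obox a b) x)%:E).
    apply/measurable_EFinP; apply: measurable_funM => //.
    by apply: measurable_indic; exact: measurable_obox.
  have fc x : setT x -> (h x * bbump a b n x)%:E @[n --> \oo] --> (h x * \1_(obox a b) x)%:E.
    move=> _; apply: cvg_EFin; first exact: nearW.
    by apply: cvgM; [exact: cvg_cst|exact: bbump_cvg].
  have bd x n : setT x -> (`|(h x * bbump a b n x)%:E| <= (abse \o ((EFin \o h) \_ (box M))) x)%E.
    move=> _; rewrite /= patchE; case: ifPn => [_|].
      have /andP[b0 b1] := bbump_le1 a b n x.
      by rewrite lee_fin normrM (ger0_norm b0) ler_piMr.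
    rewrite notin_setE => nx; rewrite bbump_out ?mulr0// => /sub; exact: nx.
  have [_ _] := @dominated_convergence _ _ _ leb3 setT measurableT _ _ _ mf ml
    (aeW _ fc) (integrable_abse ih) (aeW _ bd).
  have -> : [sequence (\int[leb3]_x (h x * bbump a b n x)%:E)%E]_n = (fun=> 0%E).
    apply/funext => n /=.
    have cb := smooth_continuous (smooth_bbump a b n).
    have iq := loc_integrableM lh cb (bsupp_bbump a b n).
    rewrite -(fineK (integrable_fin_num measurableT iq)).
    have := h0 (bbump a b n); rewrite /Rintegral => -> //.
    by apply/CcinftyP; split; [exact: smooth_bbump|exact: bsupp_bbump].
  move=> /(cvg_unique (@ereal_hausdorff R) (cvg_cst 0%E)) e.
  rewrite Rintegral_mkcond /Rintegral [X in fine X](_ : _ = 0%E)// e.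
  apply: eq_integral => x _; rewrite patchE indicE.
  by case: ifPn => _; rewrite ?mulr1 ?mulr0.
(* On a bounded box [h] is integrable, so that integrals over complements can be subtracted in the
   Dynkin argument. *)
have boxn (n : nat) : {ae leb3, forall x, obox (fun=> - n%:R) (fun=> n%:R) x -> h x = 0}.
  set B := obox _ _; have mB : measurable B := measurable_obox _ _.
  have iB : leb3.-integrable B (EFin \o h).
    have /loc_integrable_box/(_ n%:R) := lh; apply: integrableS => //; first exact: measurable_box.
    move=> x xB; apply/normR3P => j; rewrite ler_norml.
    by have /andP[/ltW-> /ltW->] := xB j.
  have iT : leb3.-integrable setT ((EFin \o h) \_ B) by apply/(integrable_mkcond _ mB).
  have iE E : measurable E -> leb3.-integrable E ((EFin \o h) \_ B).
    by move=> mE; apply: integrableS iT.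
  have bx' a b : (\int[leb3]_(x in obox a b) ((EFin \o h) \_ B) x = 0)%E.
    rewrite -integral_mkcondr.
    have [a' [b' ab]] := oboxes_setI (ex_intro _ a (ex_intro _ b erefl))
      (ex_intro _ (fun=> - n%:R) (ex_intro _ (fun=> n%:R) erefl)).
    have := bx a' b'; rewrite -ab /Rintegral => /eqP.
    rewrite fine_eq0; first by move/eqP.
    apply: integrable_fin_num; first by apply: measurableI => //; exact: measurable_obox.
    by apply: integrableS iB => //; apply: measurableI => //; exact: measurable_obox.
  have all0 E : measurable E -> (\int[leb3]_(x in E) ((EFin \o h) \_ B) x = 0)%E.
    rewrite measurable_oboxes; move: E.
    have T0 : (\int[leb3]_x ((EFin \o h) \_ B) x = 0)%E.
      rewrite -[RHS](bx' (fun=> - n%:R) (fun=> n%:R)) -/B.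
      by rewrite -!integral_mkcondr setTI setIid.
    apply: (dynkin_induction measurable_oboxes oboxes_setI) => //.
    - by move=> _ [a [b ->]]; exact: bx'.
    - move=> E mE E0.
      have : (\int[leb3]_(x in E `|` ~` E) ((EFin \o h) \_ B) x = 0)%E by rewrite setUv.
      rewrite integral_setU//; first by rewrite E0 add0e.
      + exact: measurableC.
      + by rewrite setUv; exact: measurable_int iT.
      + by apply/disj_setPS => x [].
    - move=> F mF tF F0; rewrite integral_bigcup//.
        by rewrite eseries0// => k _ _; exact: F0.
      by apply: iE; exact: bigcup_measurable.
  have iS E : E `<=` B -> measurable E ->
      (\int[leb3]_(x in E) (EFin \o h) x = \int[leb3]_(x in E) cst 0%E x)%E.
    move=> EB mE; rewrite integral0 -[RHS](all0 E mE) -integral_mkcondr.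
    by congr (integral _ _ _); apply/esym/setIidPl.
  have := integral_ae_eq mB iB (measurable_cst 0%E) iS.
  by apply: filterS => x xh /xh [].
have := ae_foralln boxn; apply: filterS => x hx; apply: (hx (Num.trunc `|x|).+1) => j.
by have := le_lt_trans (coord_norm x j) (truncnS_gt _); rewrite ltr_norml.
Qed.

End Fundamental.

Section AlmostEverywhere.
Context d (T : measurableType d) (R : realType) (mu : {measure set T -> \bar R}).
Implicit Types f g : T -> R.

Lemma L2_ae f g : measurable_fun setT f -> L2 mu g -> {ae mu, forall x, f x = g x} -> L2 mu f.
Proof.
move=> mf Lg fg; split=> //; case: (Lg) => mg g2.
rewrite (_ : (\int[mu]_x (f x ^+ 2)%:E = \int[mu]_x (g x ^+ 2)%:E)%E)//.
apply: ae_eq_integral => //.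
- by apply/measurable_EFinP; exact: measurable_funX.
- by apply/measurable_EFinP; exact: measurable_funX.
- by apply: filterS fg => x -> _.
Qed.

Lemma nrmL2_eq0 f : L2 mu f -> {ae mu, forall x, f x = 0} -> nrm (ipL2 mu) f = 0.
Proof.
move=> Lf f0; apply: (si_eq0 Lf).
suff : (ipL2 mu f f)%:E = 0%:E :> \bar R by case.
rewrite ipL2_sqr// -[RHS](integral0 mu setT); apply: ae_eq_integral => //.
- by apply/measurable_EFinP; apply: measurable_funX; exact: L2_measurable Lf.
- by apply: filterS f0 => x -> _; rewrite expr0n.
Qed.

Lemma nrmL2_ae0 f : L2 mu f -> nrm (ipL2 mu) f = 0 -> {ae mu, forall x, f x = 0}.
Proof.
move=> Lf f0; have mf := L2_measurable Lf.
have mf2 : measurable_fun setT (fun x => (f x ^+ 2)%:E).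
  by apply/measurable_EFinP; exact: measurable_funX.
have : (\int[mu]_x `|(f x ^+ 2)%:E| = 0)%E.
  under eq_integral do rewrite /= ger0_norm ?sqr_ge0//.
  by rewrite -nrmL2// f0 expr0n.
move/(ae_eq_integral_abs mu measurableT mf2); apply: filterS => x /(_ I) /= [] /eqP.
by rewrite sqrf_eq0 => /eqP.
Qed.

Lemma nrmL2_mono f g : measurable_fun setT f -> L2 mu g -> (forall x, `|f x| <= `|g x|) ->
  L2 mu f /\ nrm (ipL2 mu) f <= nrm (ipL2 mu) g.
Proof.
move=> mf Lg fg; apply: nrmL2_le => //; first exact: nrm_ge0.
rewrite nrmL2//; apply: ge0_le_integral => //.
- by move=> x _; rewrite lee_fin sqr_ge0.
- by apply/measurable_EFinP; exact: measurable_funX.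
- by apply/measurable_EFinP; apply: measurable_funX; exact: L2_measurable Lg.
- move=> x _; rewrite lee_fin -[leLHS]real_normK ?num_real// -[leRHS]real_normK ?num_real//.
  by rewrite ler_pXn2r ?nnegrE.
Qed.

End AlmostEverywhere.

Lemma nrm_sum_le (R : realType) (E : lmodType R) (H : set E) (ip : E -> E -> R)
  (S : semi_inner H ip) (I : eqType) (r : seq I) (u : I -> E) : (forall i, H (u i)) ->
  nrm ip (\sum_(i <- r) u i) <= \sum_(i <- r) nrm ip (u i).
Proof.
move=> Hu; elim: r => [|i r IH].
  by rewrite !big_nil (si_eq0 (si0 S))// (si0l S (si0 S)).
rewrite !big_cons; apply: le_trans (nrmD S (Hu i) (si_sum S _ Hu)) _.
by rewrite lerD2l.
Qed.

(** * Square-integrable matrix fields *)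

Section MatrixL2.
Context d (T : measurableType d) (R : realType) (mu : {measure set T -> \bar R}) {m n : nat}.
Implicit Types (F G K : T -> 'M[R]_(m, n)) (p : 'I_m * 'I_n).

(** A single index for all entries, over a free shape [m, n]: one row for vector fields, three rows
    for gradients. *)
Definition ent p G : T -> R := fun x => G x p.1 p.2.

Definition mL2 : set (T -> 'M[R]_(m, n)) := [set G | forall p, L2 mu (ent p G)].

Definition mip G K : R := \sum_p ipL2 mu (ent p G) (ent p K).

Lemma entD p F G : ent p (F + G) = ent p F + ent p G.
Proof. by apply/funext => x; rewrite /ent /= mxE. Qed.

Lemma entZ p (a : R) F : ent p (a *: F) = a *: ent p F.
Proof. by apply/funext => x; rewrite /ent /= mxE. Qed.

Lemma entB p F G : ent p (F - G) = ent p F - ent p G.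
Proof. by apply/funext => x; rewrite /ent /= !mxE. Qed.

Lemma ent0 p : ent p 0 = 0.
Proof. by apply/funext => x; rewrite /ent /= mxE. Qed.

Lemma semi_inner_mL2 : semi_inner mL2 mip.
Proof.
have S := semi_inner_L2 mu; split.
- by move=> p; rewrite ent0; exact: si0 S.
- by move=> F G LF LG p; rewrite entD; exact: siD S _ _ (LF p) (LG p).
- by move=> a F LF p; rewrite entZ; exact: siZ S _ _ (LF p).
- by move=> F G LF LG; apply: eq_bigr => p _; exact: siC S _ _ (LF p) (LG p).
- move=> F G K LF LG LK; rewrite /mip -big_split; apply: eq_bigr => p _ /=.
  by rewrite entD (siDl S (LF p) (LG p) (LK p)).
- move=> a F G LF LG; rewrite /mip mulr_sumr; apply: eq_bigr => p _.
  by rewrite entZ (siZl S _ (LF p) (LG p)).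
- by move=> F LF; apply: sumr_ge0 => p _; exact: si_ge0 S _ (LF p).
Qed.

Lemma nrm_mip G : mL2 G -> nrm mip G ^+ 2 = \sum_p nrm (ipL2 mu) (ent p G) ^+ 2.
Proof.
move=> LG; rewrite (nrm_sqr semi_inner_mL2)//; apply: eq_bigr => p _.
by rewrite (nrm_sqr (semi_inner_L2 mu)).
Qed.

Lemma nrm_ent_le p G : mL2 G -> nrm (ipL2 mu) (ent p G) <= nrm mip G.
Proof.
move=> LG; rewrite -(@ler_pXn2r _ 2%N) ?nnegrE ?nrm_ge0// nrm_mip// (bigD1 p)//= lerDl.
by apply: sumr_ge0 => q _; exact: sqr_ge0.
Qed.

Lemma nrm_mip_le_sum G : mL2 G -> nrm mip G <= \sum_p nrm (ipL2 mu) (ent p G).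
Proof.
move=> LG; have s0 : 0 <= \sum_p nrm (ipL2 mu) (ent p G) by apply: sumr_ge0 => p _; exact: nrm_ge0.
rewrite -(@ler_pXn2r _ 2%N) ?nnegrE ?nrm_ge0// nrm_mip// expr2 mulr_suml.
apply: ler_sum => p _; rewrite expr2 ler_wpM2l ?nrm_ge0// (bigD1 p)//= lerDl.
by apply: sumr_ge0 => q _; exact: nrm_ge0.
Qed.

Lemma scomplete_mL2 : scomplete mL2 mip.
Proof.
move=> u Lu cu; have SM := semi_inner_mL2.
have /choice[l lP] p : exists l, L2 mu l /\ clim (ipL2 mu) (fun k => ent p (u k)) l.
  have [|l Ll ul] := scomplete_L2 (mu := mu) (fun k => Lu k p); last by exists l.
  move=> e e0; have [N NP] := cu e e0; exists N => i j Ni Nj.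
  rewrite -entB; apply: le_lt_trans (NP i j Ni Nj).
  by apply: nrm_ent_le; exact: siB SM _ _ (Lu i) (Lu j).
pose L x : 'M[R]_(m, n) := \matrix_(i, j) l (i, j) x.
have entL p : ent p L = l p by apply/funext => x; rewrite /ent /L mxE; case: p.
have LL : mL2 L by move=> p; rewrite entL; exact: (lP p).1.
exists L => // e e0.
pose D := (#|{: 'I_m * 'I_n}|).+1%:R : R.
have D0 : 0 < e / D by rewrite divr_gt0.
have /choice[N NP] p := (lP p).2 _ D0.
exists (\max_p N p)%N => k Nk; apply: le_lt_trans (nrm_mip_le_sum _) _; first exact: siB SM _ _ (Lu k) LL.
apply: (@le_lt_trans _ _ (\sum_(p : 'I_m * 'I_n) e / D)).
  apply: ler_sum => p _; rewrite entB entL ltW//; apply: NP.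
  by apply: leq_trans Nk; exact: leq_bigmax.
rewrite sumr_const -mulr_natr mulrAC -mulrA gtr_pMr// ltr_pdivrMr// mul1r ltr_nat.
exact: ltnSn.
Qed.

Lemma mL2_ae F G : (forall p, measurable_fun setT (ent p F)) -> mL2 G ->
  {ae mu, forall x, F x = G x} -> mL2 F /\ nrm mip (F - G) = 0.
Proof.
move=> mF LG FG.
have LF : mL2 F.
  by move=> p; apply: L2_ae (mF p) (LG p) _; apply: filterS FG => x; rewrite /ent => ->.
split=> //; have LFG := siB semi_inner_mL2 LF LG.
apply/eqP; rewrite -sqrf_eq0 nrm_mip// big1// => p _.
rewrite nrmL2_eq0 ?expr0n//; apply: filterS FG => x FGx.
by rewrite entB /ent /= fctE FGx subrr.
Qed.

(** By [fB] and [fC] the constraint is a bounded map into L^2, so it passes to limits. It serves for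
    the trace, for the symmetrized gradient on a set, and for the vanishing of a gradient on a
    set. *)
Lemma ae_constraint_closed (f : T -> 'M[R]_(m, n) -> R) (C : R) G :
  (forall F, mL2 F -> measurable_fun setT (fun x => f x (F x))) ->
  (forall x A B, f x (A - B) = f x A - f x B) ->
  (forall x A, `|f x A| <= C * \sum_(p : 'I_m * 'I_n) `|A p.1 p.2|) -> mL2 G ->
  (forall e : R, 0 < e -> exists F, [/\ mL2 F, nrm (ipL2 mu) (fun x => f x (F x)) < e & nrm mip (G - F) < e]) ->
  {ae mu, forall x, f x (G x) = 0}.
Proof.
move=> mf fB fC LG H; have S := semi_inner_L2 mu.
pose D := #|{: 'I_m * 'I_n}|%:R : R.
have C0 : 0 <= `|C| := normr_ge0 C.
have key F : mL2 F -> L2 mu (fun x => f x (F x)) /\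
    nrm (ipL2 mu) (fun x => f x (F x)) <= `|C| * (D * nrm mip F).
  move=> LF; pose a p : T -> R := fun x => `|ent p F x|.
  have La p : L2 mu (a p) by have [] := nrmL2_abs (LF p).
  have Lg : L2 mu (`|C| *: \sum_p a p) by apply: (siZ S); apply: (si_sum S).
  have [|Lf fg] := nrmL2_mono (mf F LF) Lg.
    move=> x; apply: le_trans (fC x (F x)) _.
    have aS : 0 <= \sum_p a p x by apply: sumr_ge0 => p _; exact: normr_ge0.
    rewrite /GRing.scale/= fct_sumE normrM normr_id [X in _ <= _ * X]ger0_norm//.
    by rewrite ler_wpM2r// ler_norm.
  split=> //; apply: le_trans fg _.
  rewrite (nrmZ S); last by apply: (si_sum S).
  rewrite normr_id ler_wpM2l//; apply: (@le_trans _ _ (\sum_p nrm (ipL2 mu) (a p))).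
    by apply: (nrm_sum_le S).
  rewrite mulr_natl -sumr_const; apply: ler_sum => p _.
  by have [_ ->] := nrmL2_abs (LF p); exact: nrm_ent_le.
have [LfG _] := key G LG; apply: nrmL2_ae0 => //.
apply/eqP; rewrite eq_le nrm_ge0 andbT; apply/ler_addgt0Pr => e e0; rewrite add0r.
(* Chosen so that the bounds for [G - F] and for [F], both obtained with tolerance [e / M], add up
   to [e]. *)
pose M := `|C| * D + 1.
have M0 : 0 < M by rewrite ltr_pwDr// mulr_ge0// ler0n.
have [F [LF fF GF]] := H _ (divr_gt0 e0 M0).
have [LfF _] := key F LF; have [LfD fD] := key _ (siB semi_inner_mL2 LG LF).
have E : (fun x => f x (G x)) = (fun x => f x ((G - F) x)) + (fun x => f x (F x)).
  by apply/funext => x; rewrite fctE fB subrK.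
rewrite E; apply: le_trans (nrmD S LfD LfF) _.
apply: (@le_trans _ _ (`|C| * (D * (e / M)) + e / M)).
  apply: lerD; last exact: ltW.
  apply: le_trans fD _; rewrite ler_wpM2l// ler_wpM2l ?ler0n//; exact: ltW.
by rewrite mulrA -[X in _ + X]mul1r -mulrDl -/M mulrC divfK// gt_eqF.
Qed.

End MatrixL2.

Section LocIntegrable.
Context {R : realType}.
Implicit Types (f g h : R3 R -> R) (r M K e : R).

Lemma ecvg0P (u : nat -> \bar R) : (forall n, 0 <= u n)%E ->
  (u n @[n --> \oo] --> 0%E) <->
  (forall e : R, 0 < e -> exists N, forall n, (N <= n)%N -> (u n < e%:E)%E).
Proof.
move=> u0; split=> [cu e e0|H].
  have : \forall n \near \oo, (u n < e%:E)%E.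
    by apply: (cu [set x | (x < e%:E)%E]); exact: (@open_ereal_lt' _ 0%E e%:E).
  by move=> [N _ NP]; exists N => n; exact: NP.
apply/fine_cvgP; split.
  have [N NP] := H 1 ltr01; exists N => // n /= Nn.
  by rewrite ge0_fin_numE//; exact: lt_trans (NP n Nn) (ltry _).
apply/cvgrPdist_lt => e e0; have [N NP] := H e e0; exists N => // n /= Nn.
have ufin : u n \is a fin_num by rewrite ge0_fin_numE//; exact: lt_trans (NP n Nn) (ltry _).
by rewrite sub0r normrN ger0_norm ?fine_ge0// -lte_fin fineK// NP.
Qed.

Lemma loc_integrableD f g : loc_integrable f -> loc_integrable g -> loc_integrable (fun x => f x + g x).
Proof. by move=> lf lg r; exact: (integrableD (measurable_eball 0 r) (lf r) (lg r)). Qed.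

Lemma loc_integrableZ (a : R) f : loc_integrable f -> loc_integrable (fun x => a * f x).
Proof. by move=> lf r; exact: (integrableZl (measurable_eball 0 r) a (lf r)). Qed.

Lemma loc_integrableB f g : loc_integrable f -> loc_integrable g -> loc_integrable (fun x => f x - g x).
Proof. by move=> lf lg r; exact: (integrableB (measurable_eball 0 r) (lf r) (lg r)). Qed.

Lemma leb3_eball_fin (x : R3 R) r : (leb3 (eball x r) < +oo)%E.
Proof.
have [r0|r0] := leP r 0; first by rewrite eball_le0// measure0.
have sub : eball x r `<=` box (`|x| + r).
  move=> y /(eballP x y r0) /nsq_norm /(_ r0) yx; rewrite /box/= -(subrK x y).
  by apply: le_trans (ler_normD _ _) _; rewrite addrC lerD2l.
apply: le_lt_trans (leb3_box (`|x| + r)); apply: le_measure => //; rewrite inE.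
  exact: measurable_eball.
exact: measurable_box.
Qed.

Lemma L2_indic (A : set (R3 R)) : measurable A -> (leb3 A < +oo)%E -> L2 leb3 (\1_A : R3 R -> R).
Proof.
move=> mA fA; split; first exact: measurable_indic.
have -> : (fun x => ((\1_A x : R) ^+ 2)%:E) = (fun x => (\1_A x : R)%:E).
  by apply/funext => x; rewrite indicE; case: (_ \in _); rewrite ?expr1n ?expr0n.
by rewrite integral_indic// setIT.
Qed.

(** Cauchy-Schwarz against [a] times the indicator of the ball. With [a = 1] it puts L^2 inside
    L^1_loc; with [a = 1 + nsq] it removes the Hardy weight in [hdot1_lim]. *)
Lemma L1_ball_le (a : R3 R -> R) r : continuous a -> exists2 K : R, 0 <= K &
  forall f, L2 leb3 f -> (\int[leb3]_(y in eball 0%R r) `|a y * f y|%:E <= (K * nrm (ipL2 leb3) f)%:E)%E.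
Proof.
move=> ca; have S := semi_inner_L2 (@leb3 R).
have [K K0 aK] := continuous_bounded r ca.
have mb : measurable (eball (0 : R3 R) r) := measurable_eball 0 r.
pose b (x : R3 R) := `|a x| * \1_(eball 0 r) x : R.
have mb' : measurable_fun setT b.
  apply: measurable_funM; last exact: measurable_indic.
  by apply: measurableT_comp => //; exact: continuous_measurableR3.
have Lb : L2 leb3 b.
  have LK := siZ S K (L2_indic mb (leb3_eball_fin 0 r)).
  apply: L2_le mb' LK _ => x; rewrite /b /GRing.scale/= indicE.
  case: (boolP (x \in _)) => [/set_mem/eball_box xr|_]; rewrite ?mulr1 ?mulr0; last by rewrite normr0.
  by rewrite normr_id -[X in _ <= `|X|]/(K * 1) mulr1 (ger0_norm K0) aK.
exists (nrm (ipL2 leb3) b); first exact: nrm_ge0.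
move=> f Lf; have [Lf' fE] := nrmL2_abs Lf.
have -> : (\int[leb3]_(y in eball 0%R r) `|a y * f y|%:E = \int[leb3]_y (b y * `|f y|)%:E)%E.
  rewrite integral_mkcond; apply: eq_integral => x _; rewrite patchE /b indicE.
  by case: (x \in _); rewrite ?mulr1 ?mulr0 ?mul0r// normrM.
have ib := L2M_integrable Lb Lf'.
rewrite -(fineK (integrable_fin_num measurableT ib)) lee_fin -fE.
by apply: le_trans (si_cauchy_schwarz S Lb Lf'); exact: ler_norm.
Qed.

Lemma L2_loc_integrable f : L2 leb3 f -> loc_integrable f.
Proof.
move=> Lf r; have mf := L2_measurable Lf.
have [K K0 KP] := L1_ball_le r (fun x => @cst_continuous (R3 R) R 1 x).
apply/integrableP; split.
  by apply/measurable_EFinP; apply: measurable_funTS.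
apply: le_lt_trans (ltry (K * nrm (ipL2 leb3) f)).
apply: le_trans (KP f Lf); rewrite le_eqVlt; apply/orP; left; apply/eqP.
by apply: eq_integral => x _; rewrite mul1r.
Qed.

Lemma loc_integrableMc f g : loc_integrable f -> continuous g -> loc_integrable (fun x => f x * g x).
Proof.
move=> lf cg; apply/loc_integrable_box => M; have [K K0 gK] := continuous_bounded M cg.
have /loc_integrable_box/(_ M) iM := lf.
have mf := loc_integrable_measurable lf; have mg := continuous_measurableR3 cg.
apply: (le_integrable (measurable_box M) _ _ (integrableZl (measurable_box M) K iM)).
  by apply/measurable_EFinP; apply: measurable_funTS; exact: measurable_funM.
move=> x xM /=; rewrite lee_fin !normrM mulrC ler_wpM2r// (ger0_norm K0); exact: gK.
Qed.

(** Pairing with a fixed [g] is continuous for L^1 convergence on a ball containing its support;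
    this lets the identity defining weak gradients pass to the limit. *)
Lemma pairing_le f g : loc_integrable f -> continuous g -> bsupp g ->
  exists r K : R, 0 <= K /\ forall h, loc_integrable h ->
   (`| \int[leb3]_x ((h x - f x) * g x) |%:E <= K%:E * \int[leb3]_(y in eball 0%R r) `|h y - f y|%:E)%E.
Proof.
move=> lf cg [M' g0']; pose M := `|M'|.
have g0 x : M < `|x| -> g x = 0 by move=> Mx; apply: g0'; apply: le_lt_trans Mx; exact: ler_norm.
have bg : bsupp g by exists M.
have [K K0 gK] := continuous_bounded M cg.
have M0 : 0 <= M by exact: normr_ge0.
(* By [box_eball] the Euclidean ball of this radius contains the box of size [M]. *)
exists (2 * M + 1), K; split=> // h lh; have lhf := loc_integrableB lh lf.
have i1 := loc_integrableM lhf cg bg.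
rewrite /Rintegral.
apply: (@le_trans _ _ (\int[leb3]_x `|((h x - f x) * g x)%:E|)%E).
  have := le_abse_integral leb3 measurableT (measurable_int _ i1).
  by rewrite -[X in (`|X| <= _)%E]fineK// (integrable_fin_num measurableT i1).
have mE : measurable_fun (eball 0 (2 * M + 1)) (fun y => (`|h y - f y|)%:E).
  apply/measurable_EFinP; apply: measurable_funTS; apply: measurableT_comp => //.
  exact: loc_integrable_measurable lhf.
rewrite -ge0_integralZl_EFin//; last exact: measurable_eball.
rewrite [leRHS]integral_mkcond; apply: ge0_le_integral => //.
- by apply: measurableT_comp => //; exact: measurable_int i1.
- apply/(measurable_restrictT _ (measurable_eball _ _)).
  by apply: measurable_funeM.
- move=> x _; rewrite patchE; case: ifPn => [/set_mem xb|].
    rewrite -EFinM lee_fin normrM mulrC.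
    have [/gK gx|/g0 ->] := leP `|x| M; first by rewrite ler_wpM2r.
    by rewrite normr0 mul0r mulr_ge0.
  rewrite notin_setE => xb; have Mx : M < `|x| by rewrite ltNge; apply/negP => /(box_eball M0).
  by rewrite g0// mulr0 abse0.
Qed.

End LocIntegrable.

(** * Weak gradients and approximation by test fields *)

Section Hdot1.
Context {R : realType}.
Implicit Types (f g : R3 R -> R) (w v : vfield R) (G K : mfield R) (phi : nat -> vfield R).

Local Notation mip3 := (@mip _ (R3 R) R leb3 3 3).

Definition tends phi w := forall (r : R) i, (\int[leb3]_(y in eball 0%R r)
  `|comp (phi n) i y - comp w i y|%:E)%E @[n --> \oo] --> 0%E.

Lemma tendsP phi w : tends phi w <-> forall (r : R) i (e : R), 0 < e -> exists N, forall n,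
  (N <= n)%N -> (\int[leb3]_(y in eball 0%R r) `|comp (phi n) i y - comp w i y|%:E < e%:E)%E.
Proof.
have i0 (r : R) i n : (0 <= \int[leb3]_(y in eball 0%R r) `|comp (phi n) i y - comp w i y|%:E)%E.
  by apply: integral_ge0 => y _; rewrite lee_fin.
split=> H r i; last by apply/ecvg0P; [exact: i0|exact: H].
by have /ecvg0P := H r i; apply; exact: i0.
Qed.

Lemma mdot_sum (A B : 'M[R]_3) : mdot A B = \sum_(p : 'I_3 * 'I_3) A p.1 p.2 * B p.1 p.2.
Proof. by rewrite /mdot pair_big. Qed.

Lemma mip_mdot G K : mL2 leb3 G -> mL2 leb3 K -> mip3 G K = \int[leb3]_x mdot (G x) (K x).
Proof.
move=> LG LK; pose F i j x := G x i j * K x i j.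
have iF i j : leb3.-integrable setT (EFin \o F i j) by exact: L2M_integrable (LG (i, j)) (LK (i, j)).
rewrite /mdot (Rintegral_sum3 (F := fun i x => \sum_j F i j x)); last first.
  by move=> i; exact: integrable_sum3.
rewrite /mip -(pair_big xpredT xpredT (fun i j => ipL2 leb3 (ent (i, j) G) (ent (i, j) K)))/=.
by apply: eq_bigr => i _; rewrite (Rintegral_sum3 (iF i)).
Qed.

Lemma nrm_mip_mdot G : mL2 leb3 G ->
  ((nrm mip3 G ^+ 2)%:E = \int[leb3]_x (mdot (G x) (G x))%:E)%E.
Proof.
move=> LG; rewrite (nrm_sqr (semi_inner_mL2 leb3) LG) mip_mdot// /Rintegral fineK//.
apply: integrable_fin_num => //.
apply: (integrable_sum3 (F := fun i x => \sum_j G x i j * G x i j)) => i.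
apply: (integrable_sum3 (F := fun j x => G x i j * G x i j)) => j.
exact: L2M_integrable (LG (i, j)) (LG (i, j)).
Qed.

Lemma Ccinfty_L2 f : Ccinfty f -> L2 leb3 f.
Proof. by move=> /CcinftyP[/smooth_continuous cf bf]; exact: continuous_L2. Qed.

Lemma jacobian_mL2 w : vCcinfty w -> mL2 leb3 (jacobian w).
Proof.
move=> Cw [i j]; rewrite /ent; under eq_fun do rewrite /= mxE.
by apply: Ccinfty_L2; exact: Ccinfty_partial.
Qed.

(** By [fundamental_lemma] on each entry. Hence the representative picked by [wgrad] matters only up
    to a null set. *)
Lemma wgrad_unique w G K : is_wgrad w G -> is_wgrad w K -> {ae leb3, forall x, G x = K x}.
Proof.
move=> [lG wG] [lK wK].
have : {ae leb3, forall x (p : 'I_3 * 'I_3), G x p.1 p.2 - K x p.1 p.2 = 0}.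
  apply: filter_forall => -[i j] /=; apply: fundamental_lemma.
    exact: loc_integrableB.
  move=> psi Cpsi; have /CcinftyP[/smooth_continuous cpsi bpsi] := Cpsi.
  have iG := loc_integrableM (lG i j) cpsi bpsi.
  have iK := loc_integrableM (lK i j) cpsi bpsi.
  under eq_Rintegral do rewrite mulrBl.
  rewrite (RintegralB measurableT iG iK).
  by have := wG _ Cpsi i j; rewrite (wK _ Cpsi i j) => /oppr_inj ->; rewrite subrr.
apply: filterS => x H; apply/matrixP => i j; apply/eqP; rewrite -subr_eq0.
by apply/eqP; exact: (H (i, j)).
Qed.

(** Both sides of the integration by parts for [phi n] converge, the left one by [pairing_le] and
    the right one by Cauchy-Schwarz. *)
Lemma is_wgrad_lim phi w G : (forall i, loc_integrable (comp w i)) -> (forall n, vCcinfty (phi n)) ->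
  tends phi w -> mL2 leb3 G -> clim mip3 (fun n => jacobian (phi n)) G -> is_wgrad w G.
Proof.
move=> lw Cphi /tendsP pw LG cG.
have SM := semi_inner_mL2 (m := 3) (n := 3) (@leb3 R); have S := semi_inner_L2 (@leb3 R).
have lG i j : loc_integrable (fun x => G x i j) by exact: L2_loc_integrable (LG (i, j)).
split=> // psi Cpsi i j; have Lpsi := Ccinfty_L2 Cpsi.
have /CcinftyP[/smooth_continuous cd bd] := Ccinfty_partial j Cpsi.
have /CcinftyP[/smooth_continuous cpsi bpsi] := Cpsi.
have [r [K [K0 HK]]] := pairing_le (lw i) cd bd.
apply/eqP; rewrite -subr_eq0 opprK -normr_le0; apply/ler_addgt0Pr => e e0; rewrite add0r.
have e1 : 0 < e / 2 / (K + 1) by rewrite !divr_gt0// ltr_pwDr.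
have [N1 NP1] := pw r i _ e1.
have n0 : 0 < nrm (ipL2 leb3) psi + 1 by rewrite ltr_pwDr// nrm_ge0.
have e2 : 0 < e / 2 / (nrm (ipL2 leb3) psi + 1) by rewrite !divr_gt0.
have [N2 NP2] := cG _ e2.
pose n := maxn N1 N2.
have lphi : loc_integrable (comp (phi n) i).
  by apply: continuous_loc_integrable; apply: smooth_continuous; exact: Ccinfty_smooth (Cphi n i).
have D1 : `|\int[leb3]_x ((comp (phi n) i x - comp w i x) * partial j psi x)| <= e / 2.
  rewrite -lee_fin; apply: le_trans (HK _ lphi) _.
  apply: (@le_trans _ _ (K%:E * (e / 2 / (K + 1))%:E)%E).
    by rewrite lee_wpmul2l// ltW// NP1// leq_maxl.
  rewrite -EFinM lee_fin mulrCA ler_piMr// ?divr_ge0 ?(ltW e0)//.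
  by rewrite ler_pdivrMr ?ltr_pwDr// mul1r lerDl.
have LJ := jacobian_mL2 (Cphi n).
have LJG := siB SM LJ LG.
have D2 : `|\int[leb3]_x ((jacobian (phi n) x i j - G x i j) * psi x)| <= e / 2.
  have -> : \int[leb3]_x ((jacobian (phi n) x i j - G x i j) * psi x) =
      ipL2 leb3 (ent (i, j) (jacobian (phi n) - G)) psi.
    by apply: eq_Rintegral => x _; rewrite /ent !mxE.
  apply: le_trans (si_cauchy_schwarz S (LJG (i, j)) Lpsi) _.
  apply: (@le_trans _ _ (e / 2 / (nrm (ipL2 leb3) psi + 1) * nrm (ipL2 leb3) psi)).
    rewrite ler_wpM2r ?nrm_ge0//; apply: le_trans (nrm_ent_le _ LJG) _.
    by apply/ltW/NP2; rewrite leq_maxr.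
  rewrite mulrAC -mulrA ler_piMr// ?divr_ge0 ?(ltW e0)//.
  by rewrite ler_pdivrMr// mul1r lerDl.
have [lJ wJ] := is_wgrad_jacobian (Cphi n).
have iw := loc_integrableM (lw i) cd bd; have ip := loc_integrableM lphi cd bd.
have iG := loc_integrableM (lG i j) cpsi bpsi; have iJ := loc_integrableM (lJ i j) cpsi bpsi.
have E1 : \int[leb3]_x ((comp (phi n) i x - comp w i x) * partial j psi x) =
    \int[leb3]_x (comp (phi n) i x * partial j psi x) - \int[leb3]_x (comp w i x * partial j psi x).
  by under eq_Rintegral do rewrite mulrBl; exact: (RintegralB measurableT ip iw).
have E2 : \int[leb3]_x ((jacobian (phi n) x i j - G x i j) * psi x) =
    \int[leb3]_x (jacobian (phi n) x i j * psi x) - \int[leb3]_x (G x i j * psi x).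
  by under eq_Rintegral do rewrite mulrBl; exact: (RintegralB measurableT iJ iG).
move: D1 D2; rewrite E1 E2 (wJ _ Cpsi i j).
move: (\int[leb3]_x _) (\int[leb3]_x _) (\int[leb3]_x _) => a b c.
move=> h1 h2; rewrite [X in `|X|](_ : _ = - ((- c - b) + (c - a))); last by ring.
by rewrite normrN [e]splitr; exact: le_trans (ler_normD _ _) (lerD h1 h2).
Qed.

(** [wgrad w] is a chosen representative, so it is identified with the limit [G] only almost
    everywhere and at distance 0. *)
Lemma hdot1_intro phi w G : (forall i, loc_integrable (comp w i)) -> (forall n, vCcinfty (phi n)) ->
  tends phi w -> mL2 leb3 G -> clim mip3 (fun n => jacobian (phi n)) G ->
  [/\ hdot1 w, mL2 leb3 (wgrad w), {ae leb3, forall x, wgrad w x = G x} & nrm mip3 (wgrad w - G) = 0].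
Proof.
move=> lw Cphi pw LG cG; have SM := semi_inner_mL2 (m := 3) (n := 3) (@leb3 R).
have wG := is_wgrad_lim lw Cphi pw LG cG.
have ww : is_wgrad w (wgrad w) by exact: (xgetPex 0 (ex_intro _ G wG)).
have aeG := wgrad_unique ww wG.
have mw p : measurable_fun setT (ent p (wgrad w)).
  by apply: loc_integrable_measurable; exact: ww.1.
have [Lw dist0] := mL2_ae mw LG aeG.
split=> //; split=> //; first by exists G.
  by move=> i j; apply/Lfun_L2; exact: (Lw (i, j)).
exists phi; split=> //.
have dJ n : mL2 leb3 (jacobian (phi n) - wgrad w) by apply: (siB SM) => //; exact: jacobian_mL2.
apply/ecvg0P => [n|e e0].
  apply: integral_ge0 => x _; rewrite lee_fin mdot_sum; apply: sumr_ge0 => p _.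
  by rewrite -expr2 sqr_ge0.
have se0 : 0 < Num.sqrt e by rewrite sqrtr_gt0.
have [N NP] := cG _ se0; exists N => n Nn.
rewrite -(nrm_mip_mdot (dJ n)) lte_fin -[ltRHS]sqr_sqrtr ?(ltW e0)//.
rewrite ltr_pXn2r ?nnegrE ?nrm_ge0 ?sqrtr_ge0//.
apply: le_lt_trans (NP n Nn).
have LJ := jacobian_mL2 (Cphi n).
apply: le_trans (nrm_triang SM LJ LG Lw) _.
by rewrite (nrmBC SM LG Lw) dist0 addr0.
Qed.

Lemma hdot1_elim w : hdot1 w -> [/\ forall i, loc_integrable (comp w i), is_wgrad w (wgrad w),
  mL2 leb3 (wgrad w) & exists phi, [/\ forall n, vCcinfty (phi n), tends phi w
    & clim mip3 (fun n => jacobian (phi n)) (wgrad w)]].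
Proof.
have SM := semi_inner_mL2 (m := 3) (n := 3) (@leb3 R).
move=> [lw [G wG] Lw [phi [Cphi pw gw]]].
have LM : mL2 leb3 (wgrad w) by move=> [i j]; apply/Lfun_L2; exact: Lw.
split=> //; first exact: (xgetPex 0 (ex_intro _ G wG)).
exists phi; split=> // e e0.
have e2 : 0 < e ^+ 2 by rewrite exprn_gt0.
have /ecvg0P gw' := gw; have [|N NP] := gw' _ _ e2.
  move=> n; apply: integral_ge0 => x _; rewrite lee_fin mdot_sum; apply: sumr_ge0 => p _.
  by rewrite -expr2 sqr_ge0.
exists N => n /NP; have LJ := jacobian_mL2 (Cphi n).
rewrite -(nrm_mip_mdot (siB SM LJ LM)) lte_fin.
by rewrite ltr_pXn2r ?nnegrE ?nrm_ge0 ?(ltW e0).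
Qed.

Lemma hinner_mip v w : hdot1 v -> hdot1 w -> hinner v w = mip3 (wgrad v) (wgrad w).
Proof. by move=> /hdot1_elim[_ _ Lv _] /hdot1_elim[_ _ Lw _]; rewrite mip_mdot. Qed.

Lemma hdot1_lin (a : R) v w : hdot1 v -> hdot1 w -> [/\ hdot1 (a *: v + w),
  {ae leb3, forall x, wgrad (a *: v + w) x = a *: wgrad v x + wgrad w x}
  & nrm mip3 (wgrad (a *: v + w) - (a *: wgrad v + wgrad w)) = 0].
Proof.
have SM := semi_inner_mL2 (m := 3) (n := 3) (@leb3 R).
move=> /hdot1_elim[lv wv Lv [phi [Cphi pv cv]]] /hdot1_elim[lw ww Lw [psi [Cpsi pw cw]]].
have cE u1 u2 i : comp (a *: u1 + u2) i = (fun x => a * comp u1 i x + comp u2 i x).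
  by apply/funext => x; rewrite /comp !mxE.
have a0 : 0 < `|a| + 1 by rewrite ltr_pwDr.
suff [] : [/\ hdot1 (a *: v + w), mL2 leb3 (wgrad (a *: v + w)),
    {ae leb3, forall x, wgrad (a *: v + w) x = (a *: wgrad v + wgrad w) x}
  & nrm mip3 (wgrad (a *: v + w) - (a *: wgrad v + wgrad w)) = 0] by move=> h1 _ h2 h3; split.
apply: (@hdot1_intro (fun n => a *: phi n + psi n)).
- by move=> i; rewrite cE; apply: loc_integrableD => //; exact: loc_integrableZ.
- move=> n i; rewrite cE; apply/CcinftyP.
  have /CcinftyP[s1 b1] := Cphi n i; have /CcinftyP[s2 b2] := Cpsi n i; split.
    exact: (smoothD (smoothZ a s1) s2).
  by apply: bsuppD => //; exact: bsuppMr.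
- apply/tendsP => r i e e0; have e1 : 0 < e / 2 / (`|a| + 1) by rewrite !divr_gt0.
  have e2 : 0 < e / 2 by rewrite divr_gt0.
  have [N1 NP1] := (tendsP _ _).1 pv r i _ e1; have [N2 NP2] := (tendsP _ _).1 pw r i _ e2.
  exists (maxn N1 N2) => n; rewrite geq_max => /andP[/NP1 h1 /NP2 h2].
  have l1 : loc_integrable (fun y => comp (phi n) i y - comp v i y).
    apply: loc_integrableB => //; apply: continuous_loc_integrable; apply: smooth_continuous.
    exact: Ccinfty_smooth (Cphi n i).
  have l2 : loc_integrable (fun y => comp (psi n) i y - comp w i y).
    apply: loc_integrableB => //; apply: continuous_loc_integrable; apply: smooth_continuous.
    exact: Ccinfty_smooth (Cpsi n i).
  have m1 : measurable_fun (eball 0 r) (fun y => (`|comp (phi n) i y - comp v i y|)%:E).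
    apply/measurable_EFinP; apply: measurable_funTS; apply: measurableT_comp => //.
    exact: loc_integrable_measurable l1.
  have m2 : measurable_fun (eball 0 r) (fun y => (`|comp (psi n) i y - comp w i y|)%:E).
    apply/measurable_EFinP; apply: measurable_funTS; apply: measurableT_comp => //.
    exact: loc_integrable_measurable l2.
  have mb : measurable (eball (0 : R3 R) r) := measurable_eball 0 r.
  apply: (@le_lt_trans _ _ (\int[leb3]_(y in eball 0%R r) (`|a|%:E * `|comp (phi n) i y - comp v i y|%:E
      + `|comp (psi n) i y - comp w i y|%:E))%E).
    apply: ge0_le_integral => //.
    - apply/measurable_EFinP; apply: measurable_funTS; apply: measurableT_comp => //.
      have -> : (fun y => comp (a *: phi n + psi n) i y - comp (a *: v + w) i y) =
          (fun y => a * (comp (phi n) i y - comp v i y) + (comp (psi n) i y - comp w i y)).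
        by apply/funext => y; rewrite !cE; ring.
      exact: loc_integrable_measurable (loc_integrableD (loc_integrableZ a l1) l2).
    - by apply: emeasurable_funD => //; exact: measurable_funeM.
    - move=> y _; rewrite -EFinM -EFinD lee_fin !cE -normrM.
      rewrite [X in `|X|](_ : _ = a * (comp (phi n) i y - comp v i y) + (comp (psi n) i y - comp w i y)); last by ring.
      exact: ler_normD.
  rewrite ge0_integralD//; last exact: measurable_funeM.
  rewrite ge0_integralZl_EFin//.
  have /lee_wpmul2l h1' : (0 <= `|a|%:E)%E by rewrite lee_fin.
  apply: (@le_lt_trans _ _ (`|a|%:E * (e / 2 / (`|a| + 1))%:E + (e / 2)%:E)%E).
    by apply: leeD; [apply: h1'; exact: ltW|exact: ltW].
  rewrite -EFinM -EFinD lte_fin [ltRHS](_ : _ = `|a| * (e / 2 / (`|a| + 1)) + e / 2 + e / 2 / (`|a| + 1)).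
    by rewrite ltrDl.
  by field; rewrite gt_eqF.
- by apply: (siD SM) => //; exact: (siZ SM).
- move=> e e0; have e1 : 0 < e / 2 / (`|a| + 1) by rewrite !divr_gt0.
  have e2 : 0 < e / 2 by rewrite divr_gt0.
  have [N1 NP1] := cv _ e1; have [N2 NP2] := cw _ e2.
  exists (maxn N1 N2) => n; rewrite geq_max => /andP[/NP1 h1 /NP2 h2].
  have L1 := siB SM (jacobian_mL2 (Cphi n)) Lv; have L2 := siB SM (jacobian_mL2 (Cpsi n)) Lw.
  have -> : jacobian (a *: phi n + psi n) - (a *: wgrad v + wgrad w) =
     a *: (jacobian (phi n) - wgrad v) + (jacobian (psi n) - wgrad w).
    apply/funext => x; apply/matrixP => i j; rewrite !fctE /jacobian !mxE cE.
    have s1 := Ccinfty_smooth (Cphi n i); have s2 := Ccinfty_smooth (Cpsi n i).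
    by rewrite (partialD j x (smoothZ a s1) s2) (partialZ a j x s1); ring.
  apply: le_lt_trans (nrmD SM (siZ SM a L1) L2) _; rewrite (nrmZ SM)//.
  apply: (@le_lt_trans _ _ (`|a| * (e / 2 / (`|a| + 1)) + nrm mip3 (jacobian (psi n) - wgrad w))).
    by rewrite lerD2r ler_wpM2l// ltW.
  rewrite [ltRHS](_ : _ = `|a| * (e / 2 / (`|a| + 1)) + (e / 2 / (`|a| + 1)) + e / 2); last first.
    by field; rewrite gt_eqF.
  rewrite -addrA ltrD2l; apply: lt_trans h2 _; by rewrite ltrDr.
Qed.

End Hdot1.

(** * The space hdot1s *)

Section Hdot1Complete.
Context {R : realType}.
Implicit Types (f g : R3 R -> R) (w v z : vfield R) (G K : mfield R) (phi : nat -> vfield R).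

Local Notation mip3 := (@mip _ (R3 R) R leb3 3 3).
Local Notation SM := (semi_inner_mL2 (m := 3) (n := 3) (@leb3 R)).

(** [hardy] on each component; the factor 2 is the square root of its constant 4. *)
Lemma hardy_field (w : vfield R) : vCcinfty w ->
  mL2 leb3 (fun x => hweight x *: w x) /\
  nrm (mip leb3) (fun x => hweight x *: w x) <= 2 * nrm mip3 (jacobian w).
Proof.
move=> Cw; have LJ := jacobian_mL2 Cw.
have sw i : smooth (comp w i) := Ccinfty_smooth (Cw i).
have bw i : bsupp (comp w i) := Ccinfty_bsupp (Cw i).
have cE (p : 'I_1 * 'I_3) : ent p (fun x => hweight x *: w x) = (fun x => comp w p.2 x * hweight x).
  by apply/funext => x; rewrite /ent /comp mxE mulrC (ord1 p.1).
have L : mL2 leb3 (fun x => hweight x *: w x).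
  move=> p; rewrite cE; apply: continuous_L2; last exact: bsuppMl.
  by apply: smooth_continuous; apply: smoothM => //; exact: smooth_hweight.
split=> //; rewrite -(@ler_pXn2r _ 2%N) ?nnegrE ?mulr_ge0 ?nrm_ge0//.
have LJp i j : L2 leb3 (partial j (comp w i)).
  by apply: Ccinfty_L2; apply: Ccinfty_partial; exact: Cw.
rewrite exprMn !nrm_mip// -(pair_big xpredT xpredT (fun i j => nrm (ipL2 leb3) (ent (i, j) (fun x => hweight x *: w x)) ^+ 2))/=.
rewrite big_ord1 -(pair_big xpredT xpredT (fun i j => nrm (ipL2 leb3) (ent (i, j) (jacobian w)) ^+ 2))/=.
rewrite mulr_sumr; apply: ler_sum => i _.
have E1 : nrm (ipL2 leb3) (ent (ord0, i) (fun x => hweight x *: w x)) ^+ 2 =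
    \int[leb3]_x (comp w i x * hweight x) ^+ 2.
  rewrite (nrm_sqr (semi_inner_L2 leb3) (L (ord0, i))) cE.
  by apply: eq_Rintegral => x _; rewrite expr2.
have E2 j : nrm (ipL2 leb3) (ent (i, j) (jacobian w)) ^+ 2 = \int[leb3]_x partial j (comp w i) x ^+ 2.
  rewrite (nrm_sqr (semi_inner_L2 leb3)); last exact: (LJ (i, j)).
  by apply: eq_Rintegral => x _; rewrite expr2 /ent mxE.
rewrite E1 (eq_bigr _ (fun j _ => E2 j)); apply: le_trans (hardy (sw i) (bw i)) _.
by rewrite ler_wpM2r// ?(sumr_ge0)// => [j _|]; [rewrite -E2 sqr_ge0|lra].
Qed.

Lemma vCcinftyB w v : vCcinfty w -> vCcinfty v -> vCcinfty (w - v).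
Proof.
move=> Cw Cv i; have /CcinftyP[s1 b1] := Cw i; have /CcinftyP[s2 b2] := Cv i.
have -> : comp (w - v) i = (fun x => comp w i x + -1 * comp v i x).
  by apply/funext => x; rewrite /comp !mxE mulN1r.
apply/CcinftyP; split; last by apply: bsuppD => //; exact: bsuppMr.
exact: (smoothD s1 (smoothZ (-1) s2)).
Qed.

Lemma jacobianB w v : vCcinfty w -> vCcinfty v -> jacobian (w - v) = jacobian w - jacobian v.
Proof.
move=> Cw Cv; apply/funext => x; apply/matrixP => i j; rewrite !fctE /jacobian !mxE.
have -> : comp (w - v) i = (fun y => comp w i y - comp v i y).
  by apply/funext => y; rewrite /comp !mxE.
exact: (partialB j x (Ccinfty_smooth (Cw i)) (Ccinfty_smooth (Cv i))).
Qed.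

(* By Hardy's inequality the weighted test fields converge in L^2. *)
Lemma hdot1_lim phi G : (forall n, vCcinfty (phi n)) -> mL2 leb3 G ->
  clim mip3 (fun n => jacobian (phi n)) G ->
  exists w, [/\ hdot1 w, {ae leb3, forall x, wgrad w x = G x} & nrm mip3 (wgrad w - G) = 0].
Proof.
move=> Cphi LG cG.
have SV := semi_inner_mL2 (m := 1) (n := 3) (@leb3 R).
pose v n : vfield R := fun x => hweight x *: phi n x.
have Lv n : mL2 leb3 (v n) by exact: (hardy_field (Cphi n)).1.
have LJ n : mL2 leb3 (jacobian (phi n)) by exact: jacobian_mL2.
have [|g Lg cg] := scomplete_mL2 Lv.
  (* A quarter of [e], since [hardy_field] costs a factor 2 and the triangle inequality gives two
     terms. *)
  move=> e e0; have e4 : 0 < e / 4 by rewrite divr_gt0.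
  have [N NP] := cG _ e4; exists N => i j /NP hi /NP hj.
  have [_] := hardy_field (vCcinftyB (Cphi i) (Cphi j)); rewrite (jacobianB (Cphi i) (Cphi j)).
  have -> : (fun x => hweight x *: (phi i - phi j) x) = v i - v j.
    by apply/funext => x; rewrite /v !fctE scalerBr.
  move=> h; apply: le_lt_trans h _; have := nrm_triang SM (LJ i) LG (LJ j).
  move: hi hj; rewrite (nrmBC SM (LJ j) LG).
  by move: (nrm _ _) (nrm _ _) (nrm _ _) => p q t *; lra.
(* This undoes the weight: [g] is the L^2 limit of the weighted fields, and [1 + nsq] is the inverse
   of [hweight]. *)
pose w : vfield R := fun x => (1 + nsq x) *: g x.
have c1 : continuous (fun x : R3 R => 1 + nsq x).
  by apply: smooth_continuous; apply: smoothD; [exact: smooth_cst|exact: smooth_nsq].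
have cw i : comp w i = (fun x => ent (ord0, i) g x * (1 + nsq x)).
  by apply/funext => x; rewrite /comp /w /ent mxE mulrC.
have lw i : loc_integrable (comp w i).
  by rewrite cw; apply: loc_integrableMc => //; exact: L2_loc_integrable.
have pw : tends phi w.
  apply/tendsP => r i e e0; have [K K0 KP] := L1_ball_le r c1.
  have e1 : 0 < e / (K + 1) by rewrite divr_gt0// ltr_pwDr.
  have [N NP] := cg _ e1; exists N => n /NP hn.
  have Ld := siB SV (Lv n) Lg.
  rewrite (_ : (\int[leb3]_(y in eball 0%R r) `|comp (phi n) i y - comp w i y|%:E =
      \int[leb3]_(y in eball 0%R r) `|(1 + nsq y)%R * ent (ord0, i) (v n - g) y|%:E)%E); last first.
    apply: eq_integral => y _; rewrite cw entB /ent /= /v !fctE !mxE /comp mulrBr.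
    by rewrite mulrA divff ?mul1r ?gt_eqF ?hweight_den// [X in _ - X]mulrC.
  apply: le_lt_trans (KP _ (Ld (ord0, i))) _; rewrite lte_fin.
  apply: (@le_lt_trans _ _ (K * (e / (K + 1)))).
    by rewrite ler_wpM2l//; apply: le_trans (nrm_ent_le _ Ld) (ltW hn).
  by rewrite mulrCA gtr_pMr// ltr_pdivrMr ?ltr_pwDr// mul1r ltrDl.
by have [? _ ? ?] := hdot1_intro lw Cphi pw LG cG; exists w.
Qed.

Lemma hdot1_0 : hdot1 (0 : vfield R) /\ {ae leb3, forall x, wgrad (0 : vfield R) x = 0}.
Proof.
have C0 i : Ccinfty (comp (0 : vfield R) i).
  have -> : comp (0 : vfield R) i = (fun=> 0) by apply/funext => x; rewrite /comp mxE.
  by apply/CcinftyP; split; [exact: smooth_cst|exists 0].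
suff [h1 _ h2 _] : [/\ hdot1 (0 : vfield R), mL2 leb3 (wgrad (0 : vfield R)),
  {ae leb3, forall x, wgrad (0 : vfield R) x = (0 : mfield R) x} & nrm mip3 (wgrad (0 : vfield R) - 0) = 0] by split.
apply: (@hdot1_intro _ (fun=> 0)) => //.
- move=> i; apply: continuous_loc_integrable; apply: smooth_continuous; exact: Ccinfty_smooth (C0 i).
- apply/tendsP => r i e e0; exists 0%N => n _.
  by under eq_integral do rewrite subrr normr0; rewrite integral0 lte_fin.
- exact: si0 SM.
- move=> e e0; exists 0%N => n _; rewrite subr0.
  have -> : jacobian (0 : vfield R) = 0.
    apply/funext => x; apply/matrixP => i j; rewrite !mxE.
    have -> : comp (0 : vfield R) i = (fun=> 0) by apply/funext => y; rewrite /comp mxE.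
    exact: partial_cst.
  by rewrite (si_eq0 (si0 SM)) ?(si0l SM (si0 SM)).
Qed.

Lemma hdot1_L2 w : hdot1 w -> mL2 leb3 (wgrad w).
Proof. by move=> /hdot1_elim[]. Qed.

(** [wgrad (v - w)] and [wgrad v - wgrad w] agree almost everywhere, so they have the same norm.
    This turns Cauchy sequences of fields into Cauchy sequences of gradients in L^2. *)
Lemma hnorm_B v w : hdot1 v -> hdot1 w -> nrm hinner (v - w) = nrm mip3 (wgrad v - wgrad w).
Proof.
move=> hv hw; have [_ _ Lv _] := hdot1_elim hv; have [_ _ Lw _] := hdot1_elim hw.
have [hd _ d0] := hdot1_lin (-1) hw hv; move: hd d0.
rewrite !scaleN1r ![- _ + _]addrC => hd d0.
have [_ _ Ld _] := hdot1_elim hd.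
rewrite {1}/nrm hinner_mip// -/(nrm mip3 _).
have LB := siB SM Lv Lw.
exact: (nrm_dist0 SM Ld LB d0).
Qed.

Lemma semi_inner_hdot1s : semi_inner (@hdot1s R) hinner.
Proof.
have lin (a : R) (x y : vfield R) : hdot1s x -> hdot1s y -> hdot1s (a *: x + y).
  move=> [hx tx] [hy ty]; have [h g _] := hdot1_lin a hx hy; split; first exact: h.
  by apply: filterS3 tx ty g => t ex ey ->; rewrite mxtraceD mxtraceZ ex ey mulr0 addr0.
have s0 : hdot1s (0 : vfield R).
  have [h g] := hdot1_0; split; first exact: h.
  by apply: filterS g => t ->; rewrite mxtrace0.
have ipl (a : R) (x y z : vfield R) : hdot1s x -> hdot1s y -> hdot1s z ->
    hinner (a *: x + y) z = a * hinner x z + hinner y z.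
  move=> [hx _] [hy _] [hz _]; have [h g d0] := hdot1_lin a hx hy.
  have [_ _ Lx _] := hdot1_elim hx; have [_ _ Ly _] := hdot1_elim hy.
  have [_ _ Lz _] := hdot1_elim hz; have [_ _ Ls _] := hdot1_elim h.
  have La := siZ SM a Lx; have Lt := siD SM La Ly.
  rewrite !hinner_mip// -(siZl SM)// -(siDl SM)//; apply/eqP; rewrite -subr_eq0 -(siBl SM)//.
  by apply/eqP; apply: (si_null SM) => //; exact: (siB SM).
split; first exact: s0.
- by move=> x y hx hy; have := lin 1 x y hx hy; rewrite scale1r.
- by move=> a x hx; have := lin a x 0 hx s0; rewrite addr0.
- move=> x y [hx _] [hy _]; rewrite (hinner_mip hx hy) (hinner_mip hy hx).
  exact: (siC SM (hdot1_L2 hx) (hdot1_L2 hy)).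
- by move=> x y z hx hy hz; have := ipl 1 x y z hx hy hz; rewrite scale1r mul1r.
- move=> a x y hx hy; have := ipl a x 0 y hx s0 hy; rewrite addr0 => ->.
  have := ipl 1 0 0 y s0 s0 hy; rewrite scaler0 addr0 mul1r.
  by move: (hinner 0 y) => p e; rewrite (_ : p = 0) ?addr0//; lra.
- by move=> x [hx _]; rewrite (hinner_mip hx hx); exact: (si_ge0 SM (hdot1_L2 hx)).
Qed.

Lemma trace_L2 G : mL2 leb3 G -> L2 leb3 (fun x => \tr (G x)).
Proof.
move=> LG; have S := semi_inner_L2 (@leb3 R).
have -> : (fun x => \tr (G x)) = \sum_(i < 3) ent (i, i) G by apply/funext => x; rewrite fct_sumE.
by apply: (si_sum S) => i; exact: (LG (i, i)).
Qed.

Lemma trace_closed G : mL2 leb3 G ->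
  (forall e : R, 0 < e -> exists F : mfield R, [/\ mL2 leb3 F,
    nrm (ipL2 leb3) (fun x => \tr (F x)) < e & nrm mip3 (G - F) < e]) ->
  {ae leb3, forall x, \tr (G x) = 0}.
Proof.
move=> LG H; apply: (@ae_constraint_closed _ _ _ _ _ _ (fun _ A => \tr A) 1) LG H => //.
- by move=> F LF; exact: L2_measurable (trace_L2 LF).
- by move=> _ A B; rewrite raddfB.
- move=> _ A; rewrite mul1r /mxtrace; apply: le_trans (ler_norm_sum _ _ _) _.
  rewrite -(pair_big xpredT xpredT (fun i j => `|A i j|))/=.
  by apply: ler_sum => i _; rewrite (bigD1 i)//= lerDl sumr_ge0.
Qed.

(** The gradients converge in L^2. Replacing each [u n] by a test field at distance less than
    1/(n+1), [hdot1_lim] realizes the limit as a weak gradient, and [trace_closed] shows that it is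
    trace free. *)
Lemma scomplete_hdot1s : scomplete (@hdot1s R) hinner.
Proof.
move=> u hu cu; have S := semi_inner_L2 (@leb3 R).
have h1 n : hdot1 (u n) := (hu n).1.
have Lu n : mL2 leb3 (wgrad (u n)) by have [] := hdot1_elim (h1 n).
have [|G LG cG] := scomplete_mL2 Lu.
  move=> e e0; have [N NP] := cu e e0; exists N => i j Ni Nj.
  by rewrite -hnorm_B//; exact: NP.
have /choice[psi psiP] n : exists psi, vCcinfty psi /\ nrm mip3 (jacobian psi - wgrad (u n)) < n.+1%:R^-1.
  have [_ _ _ [phi [Cphi _ cphi]]] := hdot1_elim (h1 n).
  have n0 : 0 < n.+1%:R^-1 :> R by rewrite invr_gt0.
  by have [N NP] := cphi _ n0; exists (phi N); split=> //; exact: NP.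
have Cpsi n := (psiP n).1.
have LJ n : mL2 leb3 (jacobian (psi n)) by exact: jacobian_mL2.
have [|w [hw aeG d0]] := @hdot1_lim psi G Cpsi LG.
  move=> e e0; have e2 : 0 < e / 2 by rewrite divr_gt0.
  have [N1 NP1] := cG _ e2; have [N2 NP2] := inv_nat_lt e2.
  exists (maxn N1 N2) => n; rewrite geq_max => /andP[/NP1 hn Nn].
  have := nrm_triang SM (LJ n) (Lu n) LG; have := (psiP n).2.
  have : n.+1%:R^-1 <= N2.+1%:R^-1 :> R by rewrite lef_pV2 ?posrE// ler_nat.
  move: NP2 hn; move: (nrm _ _) (nrm _ _) (nrm _ _) (n.+1%:R^-1) (N2.+1%:R^-1) => *; lra.
have [_ _ Lw _] := hdot1_elim hw.
exists w.
  split; first exact: hw.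
  suff tG : {ae leb3, forall x, \tr (G x) = 0} by apply: filterS2 aeG tG => x ->.
  apply: trace_closed => // e e0; have [N NP] := cG _ e0; exists (wgrad (u N)).
  split; [exact: Lu| |].
    rewrite nrmL2_eq0; [exact: e0| |exact: (hu N).2].
    exact: (trace_L2 (Lu N)).
  by rewrite (nrmBC SM LG (Lu N)); exact: NP.
move=> e e0; have [N NP] := cG _ e0; exists N => n /NP hn; rewrite (hnorm_B (h1 n) hw).
have := nrm_triang SM (Lu n) LG Lw; rewrite (nrmBC SM LG Lw) d0 addr0 => h; exact: le_lt_trans h hn.
Qed.

End Hdot1Complete.

(** * Rigidity constraints on balls *)

Section Rigid.
Context {R : realType}.
Implicit Types (w v z : vfield R) (G K : mfield R) (A : set (R3 R)).

Local Notation mip3 := (@mip _ (R3 R) R leb3 3 3).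
Local Notation SM := (semi_inner_mL2 (m := 3) (n := 3) (@leb3 R)).

Lemma sgrad_eq0 w x : sgrad w x = 0 <-> forall p : 'I_3 * 'I_3, wgrad w x p.1 p.2 + wgrad w x p.2 p.1 = 0.
Proof.
rewrite /sgrad; split=> [/eqP|H].
  rewrite scaler_eq0 invr_eq0 (negbTE (_ : 2 != 0))//= => /eqP/matrixP H [i j] /=.
  by have := H i j; rewrite !mxE.
apply/matrixP => i j; rewrite !mxE; have := H (i, j) => /= ->.
by rewrite mulr0.
Qed.

Lemma closed_rigid_in A : measurable A -> closed_sub (@hdot1s R) hinner (rigid_in A).
Proof.
move=> mA; have S := @semi_inner_hdot1s R; split.
- by move=> w [].
- split; first exact: si0 S.
  by apply: filterS hdot1_0.2 => x x0 _; apply/sgrad_eq0 => p; rewrite x0 !mxE addr0.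
- move=> a v w [hv rv] [hw rw]; split; first by apply: (siD S); [exact: (siZ S)|].
  have [_ g _] := hdot1_lin a hv.1 hw.1.
  apply: filterS3 rv rw g => x rvx rwx gx Ax; apply/sgrad_eq0 => p; rewrite gx !mxE.
  have /sgrad_eq0/(_ p) e1 := rvx Ax; have /sgrad_eq0/(_ p) e2 := rwx Ax.
  by rewrite addrACA -mulrDr e1 e2 mulr0 addr0.
move=> w hw cw; split=> //.
suff : {ae leb3, forall x (p : 'I_3 * 'I_3), \1_A x * (wgrad w x p.1 p.2 + wgrad w x p.2 p.1) = 0}.
  apply: filterS => x H Ax; apply/sgrad_eq0 => p; have := H p.
  by rewrite indicE mem_set// mul1r.
apply: filter_forall => p; have Lw := hdot1_L2 hw.1.
have LS (F : mfield R) : mL2 leb3 F -> measurable_fun setT (fun x => \1_A x * (F x p.1 p.2 + F x p.2 p.1)).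
  move=> LF; apply: measurable_funM; first exact: measurable_indic.
  apply: measurable_funD; first exact: L2_measurable (LF p).
  exact: L2_measurable (LF (p.2, p.1)).
apply: (@ae_constraint_closed _ _ _ _ _ _
  (fun x (B : 'M[R]_3) => \1_A x * (B p.1 p.2 + B p.2 p.1)) 2 (wgrad w) LS) => //.
- by move=> x B C; rewrite !mxE; ring.
- move=> x B; have l1 (q : 'I_3 * 'I_3) : `|B q.1 q.2| <= \sum_(q : 'I_3 * 'I_3) `|B q.1 q.2|.
    by rewrite (bigD1 q)//= lerDl; apply: sumr_ge0.
  have h1 := l1 p; have h2 := l1 (p.2, p.1).
  rewrite indicE normrM; apply: (@le_trans _ _ `|B p.1 p.2 + B p.2 p.1|).
    by rewrite ler_piMl//; case: (_ \in _); rewrite ?normr1 ?normr0.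
  by apply: le_trans (ler_normD _ _) _; move: h1 h2 => /=; move: (\sum_q _) => s *; lra.
move=> e e0; have [v [hv rv] vw] := cw e e0; have Lv := hdot1_L2 hv.1.
exists (wgrad v); split; [exact: Lv| |by rewrite -(hnorm_B hw.1 hv.1)].
have ae0 : {ae leb3, forall x, \1_A x * (wgrad v x p.1 p.2 + wgrad v x p.2 p.1) = 0}.
  apply: filterS rv => x rvx; rewrite indicE; case: (boolP (x \in A)) => [/set_mem/rvx/sgrad_eq0 ->|_].
    by rewrite mulr0.
  by rewrite mul0r.
rewrite nrmL2_eq0//; apply: L2_ae ae0; [exact: LS|exact: si0 (semi_inner_L2 leb3)].
Qed.

Lemma measurable_ecball (x : R3 R) (r : R) : measurable (ecball x r).
Proof.
have -> : ecball x r = \bigcap_(n : nat) eball x (r + n.+1%:R^-1).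
  apply/seteqP; split=> y.
    by move=> h n _; apply: le_lt_trans h _; rewrite ltrDl invr_gt0.
  move=> h; apply/ler_addgt0Pr => e e0; have [N NP] := inv_nat_lt e0.
  by apply: ltW; apply: lt_trans (h N I) _; rewrite ltrD2l.
by apply: bigcap_measurable => // n _; exact: measurable_eball.
Qed.

(** Each line in the third direction meets the sphere in at most two points. It reconciles the
    closed balls of [Wspace] with the open balls of [Wsub]. *)
Lemma sphere_null (x : R3 R) (r : R) : {ae leb3, forall y, edist x y != r}.
Proof.
pose S := ecball x r `\` eball x r.
have mS : measurable S by apply: measurableD; [exact: measurable_ecball|exact: measurable_eball].
exists S; split=> //; last first.
  move=> y /= /negP; rewrite negbK => /eqP h; rewrite /S /ecball /eball/= h.
  by rewrite lexx ltxx.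
rewrite -[S]setIT -integral_indic// leb3_tonelli; last 2 first.
- by apply/measurable_EFinP; exact: measurable_indic.
- by move=> y; rewrite lee_fin indicE.
rewrite integral0_eq// => a _; rewrite integral0_eq// => b _.
pose k := r ^+ 2 - (a - coord x (@Ordinal 3 0 isT)) ^+ 2 - (b - coord x (@Ordinal 3 1 isT)) ^+ 2.
pose q := coord x (@Ordinal 3 2 isT).
have -> : (\int[lebesgue_measure]_c (\1_S (a, b, c) : R)%:E = lebesgue_measure (xsection S (a, b)))%E.
  rewrite -[xsection S (a, b)]setIT -integral_indic//; last exact: measurable_xsection.
  by apply: eq_integral => c _; rewrite !indicE mem_xsection.
apply: countable_lebesgue_measure0; apply: finite_set_countable.
apply: (@sub_finite_set _ _ [set q + Num.sqrt k; q - Num.sqrt k]); last exact: finite_set2.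
move=> c; rewrite /xsection/= inE /S /ecball /eball /= => -[h1 h2].
have h : edist x (a, b, c) = r by apply/eqP; rewrite eq_le h1/= leNgt; apply/negP.
have : (c - q) ^+ 2 = k.
  rewrite /k -h edistE sqr_sqrtr ?nsq_ge0// /nsq sum3 !coordB /q /coord/=; ring.
move=> ck; have : `|c - q| = Num.sqrt k by rewrite -ck sqrtr_sqr.
have [cq <-|cq <-] := ger0P (c - q); [left|right]; lra.
Qed.

Context {I : countType} (X : I -> R3 R) (rho : I -> R).

(** The exceptional null sets, one for each ball, are countably many, and by [sphere_null] closing a
    ball adds only a null set. *)
Lemma WspaceP w : Wspace X rho w <-> hdot1s w /\ forall i, Wsub X rho i w.
Proof.
split=> [[hw rw]|[hw rw]].
  split=> // i; split=> //; apply: filterS rw => y H yi; apply: H.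
  by exists i => //; exact: ltW.
split=> //.
pose P (i : I) (y : R3 R) := ecball (X i) (rho i) y -> sgrad w y = 0.
have H i : {ae leb3, forall y, P i y}.
  apply: filterS2 (rw i).2 (sphere_null (X i) (rho i)) => y e s.
  by rewrite /P /ecball/= le_eqVlt (negbTE s) => /e.
(* The indices are enumerated through [unpickle]; a number that codes no index gives a trivial
   statement. *)
have H' n : {ae leb3, forall y, if (@choice.unpickle I n) is Some i then P i y else True}.
  by case: (@choice.unpickle I n) => [i|]; [exact: H|exact: aeW].
have := ae_foralln H'; apply: filterS => y Hy [i _ yi].
by have := Hy (choice.pickle i); rewrite choice.pickleK; apply.
Qed.

Lemma closed_Wsub i : closed_sub (@hdot1s R) hinner (Wsub X rho i).
Proof. by apply: closed_rigid_in; exact: measurable_eball. Qed.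

Lemma closed_Wspace : closed_sub (@hdot1s R) hinner (Wspace X rho).
Proof.
apply: closed_rigid_in; apply: countable_bigcupT_measurable => [|i].
  exact: countableP.
exact: measurable_ecball.
Qed.

End Rigid.

(** * Divergence-free extension *)

Section Averaging.
Context {R : realType}.
Implicit Types (f g h G H : R3 R -> R) (A B : set (R3 R)) (r : R).
Local Notation mu := (@lebesgue_measure R).

Lemma integral_indicM d (T : measurableType d) (m : {measure set T -> \bar R}) (A : set T) (F : T -> \bar R) :
  (\int[m]_(x in A) F x = \int[m]_x ((\1_A x)%:E * F x))%E.
Proof.
rewrite integral_mkcond; apply: eq_integral => x _; rewrite patchE indicE.
by case: (x \in A); rewrite ?mul1e ?mul0e.
Qed.

Lemma measurable_affine3 (a : R3 R) (r : R) : measurable_fun setT (fun x : R3 R => a + r *: x).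
Proof.
have -> : (fun x : R3 R => a + r *: x) = (fun x => 1 *: a + r *: x).
  by apply/funext => x; rewrite scale1r.
apply: (@measurable_affineR3 _ _ (R3 R) (fun=> a) id (fun=> 1) (fun=> r)); try exact: measurable_cst.
exact: measurable_id.
Qed.

(** Tonelli, then for each [s] the substitution [y = a s + al s *: x], which sends [A] into itself
    and costs the inverse cube of [al s], paid for by [k s <= K * al s ^+ 3]. The alternative
    [k s = 0] covers parameters at which [al s] vanishes. *)
Lemma averaging A G H (k al : R -> R) (a : R -> R3 R) (K : R) :
  measurable A -> continuous H -> (forall x, 0 <= H x) ->
  continuous k -> continuous al -> continuous a ->
  (forall s, 0 <= s <= 1 -> 0 <= k s) ->
  (forall s, 0 <= s <= 1 -> k s = 0 \/ 0 < al s /\ k s <= K * al s ^+ 3) ->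
  0 <= K -> (forall s x, 0 <= s <= 1 -> A x -> A (a s + al s *: x)) ->
  continuous G -> (forall x, 0 <= G x) ->
  (forall x, A x -> G x <= uint (fun s => k s * H (a s + al s *: x))) ->
  (\int[leb3]_(x in A) (G x)%:E <= K%:E * \int[leb3]_(x in A) (H x)%:E)%E.
Proof.
move=> mA cH H0 ck cal ca k0 kK K0 Aa cGG G0 GH.
have cin (x : R3 R) : continuous (fun s => a s + al s *: x).
  move=> s; apply: cvgD; [exact: ca|apply: cvgZr_tmp; exact: cal].
have cG (x : R3 R) : continuous (fun s => k s * H (a s + al s *: x)).
  move=> s; apply: cvgM; first exact: ck.
  by apply: (@continuous_comp _ _ _ (fun s => a s + al s *: x) H); [exact: cin|exact: cH].
have cHs (s : R) : continuous (fun x : R3 R => H (a s + al s *: x)).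
  move=> x; apply: (@continuous_comp _ _ _ (fun x : R3 R => a s + al s *: x) H); last exact: cH.
  apply: cvgD; [exact: cvg_cst|apply: cvgZl_tmp; exact: cvg_id].
pose U : set R := `[0, 1]%classic.
have mU : measurable U by exact: measurable_itv.
pose F (z : R3 R * measurableTypeR R) : \bar R :=
  (\1_A z.1 * (\1_U z.2 * (k z.2 * H (a z.2 + al z.2 *: z.1))))%:E.
have mF : measurable_fun setT F.
  apply/measurable_EFinP; apply: measurable_funM.
    by apply: measurableT_comp; [exact: measurable_indic|exact: measurable_fst].
  apply: measurable_funM.
    by apply: measurableT_comp; [exact: measurable_indic|exact: measurable_snd].
  apply: (@caratheodory_measurable _ (R3 R) R (fun z => k z.2 * H (a z.2 + al z.2 *: z.1))).
    by move=> s /=; apply: measurable_funM; [exact: measurable_cst|exact: continuous_measurableR3 (cHs s)].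
  by move=> x /=; exact: cG.
have F0 z : (0 <= F z)%E.
  rewrite lee_fin mulr_ge0 ?indicE//; case: (boolP (z.2 \in U)) => [/set_mem|]; rewrite ?mul0r//.
  by rewrite /U/= in_itv/= mul1r => h; rewrite mulr_ge0// k0.
apply: (@le_trans _ _ (\int[@lebm3 R]_x \int[mu]_s F (x, s))%E).
  rewrite integral_indicM; apply: ge0_le_integral => //.
  - by move=> x _; rewrite -EFinM lee_fin mulr_ge0 ?indicE.
  - apply/measurable_EFinP; apply: measurable_funM; first exact: measurable_indic.
    exact: continuous_measurableR3.
  - exact: (@measurable_fun_fubini_tonelli_F _ _ _ _ _ mu F mF F0).
  move=> x _; rewrite indicE; case: (boolP (x \in A)) => xA; last first.
    by rewrite mul0e; apply: integral_ge0 => s _; exact: F0.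
  rewrite mul1e; apply: (@le_trans _ _ (uint (fun s => k s * H (a s + al s *: x)))%:E).
    by rewrite lee_fin GH//; exact: set_mem.
  have -> : (uint (fun s => k s * H (a s + al s *: x)))%:E =
     (\int[mu]_(s in U) (k s * H (a s + al s *: x))%:E)%E.
    rewrite /uint /Rintegral fineK//; apply: integrable_fin_num => //.
    exact: continuous_uintegrable.
  rewrite integral_indicM le_eqVlt; apply/orP; left; apply/eqP.
  by apply: eq_integral => s _; rewrite /F [\1_A _]indicE xA mul1r EFinM.
rewrite (fubini_tonelli F mF F0).
set M := (K%:E * _)%E; have M0 : (0 <= M)%E.
  by rewrite mule_ge0//; apply: integral_ge0 => x _; rewrite lee_fin.
(* The bound for each [s] is the same [M], and the unit interval has measure 1. *)
have -> : M = (\int[mu]_(s in U) M)%E.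
  rewrite integral_cst// [X in (_ * X)%E](@lebesgue_measure_itv R `[0, 1]) /=.
  by rewrite lte01 oppr0 adde0 mule1.
rewrite [leRHS]integral_mkcond; apply: ge0_le_integral => //.
- by move=> s _; apply: integral_ge0 => x _; exact: F0.
- exact: (@measurable_fun_fubini_tonelli_G _ _ _ _ _ (@lebm3 R) F mF F0).
- by apply/(measurable_restrictT _ mU); exact: measurable_cst.
move=> s _; rewrite patchE; case: ifPn => sU; last first.
  by rewrite integral0_eq// => x _; rewrite /F/= [\1_U s]indicE (negbTE sU) mul0r mulr0.
have s01 : 0 <= s <= 1 by move: sU; rewrite inE /U/= in_itv.
have [k0s|[al0 kal]] := kK s s01.
  by rewrite integral0_eq// => x _; rewrite /F/= k0s mul0r !mulr0.
pose H1 x := (\1_A x * H x)%:E.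
have mH1 : measurable_fun setT H1.
  apply/measurable_EFinP; apply: measurable_funM; first exact: measurable_indic.
  exact: continuous_measurableR3.
have H10 x : (0 <= H1 x)%E by rewrite lee_fin mulr_ge0 ?indicE.
have mH1a : measurable_fun setT (fun x : R3 R => H1 (a s + al s *: x)).
  by apply: (measurableT_comp mH1); exact: measurable_affine3.
apply: (@le_trans _ _ (\int[leb3]_x ((k s)%:E * H1 (a s + al s *: x)%R))%E).
  apply: ge0_le_integral => //.
  - by apply: (measurableT_comp mF); exact: measurable_pair2.
  - by apply: measurable_funeM; exact: mH1a.
  - move=> x _; rewrite /F /H1/= -EFinM lee_fin [\1_U s]indicE sU mul1r !indicE.
    case: (boolP (x \in A)) => [/set_mem xA|_]; last first.
      by rewrite mul0r mulr_ge0 ?k0// mulr_ge0.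
    by rewrite mul1r (mem_set (Aa s x s01 xA)) mul1r.
rewrite ge0_integralZl_EFin ?k0//.
rewrite ge0_integral_leb3_affine// /M muleA -EFinM.
have -> : (\int[leb3]_(x in A) (H x)%:E = \int[leb3]_x H1 x)%E.
  by rewrite integral_indicM; apply: eq_integral => x _; rewrite -EFinM.
apply: lee_wpmul2r; first exact: integral_ge0.
by rewrite lee_fin exprVn ler_pdivrMr// exprn_gt0.
Qed.

(** Jensen squares the weight [t ^+ 2] into [t ^+ 4], which is below the cube [t ^+ 3] required by
    [averaging]; hence the constant 1. The weight of [pint 1] would only give [t ^+ 2], which no
    multiple of [t ^+ 3] dominates. *)
Lemma pint_L2_le r g : smooth g ->
  (\int[leb3]_(x in eball 0%R r) (pint 2 g x ^+ 2)%:E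
    <= \int[leb3]_(x in eball 0%R r) (g x ^+ 2)%:E)%E.
Proof.
move=> sg; have mB := measurable_eball (0 : R3 R) r; have cg := smooth_continuous sg.
have [r0|r0] := leP r 0; first by rewrite eball_le0// !integral_set0.
rewrite -[leRHS]mul1e; apply: (@averaging _ _ _ (fun s => s ^+ 4) id (fun=> 0)) => //.
- exact: continuous_sqr.
- by move=> x; exact: sqr_ge0.
- by move=> s; exact: exprn_continuous.
- by move=> s; exact: cvg_id.
- by move=> s; exact: cvg_cst.
- by move=> s /andP[s0 _]; rewrite exprn_ge0.
- move=> s /andP[]; rewrite le_eqVlt => /orP[/eqP <- _|s0 s1]; first by left; rewrite expr0n.
  by right; split=> //; rewrite mul1r exprS ler_piMl// exprn_ge0// ltW.
- move=> s x /andP[s0 s1] /(eballP 0 x r0); rewrite subr0 => xr.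
  apply/eballP => //; rewrite subr0 add0r nsqZ; apply: le_lt_trans xr.
  by rewrite ler_piMl ?nsq_ge0// expr_le1.
- by apply: continuous_sqr; apply: smooth_continuous; exact: smooth_pint.
- by move=> x; exact: sqr_ge0.
move=> x _; rewrite /pint; apply: le_trans (uint_jensen _) _.
  exact: pint_integrand_continuous.
rewrite le_eqVlt; apply/orP; left; apply/eqP; apply: eq_uint => t _.
by rewrite add0r exprMn -exprM.
Qed.

Lemma cauchy_schwarz3 (v d : 'I_3 -> R) :
  (\sum_(j < 3) v j * d j) ^+ 2 <= (\sum_(j < 3) v j ^+ 2) * \sum_(j < 3) d j ^+ 2.
Proof.
rewrite !sum3 -subr_ge0; set v0 := v _; set v1 := v _; set v2 := v _.
set d0 := d _; set d1 := d _; set d2 := d _.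
rewrite [X in 0 <= X](_ : _ = (v0 * d1 - v1 * d0) ^+ 2 + (v0 * d2 - v2 * d0) ^+ 2 + (v1 * d2 - v2 * d1) ^+ 2); last by ring.
by rewrite !addr_ge0 ?sqr_ge0.
Qed.

Definition gsq f (x : R3 R) : R := \sum_(j < 3) partial j f x ^+ 2.

Lemma gsq_ge0 f x : 0 <= gsq f x.
Proof. by apply: sumr_ge0 => j _; exact: sqr_ge0. Qed.

Lemma continuous_gsq f : smooth f -> continuous (gsq f).
Proof.
move=> sf; apply: continuous_sum3 => j; apply: continuous_sqr.
exact/smooth_continuous/smooth_partial.
Qed.

(* Comparing [x] with the midpoint keeps the coefficient of [x] on the segment
   above [1/2], so that the change of variables in [x] costs a factor [8]. *)
Lemma midpoint_le r f y : 0 < r -> smooth f -> eball 0 r y ->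
  (\int[leb3]_(x in eball 0%R r) ((f x - f (2^-1 *: (x + y))%R) ^+ 2)%:E
    <= (8 * r ^+ 2)%:E * \int[leb3]_(x in eball 0%R r) (gsq f x)%:E)%E.
Proof.
move=> r0 sf yB; have mB := measurable_eball (0 : R3 R) r.
have /(eballP 0 y r0) yr := yB; rewrite subr0 in yr.
pose al (s : R) : R := (1 + s) / 2; pose a (s : R) : R3 R := ((1 - s) / 2) *: y.
have cal : continuous al by move=> s; apply: cvgMl; apply: cvgD; [exact: cvg_cst|exact: cvg_id].
have ca : continuous a.
  move=> s; apply: cvgZr_tmp; apply: cvgMl; apply: cvgB; [exact: cvg_cst|exact: cvg_id].
have ck : continuous (fun _ : R => r ^+ 2) by move=> s; exact: cvg_cst.
apply: (@averaging _ _ _ (fun=> r ^+ 2) al a) => //.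
- exact: continuous_gsq.
- exact: gsq_ge0.
- by move=> s _; exact: sqr_ge0.
- move=> s /andP[s0 s1]; right; split; first by rewrite /al; lra.
  have h : 1 <= 8 * al s ^+ 3.
    have -> : 8 * al s ^+ 3 = (1 + s) ^+ 3 by rewrite /al; field.
    by apply: exprn_ege1; lra.
  by rewrite mulrAC ler_peMl// sqr_ge0.
- by rewrite mulr_ge0// sqr_ge0.
- move=> s x /andP[s0 s1] /(eballP 0 x r0); rewrite subr0 => xr; apply/eballP => //.
  rewrite subr0; apply: (@le_lt_trans _ _ ((1 - s) / 2 * nsq y + al s * nsq x)).
    rewrite /nsq !mulr_sumr -big_split; apply: ler_sum => j _ /=.
    rewrite coordD !coordZ -subr_ge0 /al.
    rewrite [X in 0 <= X](_ : _ = (1 - s) / 2 * ((1 + s) / 2) * (coord x j - coord y j) ^+ 2); last by field.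
    by apply: mulr_ge0; [apply: mulr_ge0; lra|exact: sqr_ge0].
  have -> : r ^+ 2 = (1 - s) / 2 * r ^+ 2 + al s * r ^+ 2 by rewrite /al; field.
  apply: ler_ltD; first by rewrite ler_wpM2l ?(ltW yr)//; lra.
  by rewrite ltr_pM2l// /al; lra.
- have cf := smooth_continuous sf; apply: continuous_sqr => x; apply: cvgB; first exact: cf.
  apply: (@continuous_comp _ _ _ (fun x : R3 R => 2^-1 *: (x + y)) f); last exact: cf.
  by apply: cvgZl_tmp; apply: cvgD; [exact: cvg_id|exact: cvg_cst].
- by move=> x; exact: sqr_ge0.
move=> x /(eballP 0 x r0); rewrite subr0 => xr.
pose m := 2^-1 *: (x + y); pose v := 2^-1 *: (x - y).
have vE s : m + s *: v = a s + al s *: x.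
  by apply/R3_eqP => j; rewrite /m /v /a /al !(coordD, coordZ, coordN); field.
pose g s := \sum_(j < 3) coord v j * partial j f (m + s *: v).
have dg (s : R) : is_derive s 1 (fun s : R => f (m + s *: v)) (g s).
  exact/is_derive_line/is_derive_dir/smooth_Ck.
have cv : continuous (fun s : R => m + s *: v).
  by move=> s; apply: cvgD; [exact: cvg_cst|apply: cvgZr_tmp; exact: cvg_id].
have cg : continuous g.
  apply: continuous_sum3 => j s; apply: cvgMr.
  apply: (@continuous_comp _ _ _ (fun s : R => m + s *: v) (partial j f)); first exact: cv.
  exact/smooth_continuous/smooth_partial.
have -> : f x - f m = uint g.
  rewrite (uint_FTC dg cg) scale0r addr0 scale1r; congr (f _ - _).
  by apply/R3_eqP => j; rewrite /m /v !(coordD, coordZ, coordN); field.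
apply: le_trans (uint_jensen cg) _; apply: le_uint.
- by under eq_fun do rewrite expr2; move=> s; exact: (continuousM (cg s) (cg s)).
- move=> s; apply: cvgMr; apply: (@continuous_comp _ _ _ (fun s : R => a s + al s *: x) (gsq f)).
    by apply: cvgD; [exact: ca|apply: cvgZr_tmp; exact: cal].
  exact: continuous_gsq.
move=> s _; apply: le_trans (cauchy_schwarz3 _ _) _; rewrite vE ler_wpM2r ?gsq_ge0//.
(* The factor [r ^+ 2] comes from here: [nsq v] is at most the mean of [nsq x] and [nsq y], both
   below [r ^+ 2]. *)
rewrite -/(nsq v); apply: (@le_trans _ _ (2^-1 * nsq x + 2^-1 * nsq y)).
  rewrite /nsq !mulr_sumr -big_split; apply: ler_sum => j _ /=.
  rewrite coordZ coordB -subr_ge0.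
  rewrite [X in 0 <= X](_ : _ = (2^-1 * (coord x j + coord y j)) ^+ 2); last by field.
  exact: sqr_ge0.
by move: xr yr; lra.
Qed.

End Averaging.

(** * The Poincare inequality on a ball *)

Section Poincare.
Context {R : realType}.
Implicit Types (f g h : R3 R -> R) (A B : set (R3 R)) (r : R).

Lemma continuous_eball_integrable h r : continuous h -> leb3.-integrable (eball 0 r) (EFin \o h).
Proof. by move=> ch; exact: continuous_loc_integrable. Qed.

Lemma Rintegral_sqr_le h r : continuous h ->
  (((\int[leb3]_(x in eball 0 r) h x) ^+ 2)%:E <=
    leb3 (eball (0%R : R3 R) r) * \int[leb3]_(x in eball 0%R r) (h x ^+ 2)%:E)%E.
Proof.
move=> ch; set A := eball 0 r; have mA : measurable A := measurable_eball 0 r.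
have fA : (leb3 A < +oo)%E := leb3_eball_fin 0 r.
have S := semi_inner_L2 (@leb3 R); have L1 := L2_indic mA fA.
pose h1 x : R := \1_A x * h x.
have mh1 : measurable_fun setT h1.
  by apply: measurable_funM; [exact: measurable_indic|exact: continuous_measurableR3].
have E2 : (\int[leb3]_x (h1 x ^+ 2)%:E = \int[leb3]_(x in A) (h x ^+ 2)%:E)%E.
  rewrite [RHS]integral_indicM; apply: eq_integral => x _; rewrite -EFinM /h1 indicE.
  by case: (x \in A); rewrite ?mul1r ?mul0r ?expr0n.
have L2h : L2 leb3 h1.
  split=> //; rewrite E2; have := integrable_fin_num mA (continuous_eball_integrable r (continuous_sqr ch)).
  by rewrite ge0_fin_numE//; apply: integral_ge0 => x _; rewrite lee_fin sqr_ge0.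
have n1 : (nrm (ipL2 leb3) (\1_A : R3 R -> R) ^+ 2)%:E = leb3 A.
  rewrite nrmL2// -[X in _ = leb3 X]setIT -integral_indic//; apply: eq_integral => x _.
  by rewrite indicE; case: (_ \in _); rewrite ?expr1n ?expr0n.
have -> : \int[leb3]_(x in A) h x = ipL2 leb3 \1_A h1.
  rewrite /Rintegral /ipL2 integral_indicM; congr fine; apply: eq_integral => x _.
  by rewrite -EFinM /h1 mulrA indicE; case: (_ \in _); rewrite ?mulr1 ?mulr0.
rewrite -n1 -E2 -nrmL2// -EFinM lee_fin -exprMn -[leLHS]real_normK ?num_real//.
have cs := si_cauchy_schwarz S L1 L2h.
by rewrite ler_pXn2r ?nnegrE ?mulr_ge0 ?nrm_ge0.
Qed.

Definition bmean r f : R := (fine (leb3 (eball (0 : R3 R) r)))^-1 * \int[leb3]_(x in eball 0 r) f x.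

Lemma poincare r f : 0 < r -> smooth f ->
  (\int[leb3]_(x in eball 0%R r) ((f x - bmean r f) ^+ 2)%:E
    <= (32 * r ^+ 2)%:E * \int[leb3]_(x in eball 0%R r) (gsq f x)%:E)%E.
Proof.
move=> r0 sf; have cf := smooth_continuous sf.
set B := eball 0 r; have mB : measurable B := measurable_eball 0 r.
have fB : (leb3 B < +oo)%E := leb3_eball_fin 0 r.
pose vol := fine (leb3 B).
have volE : leb3 B = vol%:E by rewrite fineK// ge0_fin_numE.
have i0 : (0 <= \int[leb3]_(x in B) (gsq f x)%:E)%E.
  by apply: integral_ge0 => x _; rewrite lee_fin gsq_ge0.
have vol_ge0 : 0 <= vol by rewrite fine_ge0.
have cm (c : R) : continuous (fun x => (f x - c) ^+ 2).
  by apply: continuous_sqr => x; apply: cvgB; [exact: cf|exact: cvg_cst].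
(* If [vol] is 0, the left-hand side is an integral over a null set; otherwise [vol] can be
   cancelled. *)
have [v0|v0] := eqVneq vol 0.
  have B0 : leb3 B = 0%E by rewrite volE v0.
  rewrite (null_set_integral mB _ B0); first by rewrite mule_ge0// lee_fin mulr_ge0// sqr_ge0.
  by apply/measurable_EFinP; apply: measurable_funTS; exact: continuous_measurableR3.
have vol0 : 0 < vol by rewrite lt_neqAle eq_sym v0.
set M := ((8 * r ^+ 2)%:E * \int[leb3]_(x in B) (gsq f x)%:E)%E.
have M0 : (0 <= M)%E by rewrite mule_ge0// lee_fin mulr_ge0// sqr_ge0.
pose S1 x y := (f x - f (2^-1 *: (x + y))) ^+ 2.
pose F (z : R3 R * R3 R) : \bar R := (\1_B z.1 * \1_B z.2 * S1 z.1 z.2)%:E.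
have mhalf : measurable_fun setT (fun z : R3 R * R3 R => 2^-1 *: (z.1 + z.2) : R3 R).
  have -> : (fun z : R3 R * R3 R => 2^-1 *: (z.1 + z.2) : R3 R) = (fun z => 2^-1 *: z.1 + 2^-1 *: z.2).
    by apply/funext => z; rewrite scalerDr.
  by apply: (@measurable_affineR3 _ _ _ _ _ (fun=> 2^-1) (fun=> 2^-1)).
have mf := continuous_measurableR3 cf.
have mF : measurable_fun setT F.
  apply/measurable_EFinP; apply: measurable_funM.
    by apply: measurable_funM; apply: measurableT_comp => //; exact: measurable_indic.
  apply: measurable_funX; apply: measurable_funB; first exact: (measurableT_comp mf measurable_fst).
  exact: (measurableT_comp mf mhalf).
have ind0 A x : 0 <= \1_A x :> R by rewrite indicE.
have F0 z : (0 <= F z)%E.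
  by rewrite lee_fin; apply: mulr_ge0; [exact: mulr_ge0|exact: sqr_ge0].
(* [F] compares the value at its first variable with the value at the midpoint. [Fb] integrates over
   that variable, where [midpoint_le] applies, and by Tonelli [Fa] has the same total integral. *)
pose Fa x : \bar R := (\int[@lebm3 R]_y F (x, y))%E; pose Fb x : \bar R := (\int[@lebm3 R]_y F (y, x))%E.
have Fa0 x : (0 <= Fa x)%E by apply: integral_ge0.
have Fb0 x : (0 <= Fb x)%E by apply: integral_ge0.
have mFa : measurable_fun setT Fa := @measurable_fun_fubini_tonelli_F _ _ _ _ _ (@lebm3 R) F mF F0.
have mFb : measurable_fun setT Fb := @measurable_fun_fubini_tonelli_G _ _ _ _ _ (@lebm3 R) F mF F0.
have Fb_le x : (Fb x <= (\1_B x)%:E * M)%E.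
  rewrite /Fb indicE; case: (boolP (x \in B)) => xB; last first.
    by rewrite mul0e integral0_eq// => y _; rewrite /F/= [\1_B x]indicE (negbTE xB) mulr0 mul0r.
  rewrite mul1e; apply: le_trans (midpoint_le r0 sf (set_mem xB)).
  rewrite [leRHS]integral_indicM le_eqVlt; apply/orP; left; apply/eqP; apply: eq_integral => y _.
  by rewrite /F/= [\1_B x]indicE xB mulr1 -EFinM.
have Fbint : (\int[@lebm3 R]_x Fb x <= M * vol%:E)%E.
  apply: (@le_trans _ _ (\int[leb3]_x ((\1_B x)%:E * M))%E).
    apply: ge0_le_integral => //; apply: emeasurable_funM => //; apply/measurable_EFinP.
    exact: measurable_indic.
  rewrite -(@integral_indicM _ _ _ leb3 B (cst M)) integral_cst// volE//.
have Faint : (\int[@lebm3 R]_x Fa x <= M * vol%:E)%E by rewrite [leLHS](fubini_tonelli F mF F0).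
have key x : B x -> ((vol * (f x - bmean r f) ^+ 2)%:E <= 2%:E * (Fa x + Fb x))%E.
  move=> xB.
  have ch : continuous (fun y => f x - f y) by move=> y; apply: cvgB; [exact: cvg_cst|exact: cf].
  have ih := continuous_eball_integrable r ch.
  have e1 : vol * (f x - bmean r f) = \int[leb3]_(y in B) (f x - f y).
    have ic := continuous_eball_integrable r (fun y => @cst_continuous (R3 R) R (f x) y).
    have iff := continuous_eball_integrable r cf.
    rewrite (RintegralB mB ic iff) (Rintegral_cst _ mB) -/vol /bmean -/B -/vol mulrBr mulVKf// mulrC//.
  have h1 : ((vol ^+ 2 * (f x - bmean r f) ^+ 2)%:E <= vol%:E * \int[leb3]_(y in B) ((f x - f y) ^+ 2)%:E)%E.
    by rewrite -exprMn e1 -volE; exact: Rintegral_sqr_le.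
  have h2 : ((vol * (f x - bmean r f) ^+ 2)%:E <= \int[leb3]_(y in B) ((f x - f y) ^+ 2)%:E)%E.
    by rewrite -(@lee_pmul2l _ vol%:E)// -EFinM mulrA -expr2.
  have mF1 : measurable_fun setT (fun y => F (x, y)) := measurableT_comp mF (measurable_pair1 x).
  have mF2 : measurable_fun setT (fun y => F (y, x)) := measurableT_comp mF (measurable_pair2 x).
  have mF12 := emeasurable_funD mF1 mF2.
  have F12 y : (0 <= F (x, y) + F (y, x))%E := adde_ge0 (F0 _) (F0 _).
  have -> : (Fa x + Fb x = \int[@lebm3 R]_y (F (x, y) + F (y, x)))%E.
    exact/esym/(ge0_integralD (@lebm3 R) measurableT (fun y _ => F0 _) mF1 (fun y _ => F0 _) mF2).
  rewrite -(ge0_integralZl_EFin (@lebm3 R) measurableT (fun y _ => F12 y) mF12 (ler0n _ 2)).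
  apply: (le_trans h2); rewrite [leLHS]integral_indicM; apply: ge0_le_integral.
  - exact: measurableT.
  - by move=> y _; rewrite -EFinM lee_fin; apply: mulr_ge0; [exact: ind0|exact: sqr_ge0].
  - apply/measurable_EFinP; apply: measurable_funM; first exact: measurable_indic.
    by apply: continuous_measurableR3; exact: continuous_sqr.
  - exact: (measurable_funeM 2%:E mF12).
  move=> y _; rewrite /F/= -EFinM -EFinD -EFinM lee_fin [\1_B x]indicE (mem_set xB) mul1r mulr1 -mulrDr [leRHS]mulrCA.
  apply: ler_wpM2l; first by rewrite indicE.
  rewrite /S1 [y + x]addrC; set m := f (_ *: _).
  by rewrite -subr_ge0 [X in 0 <= X](_ : _ = (f x - m + (f y - m)) ^+ 2) ?sqr_ge0//; ring.
have cmb := cm (bmean r f).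
suff : (vol%:E * \int[leb3]_(x in B) ((f x - bmean r f) ^+ 2)%:E <= vol%:E * (4%:E * M))%E.
  rewrite lee_pmul2l// /M muleA -EFinM.
  by have -> : (4 * (8 * r ^+ 2) = 32 * r ^+ 2)%R by ring.
have mcB : measurable_fun B (fun x => ((f x - bmean r f) ^+ 2)%:E).
  by apply/measurable_EFinP; apply: measurable_funTS; exact: continuous_measurableR3.
have cB0 x : B x -> (0 <= ((f x - bmean r f) ^+ 2)%:E)%E by move=> _; rewrite lee_fin sqr_ge0.
have mFab := emeasurable_funD mFa mFb.
have Fab0 x : (0 <= Fa x + Fb x)%E := adde_ge0 (Fa0 x) (Fb0 x).
rewrite -(ge0_integralZl_EFin leb3 mB cB0 mcB vol_ge0).
apply: (@le_trans _ _ (\int[@lebm3 R]_x (2%:E * (Fa x + Fb x)))%E).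
  rewrite [leLHS]integral_indicM; apply: ge0_le_integral.
  - exact: measurableT.
  - by move=> x _; rewrite -!EFinM lee_fin; apply: mulr_ge0; [exact: ind0|apply: mulr_ge0 => //; exact: sqr_ge0].
  - apply/measurable_EFinP; apply: measurable_funM; first exact: measurable_indic.
    by apply: measurable_funM; [exact: measurable_cst|exact: continuous_measurableR3].
  - exact: (measurable_funeM 2%:E mFab).
  move=> x _; rewrite indicE; case: (boolP (x \in B)) => xB; last by rewrite mul0e mule_ge0// adde_ge0.
  by rewrite mul1e -EFinM; apply: key; exact: set_mem.
rewrite (ge0_integralZl_EFin (@lebm3 R) measurableT (fun x _ => Fab0 x) mFab (ler0n _ 2)).
rewrite (ge0_integralD (@lebm3 R) measurableT (fun x _ => Fa0 x) mFa (fun x _ => Fb0 x) mFb).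
apply: (@le_trans _ _ (2%:E * (M * vol%:E + M * vol%:E))%E).
  by apply: lee_wpmul2l; [rewrite lee_fin|exact: (leeD Faint Fbint)].
rewrite -mule2n -mule_natl muleA -EFinM [leRHS]muleCA [(vol%:E * M)%E]muleC.
by have -> : (2 * 2%:R = 4 :> R)%R by ring.
Qed.

End Poincare.

(** * The extension at the unit scale *)

Section CutoffProfile.
Context {R : realType}.

Lemma Dk_derive (c : R -> R) : (forall n, Dk n c) ->
  exists c1 : R -> R, (forall s : R, is_derive s 1 c (c1 s)) /\ forall n, Dk n c1.
Proof.
move=> Dc; have [g dg _] := Dc 1%N; exists g; split=> // n; have [g' dg' Dg'] := Dc n.+1.
suff -> : g = g' by [].
by apply/funext => s; have [_ <-] := dg s; have [_ <-] := dg' s.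
Qed.

Lemma is_derive_locally_cst (c : R -> R) (s l k : R) : is_derive s 1 c l ->
  (\forall t \near s, c t = k) -> l = 0.
Proof.
move=> [_ <-] ck; rewrite -[RHS](derive_cst k s (1 : R)).
by apply: near_eq_derive.
Qed.

(** A profile in the variable |x|^2. Two derivatives are needed: the first enters the gradient of
    chi, the second the gradient of the kernel. With the transition strictly between 1 and [th],
    both also vanish at these end points. *)
Lemma cutoff_profile (th : R) : 1 < th -> exists c c1 c2 : R -> R,
  [/\ (forall n, Dk n c) /\ (forall n, Dk n c1) /\ (forall n, Dk n c2),
    (forall s : R, is_derive s 1 c (c1 s)) /\ (forall s : R, is_derive s 1 c1 (c2 s)),
    (forall s, s <= 1 -> [/\ c s = 1, c1 s = 0 & c2 s = 0])
  & (forall s, th <= s -> [/\ c s = 0, c1 s = 0 & c2 s = 0])].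
Proof.
move=> th1; pose a := 1 + (th - 1) / 3; pose b := 1 + (th - 1) / 3 * 2.
have ab : a < b by rewrite /a /b; lra.
have a1 : 1 < a by rewrite /a; lra.
have bth : b < th by rewrite /b; lra.
have Dc n : Dk n (cutoff a b) := Dk_cutoff ab n.
have [c1 [d1 D1]] := Dk_derive Dc; have [c2 [d2 D2]] := Dk_derive D1.
have z1 s : s < a -> c1 s = 0.
  move=> sa; apply: (is_derive_locally_cst (k := 1) (d1 s)).
  near=> t; apply: cutoff_eq1 => //; apply: ltW; near: t; exact: lt_nbhsl.
have z2 s : b < s -> c1 s = 0.
  move=> sb; apply: (is_derive_locally_cst (k := 0) (d1 s)).
  near=> t; apply: cutoff_eq0 => //; apply: ltW; near: t; exact: lt_nbhsr.
exists (cutoff a b), c1, c2; split=> // s hs.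
  have sa := le_lt_trans hs a1; split; [by apply: cutoff_eq1 => //; exact: ltW|exact: z1|].
  apply: (is_derive_locally_cst (k := 0) (d2 s)).
  by near=> t; apply: z1; near: t; exact: lt_nbhsl.
have sb := lt_le_trans bth hs; split; [by apply: cutoff_eq0 => //; exact: ltW|exact: z2|].
apply: (is_derive_locally_cst (k := 0) (d2 s)).
by near=> t; apply: z2; near: t; exact: lt_nbhsr.
Unshelve. all: by end_near. Qed.

End CutoffProfile.

(* The pointwise identity behind [div_extu], with [X = x] and [P i j] the value
   at [x] of [pint 2] of the [i]-th derivative of [f j]. *)
Lemma div_algebra (R : realType) (X F d : 'I_3 -> R) (P : 'I_3 -> 'I_3 -> R) (c H H1 N : R) :
  N = \sum_(j < 3) X j ^+ 2 ->
  \sum_(i < 3) (c * d i + (2 * F i + \sum_(l < 3) X l * P l i) * (X i * H) +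
    \sum_(j < 3) (H * (N * (i == j)%:R - X i * X j) * P i j +
      F j * (X i * H1 * (N * (i == j)%:R - X i * X j) +
             H * (2 * X i * (i == j)%:R - (i == i)%:R * X j - X i * (i == j)%:R)))) =
  c * (\sum_(i < 3) d i) + H * N * \sum_(i < 3) P i i.
Proof.
rewrite sum3; set N' := (X in N = X) => ->.
under eq_bigr => i _ do rewrite 2!sum3.
rewrite !sum3.
rewrite ?eqxx /=.
rewrite /N'.
move: (X _) (X _) (X _) (F _) (F _) (F _) (d _) (d _) (d _) => x0 x1 x2 f0 f1 f2 d0 d1 d2.
do 9 move: (P _ _) => ?.
ring.
Qed.

Section UnitExtension.
Context {R : realType}.
Variables (chi h h1 : R3 R -> R).
Hypotheses (s_chi : smooth chi) (s_h : smooth h).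
Hypotheses (d_chi : forall j x, partial j chi x = coord x j * h x)
  (d_h : forall j x, partial j h x = coord x j * h1 x).
Implicit Types (f : 'I_3 -> R3 R -> R) (x : R3 R) (i j k l : 'I_3).

(** The matrix of the map sending F to grad chi cross (F cross x), where grad chi = h x. *)
Definition kern i j x : R := h x * (nsq x * (i == j)%:R - coord x i * coord x j).

Definition extu f i x : R := chi x * f i x + \sum_(j < 3) kern i j x * pint 1 (f j) x.

Let s_inner i j : smooth (fun x : R3 R => nsq x * (i == j)%:R - coord x i * coord x j).
Proof.
apply: smoothB; first by apply: smoothM; [exact: smooth_nsq|exact: smooth_cst].
by apply: smoothM; exact: smooth_coord.
Qed.

Lemma smooth_kern i j : smooth (kern i j).
Proof. exact: (smoothM s_h (s_inner i j)). Qed.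

Lemma partial_kern k i j x : partial k (kern i j) x =
  coord x k * h1 x * (nsq x * (i == j)%:R - coord x i * coord x j) +
  h x * (2 * coord x k * (i == j)%:R - (k == i)%:R * coord x j - coord x i * (k == j)%:R).
Proof.
have sc i' := @smooth_coord R i'.
have s1 : smooth (fun x : R3 R => nsq x * (i == j)%:R).
  by apply: smoothM; [exact: smooth_nsq|exact: smooth_cst].
rewrite /kern (partialM _ _ s_h (s_inner i j)) d_h (partialB _ _ s1 (smoothM (sc i) (sc j))).
rewrite (partialM _ _ (sc i) (sc j)) !partial_coord (partialM _ _ smooth_nsq (smooth_cst _)).
by rewrite partial_nsq partial_cst; ring.
Qed.

Lemma smooth_extu f i : (forall j, smooth (f j)) -> smooth (extu f i).
Proof.
move=> sf; apply: (smoothD (smoothM s_chi (sf i))).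
by apply: smooth_sum => j; exact: (smoothM (smooth_kern i j) (smooth_pint 1 (sf j))).
Qed.

Lemma extuB f (g : 'I_3 -> R3 R -> R) i x : (forall j, smooth (f j)) -> (forall j, smooth (g j)) ->
  extu (fun j y => f j y - g j y) i x = extu f i x - extu g i x.
Proof.
move=> sf sg; rewrite /extu.
have pE j : kern i j x * pint 1 (fun y => f j y - g j y) x =
    kern i j x * pint 1 (f j) x - kern i j x * pint 1 (g j) x.
  have cf := smooth_continuous (sf j); have cg := smooth_continuous (sg j).
  rewrite -mulrBr; congr (_ * _); rewrite /pint -uintB; [|exact: pint_integrand_continuous..].
  by apply: eq_uint => t _; exact: mulrBr.
rewrite (eq_bigr _ (fun j _ => pE j)) sumrB; move: (\sum_j _) (\sum_j _) => a b; ring.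
Qed.

Lemma partial_extu f k i x : (forall j, smooth (f j)) -> partial k (extu f i) x =
  chi x * partial k (f i) x + f i x * (coord x k * h x) +
  \sum_(j < 3) (kern i j x * pint 2 (partial k (f j)) x + pint 1 (f j) x * partial k (kern i j) x).
Proof.
move=> sf; have sF j : smooth (fun x => kern i j x * pint 1 (f j) x).
  exact: (smoothM (smooth_kern i j) (smooth_pint 1 (sf j))).
rewrite /extu (partialD k x (smoothM s_chi (sf i)) (smooth_sum _ sF)).
rewrite (partialM k x s_chi (sf i)) d_chi (partial_sum _ k x sF); congr (_ + _); apply: eq_bigr => j _.
by rewrite (partialM k x (smooth_kern i j) (smooth_pint 1 (sf j))) (partial_pint 1 k x (sf j)).
Qed.

(** Euler's relation solved for F_j. Since [pint_L2_le] handles averages of weight 2, F_j is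
    estimated through [f j] and such averages of its gradient. *)
Lemma pint1E f j x : smooth (f j) -> pint 1 (f j) x =
  2^-1 * (f j x - \sum_(l < 3) coord x l * pint 2 (partial l (f j)) x).
Proof.
move=> sf; have := pint_euler 1 x sf.
under eq_bigr do rewrite partial_pint//.
by move=> <-; rewrite addrK mulKf.
Qed.

(* The radial terms cancel because [2 F_j + x . grad F_j = f_j]. *)
Lemma div_extu f x : (forall j, smooth (f j)) ->
  \sum_(i < 3) partial i (extu f i) x =
  chi x * (\sum_(i < 3) partial i (f i) x) + h x * nsq x * pint 2 (fun y => \sum_(i < 3) partial i (f i) y) x.
Proof.
move=> sf; under eq_bigr do rewrite partial_extu//.
have cp i : continuous (partial i (f i)) := smooth_continuous (smooth_partial i (sf i)).
have -> : pint 2 (fun y => \sum_(i < 3) partial i (f i) y) x = \sum_(i < 3) pint 2 (partial i (f i)) x.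
  under [in LHS]eq_fun do rewrite sum3.
  rewrite (pintD 2 x _ (cp _)); first by rewrite (pintD 2 x (cp _) (cp _)) sum3.
  by move=> y; apply: cvgD; exact: cp.
have E j : f j x = 2 * pint 1 (f j) x + \sum_(l < 3) coord x l * pint 2 (partial l (f j)) x.
  by rewrite (pint1E x (sf j)); move: (\sum_l _) (f j x) => a b; field.
under eq_bigr => i _ do rewrite [in X in _ + X + _]E.
under eq_bigr => i _ do under [X in _ + X]eq_bigr => j _ do rewrite partial_kern /kern.
exact: (@div_algebra R (fun j => coord x j) (fun j => pint 1 (f j) x) (fun i => partial i (f i) x)
  (fun i j => pint 2 (partial i (f j)) x) (chi x) (h x) (h1 x) (nsq x) erefl).
Qed.

Lemma partial_extu_eq f k i x : (forall j, smooth (f j)) -> chi x = 1 -> h x = 0 -> h1 x = 0 ->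
  partial k (extu f i) x = partial k (f i) x.
Proof.
move=> sf c0 h0 h10; rewrite (partial_extu _ _ _ sf) c0 h0 mul1r !mulr0 addr0 big1 ?addr0// => j _.
by rewrite partial_kern /kern h0 h10 !(mul0r, mulr0, addr0).
Qed.

Lemma extu_out f i x : chi x = 0 -> h x = 0 -> extu f i x = 0.
Proof.
by move=> c0 h0; rewrite /extu c0 mul0r add0r big1// => j _; rewrite /kern h0 !mul0r.
Qed.

Lemma partial_extu_out f k i x : (forall j, smooth (f j)) -> chi x = 0 -> h x = 0 -> h1 x = 0 ->
  partial k (extu f i) x = 0.
Proof.
move=> sf c0 h0 h10; rewrite (partial_extu _ _ _ sf) c0 h0 mul0r !mulr0 addr0 add0r big1// => j _.
by rewrite partial_kern /kern h0 h10 !(mul0r, mulr0, addr0).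
Qed.

Definition extS f x : R := \sum_(j < 3) `|f j x| + \sum_(j < 3) \sum_(l < 3) `|partial l (f j) x| +
  \sum_(j < 3) \sum_(l < 3) `|pint 2 (partial l (f j)) x|.

(** Every coefficient in [partial_extu] is continuous, hence bounded on the box; the constant thus
    depends on the cutoff and on [M] but not on [f]. *)
Lemma partial_extu_le (M : R) : exists2 K : R, 0 <= K & forall f k i x, (forall j, smooth (f j)) ->
  `|x| <= M -> `|partial k (extu f i) x| <= K * extS f x.
Proof.
have bd (T : finType) (F : T -> R3 R -> R) : (forall t, continuous (F t)) ->
    exists2 K : R, 0 <= K & forall t x, `|x| <= M -> `|F t x| <= K.
  move=> cF; have /choice[K KP] t : exists K : R, 0 <= K /\ forall x, `|x| <= M -> `|F t x| <= K.
    by have [K K0 KP] := continuous_bounded M (cF t); exists K.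
  exists (\sum_t K t) => [|t x xM]; first by apply: sumr_ge0 => t _; exact: (KP t).1.
  apply: le_trans ((KP t).2 x xM) _; rewrite (bigD1 t)//= lerDl sumr_ge0// => t' _; exact: (KP t').1.
have [K1 K10 B1] := continuous_bounded M (smooth_continuous s_chi).
have [K2 K20 B2] := bd _ (fun k x => coord x k * h x)
  (fun k => smooth_continuous (smoothM (smooth_coord k) s_h)).
have [K3 K30 B3] := bd ('I_3 * 'I_3)%type (fun p => kern p.1 p.2)
  (fun p => smooth_continuous (smooth_kern p.1 p.2)).
have [K4 K40 B4] := bd ('I_3 * 'I_3 * 'I_3)%type (fun p => partial p.2 (kern p.1.1 p.1.2))
  (fun p => smooth_continuous (smooth_partial p.2 (smooth_kern p.1.1 p.1.2))).
have [K5 K50 B5] := bd 'I_3 (fun j x => coord x j) (fun j => smooth_continuous (smooth_coord j)).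
(* Bounds F_j through [pint1E]: half of one term [f j] plus three terms with coordinates bounded by
   [K5]. *)
pose KF := 2^-1 * (1 + 3 * K5).
have KF0 : 0 <= KF by rewrite mulr_ge0 ?invr_ge0// addr_ge0// mulr_ge0.
exists (K1 + K2 + 3 * (K3 + KF * K4)).
  by rewrite !addr_ge0// mulr_ge0// addr_ge0// mulr_ge0.
move=> f k i x sf xM; set S := extS f x.
have S1 j : `|f j x| <= S.
  rewrite /S /extS (bigD1 j)//= -!addrA lerDl; do 3 ?apply: addr_ge0.
  - by apply: sumr_ge0.
  - by apply: sumr_ge0 => j' _; apply: sumr_ge0.
  - by apply: sumr_ge0 => j' _; apply: sumr_ge0.
have S2 j l : `|partial l (f j) x| <= S.
  rewrite /S /extS [X in _ + X + _](bigD1 j)//= [X in _ + (X + _) + _](bigD1 l)//=.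
  rewrite -!addrA addrCA lerDl; do 4 ?apply: addr_ge0; try by apply: sumr_ge0.
  - by apply: sumr_ge0 => j' _; apply: sumr_ge0.
  - by apply: sumr_ge0 => j' _; apply: sumr_ge0.
have S3 j l : `|pint 2 (partial l (f j)) x| <= S.
  rewrite /S /extS [X in _ + _ + X](bigD1 j)//= [X in _ + _ + (X + _)](bigD1 l)//=.
  rewrite [leRHS]addrC -!addrA lerDl; do 4 ?apply: addr_ge0; try by apply: sumr_ge0.
  - by apply: sumr_ge0 => j' _; apply: sumr_ge0.
  - by apply: sumr_ge0 => j' _; apply: sumr_ge0.
have S0 : 0 <= S := le_trans (normr_ge0 _) (S1 i).
have SF j : `|pint 1 (f j) x| <= KF * S.
  rewrite (pint1E x (sf j)) normrM ger0_norm ?invr_ge0// /KF -mulrA; apply: ler_wpM2l; first by rewrite invr_ge0.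
  apply: le_trans (ler_normB _ _) _; rewrite mulrDl mul1r; apply: lerD; first exact: S1.
  apply: le_trans (ler_norm_sum _ _ _) _.
  apply: (@le_trans _ _ (\sum_(l < 3) K5 * S)); last by rewrite sum3; lra.
  by apply: ler_sum => l _; rewrite normrM; apply: ler_pM => //; exact: B5.
rewrite (partial_extu _ _ _ sf) !mulrDl; apply: le_trans (ler_normD _ _) _; apply: lerD.
  apply: le_trans (ler_normD _ _) _; apply: lerD; rewrite normrM.
    by apply: ler_pM => //; exact: B1.
  by rewrite mulrC; apply: ler_pM => //; exact: B2.
apply: le_trans (ler_norm_sum _ _ _) _.
apply: (@le_trans _ _ (\sum_(j < 3) (K3 * S + KF * S * K4))); last by rewrite sum3; lra.
apply: ler_sum => j _; apply: le_trans (ler_normD _ _) _; rewrite [X in X + _ <= _]normrM [X in _ + X <= _]normrM; apply: lerD.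
  by apply: ler_pM => //; exact: (B3 (i, j)).
by apply: ler_pM => //; exact: (B4 (i, j, k)).
Qed.

End UnitExtension.

Section UnitExtensionBounds.
Context {R : realType}.
Implicit Types (f g : 'I_3 -> R3 R -> R) (x : R3 R) (i j k l : 'I_3) (r th : R).

Definition fgsq f x : R := \sum_(i < 3) gsq (f i) x.
Definition fdiv f x : R := \sum_(i < 3) partial i (f i) x.

Lemma fgsq_ge0 f x : 0 <= fgsq f x.
Proof. by apply: sumr_ge0 => i _; exact: gsq_ge0. Qed.

Lemma continuous_fgsq f : (forall j, smooth (f j)) -> continuous (fgsq f).
Proof. by move=> sf; apply: continuous_sum3 => j; exact: continuous_gsq. Qed.

Lemma smooth_fdiv f : (forall j, smooth (f j)) -> smooth (fdiv f).
Proof. by move=> sf; apply: smooth_sum => j; exact: (smooth_partial j (sf j)). Qed.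

Lemma sqr_sum3_le (a : 'I_3 -> R) : (\sum_(j < 3) a j) ^+ 2 <= 3 * \sum_(j < 3) a j ^+ 2.
Proof.
have := cauchy_schwarz3 a (fun=> 1); under eq_bigr do rewrite mulr1.
by rewrite [X in _ <= _ * X]sum3 !expr1n mulrC => /le_trans; apply; lra.
Qed.

(** The constant is 3, for the three groups of terms in [extS], times 9, for the entries of a double
    sum. *)
Lemma extS_sqr_le f x : extS f x ^+ 2 <= 27 * (\sum_(j < 3) f j x ^+ 2 + fgsq f x +
  \sum_(j < 3) \sum_(l < 3) pint 2 (partial l (f j)) x ^+ 2).
Proof.
have dbl (a : 'I_3 -> 'I_3 -> R) : (\sum_(j < 3) \sum_(l < 3) `|a j l|) ^+ 2 <=
    9 * \sum_(j < 3) \sum_(l < 3) a j l ^+ 2.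
  apply: le_trans (sqr_sum3_le _) _; rewrite (_ : 9 = 3 * 3) -?mulrA; last by ring.
  rewrite ler_wpM2l// mulr_sumr; apply: ler_sum => j _; apply: le_trans (sqr_sum3_le _) _.
  by rewrite le_eqVlt; apply/orP; left; apply/eqP; congr (_ * _); apply: eq_bigr => l _; rewrite real_normK ?num_real.
have h1 : (\sum_(j < 3) `|f j x|) ^+ 2 <= 3 * \sum_(j < 3) f j x ^+ 2.
  apply: le_trans (sqr_sum3_le _) _.
  by rewrite le_eqVlt; apply/orP; left; apply/eqP; congr (_ * _); apply: eq_bigr => l _; rewrite real_normK ?num_real.
have h2 := dbl (fun j l => partial l (f j) x); have h3 := dbl (fun j l => pint 2 (partial l (f j)) x).
rewrite /extS; move: h1 h2 h3; rewrite -/(fgsq f x).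
move: (\sum_j `|_|) (\sum_j \sum_l `|_|) (\sum_j \sum_l `|_|) => a b c.
have p0 : 0 <= \sum_(j < 3) f j x ^+ 2 by apply: sumr_ge0 => j _; exact: sqr_ge0.
have := fgsq_ge0 f x; move: p0; rewrite /fgsq /gsq.
move: (\sum_j _) (\sum_j _) (\sum_j _) => p q t p0 q0 h1 h2 h3.
have := sqr_ge0 (a - b); have := sqr_ge0 (a - c); have := sqr_ge0 (b - c).
rewrite !expr2 in h1 h2 h3 *; lra.
Qed.

Let ibs r (F : R3 R -> R) : \bar R := (\int[leb3]_(x in eball 0%R r) (F x)%:E)%E.

Let mc r (F : R3 R -> R) : continuous F -> measurable_fun (eball 0 r) (EFin \o F).
Proof. by move=> cF; apply/measurable_EFinP; apply: measurable_funTS; exact: continuous_measurableR3. Qed.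

Let ibs_ge0 r (F : R3 R -> R) : (forall x, 0 <= F x) -> (0 <= ibs r F)%E.
Proof. by move=> F0; apply: integral_ge0 => x _; rewrite lee_fin. Qed.

Let ibs_le r (F G : R3 R -> R) : continuous F -> continuous G -> (forall x, 0 <= F x) ->
  (forall x, eball 0 r x -> F x <= G x) -> (ibs r F <= ibs r G)%E.
Proof.
move=> cF cG F0 FG; apply: ge0_le_integral.
- exact: measurable_eball.
- by move=> x _; rewrite lee_fin.
- exact: mc.
- exact: mc.
- by move=> x xB; rewrite lee_fin FG.
Qed.

Let ibsD r (F G : R3 R -> R) : continuous F -> continuous G -> (forall x, 0 <= F x) -> (forall x, 0 <= G x) ->
  ibs r (fun x => F x + G x) = (ibs r F + ibs r G)%E.
Proof.
move=> cF cG F0 G0; rewrite /ibs; under eq_integral do rewrite EFinD.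
apply: ge0_integralD.
- exact: measurable_eball.
- by move=> x _; rewrite lee_fin.
- exact: mc.
- by move=> x _; rewrite lee_fin.
- exact: mc.
Qed.

Let ibs_sum r (F : 'I_3 -> R3 R -> R) : (forall i, continuous (F i)) -> (forall i x, 0 <= F i x) ->
  ibs r (fun x => \sum_(i < 3) F i x) = (\sum_(i < 3) ibs r (F i))%E.
Proof.
move=> cF F0; rewrite /ibs; under eq_integral do rewrite -sumEFin.
apply: ge0_integral_sum.
- exact: measurable_eball.
- by move=> i; exact: mc.
- by move=> i x _; rewrite lee_fin.
Qed.

Let ibsZ r (c : R) (F : R3 R -> R) : 0 <= c -> continuous F -> (forall x, 0 <= F x) ->
  ibs r (fun x => c * F x) = (c%:E * ibs r F)%E.
Proof.
move=> c0 cF F0; rewrite /ibs; under eq_integral do rewrite EFinM.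
apply: ge0_integralZl_EFin => //.
- exact: measurable_eball.
- by move=> x _; rewrite lee_fin.
- exact: mc.
Qed.

Let ibs_out r (F : R3 R -> R) : 0 < r -> (forall x, r ^+ 2 <= nsq x -> F x = 0) -> (\int[leb3]_x (F x)%:E = ibs r F)%E.
Proof.
move=> r0 Fout; rewrite /ibs [RHS]integral_indicM; apply: eq_integral => x _; rewrite indicE.
case: (boolP (x \in _)); first by rewrite mul1e.
rewrite notin_setE => xB; rewrite mul0e Fout// leNgt; apply/negP => h; apply: xB.
by apply/eballP => //; rewrite subr0.
Qed.

(** [extu] is applied to [f] minus its mean: no derivative changes, and Poincare's inequality bounds
    the terms of order zero by the gradient. Compatibility with differences is what makes images of
    Cauchy sequences Cauchy. *)
Lemma unit_extension th : 1 < th -> exists (C : R) (E : ('I_3 -> R3 R -> R) -> 'I_3 -> R3 R -> R), [/\ 0 < C,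
  forall f g, (forall j, smooth (f j)) -> (forall j, smooth (g j)) ->
    forall i x, E (fun j y => f j y - g j y) i x = E f i x - E g i x &
  forall f, (forall j, smooth (f j)) -> [/\ forall i, smooth (E f i) /\ bsupp (E f i),
    forall i k x, nsq x <= 1 -> partial k (E f i) x = partial k (f i) x,
    forall i k x, th ^+ 2 <= nsq x -> partial k (E f i) x = 0,
    (\int[leb3]_x (fgsq (E f) x)%:E <= C%:E * \int[leb3]_(x in eball 0%R th) (fgsq f x)%:E)%E
  & (\int[leb3]_x (fdiv (E f) x ^+ 2)%:E <= C%:E * \int[leb3]_(x in eball 0%R th) (fdiv f x ^+ 2)%:E)%E]].
Proof.
move=> th1; have th0 : 0 < th := lt_trans ltr01 th1.
have th2 : 1 < th ^+ 2 by rewrite exprn_egt1.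
(* The profile is evaluated at [nsq x], so the outer threshold is [th ^+ 2]; the factors 2 and 4
   below come from the gradient 2x of [nsq]. *)
have [c [c1 [c2 [[Dc [Dc1 Dc2]] [dc dc1] cin cout]]]] := cutoff_profile th2.
pose chi (x : R3 R) := c (nsq x); pose h (x : R3 R) := 2 * c1 (nsq x); pose h1 (x : R3 R) := 4 * c2 (nsq x).
have s_chi : smooth chi := smooth_comp Dc (@smooth_nsq R).
have s_c1 : smooth (c1 \o @nsq R) := smooth_comp Dc1 (@smooth_nsq R).
have s_h : smooth h := smoothZ 2 s_c1.
have d_chi j x : partial j chi x = coord x j * h x.
  by rewrite /chi (partial_comp j x dc (@smooth_nsq R)) partial_nsq /h; ring.
have d_h j x : partial j h x = coord x j * h1 x.
  rewrite /h (partialZ 2 j x s_c1) (partial_comp j x dc1 (@smooth_nsq R)) partial_nsq /h1; ring.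
have in1 x : nsq x <= 1 -> [/\ chi x = 1, h x = 0 & h1 x = 0].
  by move=> /cin[e1 e2 e3]; rewrite /chi /h /h1 e1 e2 e3 !mulr0.
have out0 x : th ^+ 2 <= nsq x -> [/\ chi x = 0, h x = 0 & h1 x = 0].
  by move=> /cout[e1 e2 e3]; rewrite /chi /h /h1 e1 e2 e3 !mulr0.
have [K K0 KP] := partial_extu_le s_chi s_h d_chi th.
have [K1 K10 KP1] := continuous_bounded th (smooth_continuous s_chi).
have [K2 K20 KP2] := continuous_bounded th (smooth_continuous (smoothM s_h (@smooth_nsq R))).
pose ctr f j y := f j y - bmean th (f j).
have sctr f : (forall j, smooth (f j)) -> forall j, smooth (ctr f j).
  by move=> sf j; exact: (smoothB (sf j) (smooth_cst _)).
have dctr f : (forall j, smooth (f j)) -> forall j k x, partial k (ctr f j) x = partial k (f j) x.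
  by move=> sf j k x; rewrite (partialB k x (sf j) (smooth_cst _)) partial_cst subr0.
(* 9 entries of the gradient, [K ^+ 2] from [partial_extu_le], 27 from [extS_sqr_le]; then
   [32 * th ^+ 2] for the field by Poincare, and 1 each for its gradient and for the ray averages of
   its gradient. [C2] comes from the two coefficients in [div_extu]. *)
pose C1 := 9 * K ^+ 2 * 27 * (32 * th ^+ 2 + 2); pose C2 := 2 * (K1 ^+ 2 + K2 ^+ 2).
have C10 : 0 <= C1 by rewrite !mulr_ge0 ?sqr_ge0// addr_ge0// mulr_ge0// sqr_ge0.
have C20 : 0 <= C2 by rewrite mulr_ge0// addr_ge0 ?sqr_ge0.
(* [C2] is doubled because the divergence and its ray average are bounded by the same integral; the
   added 1 ensures positivity. *)
exists (C1 + 2 * C2 + 1), (fun f => extu chi h (ctr f)); split.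
- by rewrite ltr_wpDl// addr_ge0// mulr_ge0.
- move=> f g sf sg i x; rewrite -(extuB chi h i x (sctr f sf) (sctr g sg)).
  congr (extu chi h _ i x); apply/funext => j; apply/funext => y; rewrite /ctr.
  have i1 := continuous_eball_integrable th (smooth_continuous (sf j)).
  have i2 := continuous_eball_integrable th (smooth_continuous (sg j)).
  rewrite /bmean (RintegralB (measurable_eball _ _) i1 i2) mulrBr.
  by move: (f j y) (g j y) (_ * _) (_ * _) => p q s t; ring.
move=> f sf; have sc := sctr f sf; have su i := smooth_extu s_chi s_h i sc.
set u := extu chi h (ctr f) in su *.
have dout i k x : th ^+ 2 <= nsq x -> partial k (u i) x = 0.
  by move=> /out0[e1 e2 e3]; exact: (partial_extu_out s_chi s_h d_chi d_h k i sc e1 e2 e3).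
have xbox x : eball 0 th x -> `|x| <= th by exact: eball_box.
have cD : continuous (fdiv f) := smooth_continuous (smooth_fdiv sf).
split.
- move=> i; split; first exact: su.
  exists th => x xM; have [|e1 e2 _] := out0 x; last exact: (extu_out _ _ e1 e2).
  rewrite leNgt; apply/negP => /nsq_norm/(_ th0); by rewrite leNgt xM.
- move=> i k x /in1[e1 e2 e3].
  by rewrite (partial_extu_eq s_chi s_h d_chi d_h k i sc e1 e2 e3) dctr.
- exact: dout.
- pose Q x := \sum_(j < 3) ctr f j x ^+ 2 + fgsq f x +
    \sum_(j < 3) \sum_(l < 3) pint 2 (partial l (f j)) x ^+ 2.
  have cQ1 j : continuous (fun x => ctr f j x ^+ 2) := continuous_sqr (smooth_continuous (sc j)).
  have cQ3 j l : continuous (fun x => pint 2 (partial l (f j)) x ^+ 2).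
    exact: (continuous_sqr (smooth_continuous (smooth_pint 2 (smooth_partial l (sf j))))).
  have cG := continuous_fgsq sf.
  have cS1 := continuous_sum3 cQ1; have cS3 := continuous_sum3 (fun j => continuous_sum3 (cQ3 j)).
  have S10 x : 0 <= \sum_(j < 3) ctr f j x ^+ 2 by apply: sumr_ge0 => j _; exact: sqr_ge0.
  have S30 x : 0 <= \sum_(j < 3) \sum_(l < 3) pint 2 (partial l (f j)) x ^+ 2.
    by apply: sumr_ge0 => j _; apply: sumr_ge0 => l _; exact: sqr_ge0.
  have c12 : continuous (fun x => \sum_(j < 3) ctr f j x ^+ 2 + fgsq f x).
    by move=> x; apply: cvgD; [exact: cS1|exact: cG].
  have cQ : continuous Q by move=> x; apply: cvgD; [exact: c12|exact: cS3].
  have Q0 x : 0 <= Q x by rewrite /Q !addr_ge0// fgsq_ge0.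
  have eG x : fgsq (ctr f) x = fgsq f x.
    by apply: eq_bigr => j _; apply: eq_bigr => l _; rewrite (dctr f sf).
  have eP x : \sum_(j < 3) \sum_(l < 3) pint 2 (partial l (ctr f j)) x ^+ 2 =
      \sum_(j < 3) \sum_(l < 3) pint 2 (partial l (f j)) x ^+ 2.
    apply: eq_bigr => j _; apply: eq_bigr => l _; rewrite (_ : partial l (ctr f j) = partial l (f j))//.
    by apply/funext => y; exact: (dctr f sf).
  have pw x : eball 0 th x -> fgsq u x <= 9 * K ^+ 2 * 27 * Q x.
    move=> /xbox xM; have b i k : partial k (u i) x ^+ 2 <= K ^+ 2 * (27 * Q x).
      rewrite -[leLHS]real_normK ?num_real//.
      apply: (@le_trans _ _ ((K * extS (ctr f) x) ^+ 2)).
        have h0 := KP _ k i x sc xM.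
        by rewrite ler_pXn2r ?nnegrE// (le_trans _ h0).
      rewrite exprMn ler_wpM2l ?sqr_ge0//; apply: le_trans (extS_sqr_le _ _) _.
      by rewrite eG eP.
    rewrite /fgsq /gsq; apply: (@le_trans _ _ (\sum_(i < 3) \sum_(k < 3) K ^+ 2 * (27 * Q x))).
      by apply: ler_sum => i _; apply: ler_sum => k _; exact: b.
    by rewrite !sum3; move: (Q x) (K ^+ 2) => a b'; lra.
  rewrite (ibs_out (r := th) th0); last first.
    by move=> x xo; rewrite /fgsq big1// => i _; rewrite /gsq big1// => k _; rewrite dout// expr0n.
  have k0 : 0 <= 9 * K ^+ 2 * 27 by rewrite !mulr_ge0// sqr_ge0.
  have cKQ : continuous (fun x => 9 * K ^+ 2 * 27 * Q x) by move=> x; apply: cvgMr; exact: cQ.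
  apply: (le_trans (ibs_le (continuous_fgsq su) cKQ (fgsq_ge0 u) pw)).
  rewrite (ibsZ th k0 cQ Q0).
  apply: (@le_trans _ _ (C1%:E * ibs th (fgsq f))%E); last first.
    rewrite lee_wpmul2r//; first exact: (ibs_ge0 _ (fgsq_ge0 f)).
    by rewrite lee_fin -addrA lerDl addr_ge0// mulr_ge0.
  rewrite /C1; move: (9 * K ^+ 2 * 27) k0 => kk k0.
  rewrite EFinM -muleA; have k0E : (0 <= kk%:E)%E by rewrite lee_fin.
  suff H : (ibs th Q <= (32 * th ^+ 2 + 2)%:E * ibs th (fgsq f))%E by exact: (lee_wpmul2l k0E H).
  rewrite (ibsD th c12 cS3 _ S30); last by move=> x; rewrite addr_ge0// fgsq_ge0.
  rewrite (ibsD th cS1 cG S10 (fgsq_ge0 f)) (ibs_sum th cQ1); last by move=> j x; exact: sqr_ge0.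
  rewrite (ibs_sum th (fun j => continuous_sum3 (cQ3 j))); last first.
    by move=> j x; apply: sumr_ge0 => l _; exact: sqr_ge0.
  have cg j := continuous_gsq (sf j).
  have e0 : ibs th (fgsq f) = (\sum_(j < 3) ibs th (gsq (f j)))%E.
    by rewrite /fgsq (ibs_sum th cg)// => j x; exact: gsq_ge0.
  have f0 := ibs_ge0 th (fgsq_ge0 f).
  have -> : (32 * th ^+ 2 + 2 = 32 * th ^+ 2 + 1 + 1)%R by ring.
  have q0 : (0 <= (32 * th ^+ 2)%:E)%E by rewrite lee_fin mulr_ge0// sqr_ge0.
  rewrite !EFinD ge0_muleDl ?mul1e//; last by rewrite adde_ge0.
  rewrite ge0_muleDl ?mul1e//; apply: leeD; first apply: leeD => //.
    rewrite e0 ge0_sume_distrr; last by move=> j _; apply: ibs_ge0; exact: gsq_ge0.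
    by apply: lee_sum => j _; exact: (poincare th0 (sf j)).
  rewrite e0; apply: lee_sum => j _; rewrite (ibs_sum th (cQ3 j)); last first.
    by move=> l x; exact: sqr_ge0.
  have cp2 l : continuous (fun x => partial l (f j) x ^+ 2).
    exact: (continuous_sqr (smooth_continuous (smooth_partial l (sf j)))).
  rewrite /gsq (ibs_sum th cp2); last by move=> l x; exact: sqr_ge0.
  by apply: lee_sum => l _; exact: (pint_L2_le th (smooth_partial l (sf j))).
- rewrite (ibs_out (r := th) th0); last first.
  by move=> x xo; rewrite /fdiv big1 ?expr0n// => i _; exact: dout.
have sP := smooth_pint 2 (smooth_fdiv sf).
have cD2 := continuous_sqr cD; have cP2 := continuous_sqr (smooth_continuous sP).
have cDP : continuous (fun x => fdiv f x ^+ 2 + pint 2 (fdiv f) x ^+ 2).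
  by move=> x; apply: cvgD; [exact: cD2|exact: cP2].
have cC : continuous (fun x => C2 * (fdiv f x ^+ 2 + pint 2 (fdiv f) x ^+ 2)).
  by move=> x; apply: cvgMr; exact: cDP.
have DP0 x : 0 <= fdiv f x ^+ 2 + pint 2 (fdiv f) x ^+ 2 by rewrite addr_ge0// sqr_ge0.
apply: (le_trans (ibs_le (r := th) (continuous_sqr (smooth_continuous (smooth_fdiv su))) cC _ _)).
- by move=> x; exact: sqr_ge0.
- move=> x /xbox xM.
  have -> : fdiv u x = chi x * fdiv f x + h x * nsq x * pint 2 (fdiv f) x.
    rewrite /fdiv /u (div_extu s_chi s_h d_chi d_h x sc); congr (_ * _ + _ * pint 2 _ x).
      by apply: eq_bigr => i _; exact: dctr.
    by apply/funext => y; apply: eq_bigr => i _; exact: dctr.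
  have b1 : chi x ^+ 2 <= K1 ^+ 2.
    by rewrite -[leLHS]real_normK ?num_real// ler_pXn2r ?nnegrE//; exact: KP1.
  have b2 : (h x * nsq x) ^+ 2 <= K2 ^+ 2.
    by rewrite -[leLHS]real_normK ?num_real// ler_pXn2r ?nnegrE//; exact: KP2.
  move: b1 b2; rewrite /C2; move: (chi x) (h x * nsq x) (fdiv f x) (pint 2 (fdiv f) x) => a b D P b1 b2.
  apply: (@le_trans _ _ (2 * (a ^+ 2 * D ^+ 2 + b ^+ 2 * P ^+ 2))).
    rewrite -subr_ge0 [X in 0 <= X](_ : _ = (a * D - b * P) ^+ 2) ?sqr_ge0//; ring.
  rewrite -mulrA ler_wpM2l//; have D0 := sqr_ge0 D; have P0 := sqr_ge0 P.
  have k1 := sqr_ge0 K1; have k2 := sqr_ge0 K2.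
  have m1 := ler_wpM2r D0 b1; have m2 := ler_wpM2r P0 b2.
  have m3 := mulr_ge0 k1 P0; have m4 := mulr_ge0 k2 D0.
  by rewrite mulrDl !mulrDr; lra.
rewrite (ibsZ th C20 cDP DP0) (ibsD th cD2 cP2); [|by move=> x; exact: sqr_ge0|by move=> x; exact: sqr_ge0].
set Y := ibs th (fun x => fdiv f x ^+ 2).
have Y0 : (0 <= Y)%E by apply: ibs_ge0 => x; exact: sqr_ge0.
apply: (@le_trans _ _ (C2%:E * (Y + Y))%E).
  have C2E : (0 <= C2%:E)%E by rewrite lee_fin.
  by apply: (lee_wpmul2l C2E); apply: leeD2l; exact: (pint_L2_le th (smooth_fdiv sf)).
rewrite -mule2n -mule_natl muleA -EFinM; apply: lee_wpmul2r => //.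
rewrite lee_fin; move: C10 C20 => ? ?; lra.
Qed.

End UnitExtensionBounds.

(** * Rescaling to an arbitrary ball and passage to the limit *)

Section Scaling.
Context {R : realType}.
Implicit Types (f g : R3 R -> R) (x a X : R3 R) (i j k : 'I_3) (r th rho : R).

Lemma is_derive_scaled f a r j x : Ck 1 f ->
  is_derive x (basis j) (fun y => f (a + r *: y)) (r * partial j f (a + r *: x)).
Proof.
move=> Cf; have := is_derive_dir (a + r *: x) (r *: basis j) Cf.
have -> : \sum_(i < 3) coord (r *: basis j) i * partial i f (a + r *: x) = r * partial j f (a + r *: x).
  rewrite (bigD1 j)//= big1 ?addr0 => [|i ij]; rewrite coordZ coord_basis.
    by rewrite eqxx mulr1.
  by rewrite eq_sym (negbTE ij) mulr0 mul0r.
have E : (fun h : R => h^-1 *: (f (h *: (r *: basis j) + (a + r *: x)) - f (a + r *: x))) =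
         (fun h : R => h^-1 *: (f (a + r *: (h *: basis j + x)) - f (a + r *: x))).
  apply/funext => h; congr (_ *: (f _ - _)).
  by rewrite scalerDr !scalerA [h * r]mulrC addrCA.
move=> [d1 d2]; split; first by move: d1; rewrite /derivable /= E.
by move: d2; rewrite /derive E.
Qed.

Lemma Ck_scaled n f a r : Ck n f -> Ck n (fun x => f (a + r *: x)).
Proof.
elim: n f => [|n IH] f Cf; have cf := Ck_continuous Cf.
  split=> // x; apply: (@continuous_comp _ _ _ (fun x : R3 R => a + r *: x) f); last exact: cf.
  by apply: cvgD; [exact: cvg_cst|apply: cvgZl_tmp; exact: cvg_id].
split.
  move=> x; apply: (@continuous_comp _ _ _ (fun x : R3 R => a + r *: x) f); last exact: cf.
  by apply: cvgD; [exact: cvg_cst|apply: cvgZl_tmp; exact: cvg_id].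
move=> j; have [df Cp] := CkS Cf j.
exists (fun x => r * partial j f (a + r *: x)); last by apply: CkZ; exact: IH.
by move=> x; apply: is_derive_scaled; elim: n {IH Cp} Cf => // n IH' /Ck_le.
Qed.

Lemma smooth_scaled f a r : smooth f -> smooth (fun x => f (a + r *: x)).
Proof. by move=> /smoothP sf; apply/smoothP => n; exact: Ck_scaled. Qed.

Lemma partial_scaled f a r j x : smooth f ->
  partial j (fun y => f (a + r *: y)) x = r * partial j f (a + r *: x).
Proof. by move=> sf; have [] := is_derive_scaled a r j x (smooth_Ck 1 sf). Qed.

Lemma bsupp_scaled f a r : 0 < r -> bsupp f -> bsupp (fun x => f (a + r *: x)).
Proof.
move=> r0 [M f0]; exists (r^-1 * (M + `|a|)) => x; rewrite mulrC ltr_pdivrMr// => xM.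
apply: f0; rewrite -(@ltrD2r _ `|a|); apply: lt_le_trans xM _.
have -> : `|x| * r = `|(a + r *: x) - a|.
  by rewrite [a + _]addrC addrK normrZ gtr0_norm// mulrC.
exact: ler_normB.
Qed.

Lemma eball_scaled X rho r y : 0 < rho -> 0 < r -> eball X (r * rho) (X + rho *: y) <-> eball 0 r y.
Proof.
move=> rho0 r0; rewrite !eballP ?mulr_gt0// subr0 [X + _]addrC addrK nsqZ exprMn mulrC.
by rewrite ltr_pM2r// exprn_gt0.
Qed.

Lemma mdot_jacobian (w : vfield R) x :
  mdot (jacobian w x) (jacobian w x) = fgsq (comp w) x.
Proof.
by apply: eq_bigr => i _; apply: eq_bigr => j _; rewrite !mxE expr2.
Qed.

Lemma tr_jacobian (w : vfield R) x : \tr (jacobian w x) = fdiv (comp w) x.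
Proof. by apply: eq_bigr => i _; rewrite mxE. Qed.

(** The unit operator is conjugated by the map sending y to X + rho y. Both sides of each bound are
    integrals quadratic in first derivatives, so they scale alike and [C] is independent of [X] and
    [rho]. *)
Lemma extension_test th : 1 < th -> exists2 C : R, 0 < C & forall X rho, 0 < rho ->
  exists T : vfield R -> vfield R, (forall phi psi, vCcinfty phi -> vCcinfty psi ->
      T (phi - psi) = T phi - T psi) /\
  forall phi, vCcinfty phi -> [/\ vCcinfty (T phi),
    forall x, eball X rho x -> jacobian (T phi) x = jacobian phi x,
    forall x, ~ eball X (th * rho) x -> jacobian (T phi) x = 0,
    (\int[leb3]_x (mdot (jacobian (T phi) x) (jacobian (T phi) x))%:E <=
      C%:E * \int[leb3]_(x in eball X (th * rho)) (mdot (jacobian phi x) (jacobian phi x))%:E)%E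
  & (\int[leb3]_x (\tr (jacobian (T phi) x) ^+ 2)%:E <=
      C%:E * \int[leb3]_(x in eball X (th * rho)) (\tr (jacobian phi x) ^+ 2)%:E)%E].
Proof.
move=> th1; have th0 : 0 < th := lt_trans ltr01 th1.
have [C [E [C0 EB EP]]] := @unit_extension R th th1.
exists C => // X rho rho0; have ri0 : 0 < rho^-1 by rewrite invr_gt0.
pose sc (phi : vfield R) j y := comp phi j (X + rho *: y).
pose X' := - (rho^-1 *: X).
pose T (phi : vfield R) : vfield R := fun x => \row_i E (sc phi) i (X' + rho^-1 *: x).
have ssc phi : vCcinfty phi -> forall j, smooth (sc phi j).
  by move=> Cphi j; apply: smooth_scaled; exact: Ccinfty_smooth (Cphi j).
have cT phi i : comp (T phi) i = (fun x => E (sc phi) i (X' + rho^-1 *: x)).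
  by apply/funext => x; rewrite /comp mxE.
have unsc x : X + rho *: (X' + rho^-1 *: x) = x.
  by rewrite scalerDr scalerN !scalerA mulfV ?gt_eqF// !scale1r addrA subrr add0r.
have rsc y : X' + rho^-1 *: (X + rho *: y) = y.
  by rewrite scalerDr !scalerA mulVf ?gt_eqF// scale1r addrA addNr add0r.
exists T; split.
  move=> phi psi Cphi Cpsi; apply/funext => x; apply/rowP => i; rewrite !mxE.
  rewrite -(EB _ _ (ssc phi Cphi) (ssc psi Cpsi)); congr (E _ i _).
  by apply/funext => j; apply/funext => y; rewrite /sc /comp !mxE.
move=> phi Cphi; have sf := ssc phi Cphi.
have [EC Ein Eout Eg Ed] := EP _ sf.
have dT k i x : partial k (comp (T phi) i) x = rho^-1 * partial k (E (sc phi) i) (X' + rho^-1 *: x).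
  by rewrite cT (partial_scaled X' rho^-1 k x (EC i).1).
have dsc k i y : partial k (sc phi i) y = rho * partial k (comp phi i) (X + rho *: y).
  exact: (partial_scaled X rho k y (Ccinfty_smooth (Cphi i))).
have gT x : fgsq (comp (T phi)) x = rho^-1 ^+ 2 * fgsq (E (sc phi)) (X' + rho^-1 *: x).
  rewrite /fgsq /gsq mulr_sumr; apply: eq_bigr => i _; rewrite mulr_sumr; apply: eq_bigr => k _.
  by rewrite dT exprMn.
have gS y : fgsq (sc phi) y = rho ^+ 2 * fgsq (comp phi) (X + rho *: y).
  rewrite /fgsq /gsq mulr_sumr; apply: eq_bigr => i _; rewrite mulr_sumr; apply: eq_bigr => k _.
  by rewrite dsc exprMn.
have tT x : fdiv (comp (T phi)) x ^+ 2 = rho^-1 ^+ 2 * fdiv (E (sc phi)) (X' + rho^-1 *: x) ^+ 2.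
  by rewrite -exprMn /fdiv mulr_sumr; congr (_ ^+ 2); apply: eq_bigr => i _; exact: dT.
have tS y : fdiv (sc phi) y ^+ 2 = rho ^+ 2 * fdiv (comp phi) (X + rho *: y) ^+ 2.
  by rewrite -exprMn /fdiv mulr_sumr; congr (_ ^+ 2); apply: eq_bigr => i _; exact: dsc.
have cphi j : smooth (comp phi j) := Ccinfty_smooth (Cphi j).
have mball := measurable_eball X (th * rho).
(* The powers of [rho] from the two changes of variables cancel. *)
have change (F G H L : R3 R -> R) : continuous F -> (forall x, 0 <= F x) ->
    continuous L -> (forall x, 0 <= L x) ->
    (forall x, H x = rho^-1 ^+ 2 * F (X' + rho^-1 *: x)) ->
    (forall y, G y = rho ^+ 2 * L (X + rho *: y)) ->
    (\int[leb3]_x (F x)%:E <= C%:E * \int[leb3]_(y in eball 0%R th) (G y)%:E)%E ->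
    (\int[leb3]_x (H x)%:E <= C%:E * \int[leb3]_(x in eball X (th * rho)) (L x)%:E)%E.
  move=> cF F0 cL L0 HF GL FG.
  have mF : measurable_fun setT (EFin \o F) by apply/measurable_EFinP; exact: continuous_measurableR3.
  pose L1 x := (\1_(eball X (th * rho)) x * L x)%:E.
  have mL1 : measurable_fun setT L1.
    apply/measurable_EFinP; apply: measurable_funM; first exact: measurable_indic.
    exact: continuous_measurableR3.
  have L10 x : (0 <= L1 x)%E by rewrite lee_fin mulr_ge0// indicE.
  have -> : (\int[leb3]_x (H x)%:E = rho%:E * \int[leb3]_x (F x)%:E)%E.
    under eq_integral do rewrite HF EFinM.
    rewrite ge0_integralZl_EFin//; last 3 first.
    - by move=> x _; rewrite lee_fin.
    - exact: (measurableT_comp mF (measurable_affine3 _ _)).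
    - by rewrite exprn_ge0// ltW.
    rewrite (ge0_integral_leb3_affine (f := EFin \o F) X' ri0 mF)//.
    rewrite muleA -EFinM; congr (_%:E * _)%E; rewrite invrK exprVn; field.
    by rewrite gt_eqF.
  have -> : (\int[leb3]_(x in eball X (th * rho)) (L x)%:E = rho%:E * \int[leb3]_(y in eball 0%R th) (G y)%:E)%E.
    have -> : (\int[leb3]_(y in eball 0%R th) (G y)%:E = (rho ^+ 2)%:E * \int[leb3]_y L1 (X + rho *: y)%R)%E.
      rewrite [LHS]integral_indicM -ge0_integralZl_EFin//; last 2 first.
      - exact: (measurableT_comp mL1 (measurable_affine3 _ _)).
      - by rewrite sqr_ge0.
      apply: eq_integral => y _; rewrite GL /L1 -!EFinM !indicE.
      have -> : (X + rho *: y \in eball X (th * rho)) = (y \in eball 0 th).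
        by apply/idP/idP => /set_mem h; apply/mem_set; apply/(eball_scaled X y rho0 th0).
      by rewrite mulrCA.
    rewrite (ge0_integral_leb3_affine X rho0 mL1)// !muleA -!EFinM.
    have -> : rho * rho ^+ 2 * rho^-1 ^+ 3 = 1 by field; rewrite gt_eqF.
    by rewrite mul1e [LHS]integral_indicM; apply: eq_integral => y _; rewrite -EFinM.
  have rho0E : (0 <= rho%:E)%E by rewrite lee_fin ltW.
  by rewrite [leRHS]muleCA; exact: (lee_wpmul2l rho0E FG).
split.
- move=> i; apply/CcinftyP; rewrite cT; split; first exact: (smooth_scaled _ _ (EC i).1).
  exact: (bsupp_scaled _ ri0 (EC i).2).
- move=> x xB; apply/matrixP => i k; rewrite !mxE dT Ein.
    by rewrite dsc unsc mulKf// gt_eqF.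
  have /(eball_scaled X _ rho0 ltr01)/(eballP _ _ ltr01) : eball X (1 * rho) (X + rho *: (X' + rho^-1 *: x)).
    by rewrite unsc mul1r.
  by rewrite subr0 expr1n => /ltW.
- move=> x xB; apply/matrixP => i k; rewrite !mxE dT Eout ?mulr0//.
  rewrite leNgt; apply/negP => h; apply: xB; rewrite -(unsc x).
  by apply/(eball_scaled X _ rho0 th0)/eballP => //; rewrite subr0.
- have H := change _ _ _ _ (continuous_fgsq (fun i => (EC i).1)) (fgsq_ge0 _)
    (continuous_fgsq cphi) (fgsq_ge0 _) gT gS Eg.
  under eq_integral do rewrite mdot_jacobian.
  by under [X in (_ <= _ * X)%E]eq_integral do rewrite mdot_jacobian.
have H := change _ _ _ _ (continuous_sqr (smooth_continuous (smooth_fdiv (fun i => (EC i).1)))) (fun x => sqr_ge0 _)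
    (continuous_sqr (smooth_continuous (smooth_fdiv cphi))) (fun x => sqr_ge0 _) tT tS Ed.
under eq_integral do rewrite tr_jacobian.
by under [X in (_ <= _ * X)%E]eq_integral do rewrite tr_jacobian.
Qed.

End Scaling.

Section Extension.
Context {R : realType}.
Implicit Types (w u v : vfield R) (F G K : mfield R) (A B : set (R3 R)) (X : R3 R) (th rho : R).

Local Notation mip3 := (@mip _ (R3 R) R leb3 3 3).
Local Notation SM := (semi_inner_mL2 (m := 3) (n := 3) (@leb3 R)).

Definition cut A G : mfield R := fun x => \1_A x *: G x.

Lemma ent_cut A G p : ent p (cut A G) = (fun x => \1_A x * ent p G x).
Proof. by apply/funext => x; rewrite /ent mxE. Qed.

Lemma cut_mL2 A G : measurable A -> mL2 leb3 G -> mL2 leb3 (cut A G).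
Proof.
move=> mA LG p; rewrite ent_cut; apply: L2_le (LG p) _ => [|x].
  by apply: measurable_funM; [exact: measurable_indic|exact: L2_measurable (LG p)].
by rewrite indicE normrM; case: (_ \in _); rewrite ?normr1 ?mul1r// normr0 mul0r.
Qed.

Lemma cut_le A G : measurable A -> mL2 leb3 G -> nrm mip3 (cut A G) <= nrm mip3 G.
Proof.
move=> mA LG; have LC := cut_mL2 mA LG.
rewrite -(@ler_pXn2r _ 2%N) ?nnegrE ?nrm_ge0// !nrm_mip//; apply: ler_sum => p _.
rewrite ler_pXn2r ?nnegrE ?nrm_ge0//.
have [|_ //] := nrmL2_mono (L2_measurable (LC p)) (LG p).
by move=> x; rewrite ent_cut indicE normrM; case: (_ \in _); rewrite ?normr1 ?mul1r// normr0 mul0r.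
Qed.

Lemma cutB A F G : cut A (F - G) = cut A F - cut A G.
Proof. by apply/funext => x; exact: scalerBr. Qed.

Lemma nrm_cut A G : measurable A -> mL2 leb3 G ->
  ((nrm mip3 (cut A G) ^+ 2)%:E = \int[leb3]_(x in A) (mdot (G x) (G x))%:E)%E.
Proof.
move=> mA LG; rewrite (nrm_mip_mdot (cut_mL2 mA LG)) [RHS]integral_indicM.
apply: eq_integral => x _; rewrite -EFinM !mdot_sum /cut indicE; case: (_ \in _).
  by rewrite mul1r scale1r.
by rewrite mul0r scale0r big1// => p _; rewrite mxE mul0r.
Qed.

Lemma ae_cut_closed A G : measurable A -> mL2 leb3 G ->
  (forall e : R, 0 < e -> exists F, [/\ mL2 leb3 F, forall x, A x -> F x = 0 & nrm mip3 (G - F) < e]) ->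
  {ae leb3, forall x, A x -> G x = 0}.
Proof.
move=> mA LG H.
suff : {ae leb3, forall x (p : 'I_3 * 'I_3), \1_A x * G x p.1 p.2 = 0}.
  apply: filterS => x h Ax; apply/matrixP => i j; rewrite mxE.
  by have := h (i, j); rewrite indicE mem_set// mul1r.
apply: filter_forall => p; apply: (@ae_constraint_closed _ _ _ _ _ _
  (fun x (B : 'M[R]_3) => \1_A x * B p.1 p.2) 1 G) => //.
- move=> F LF; apply: measurable_funM; first exact: measurable_indic.
  exact: L2_measurable (LF p).
- by move=> x B C; rewrite !mxE mulrBr.
- move=> x B; rewrite mul1r (bigD1 p)//= indicE normrM; apply: (@le_trans _ _ `|B p.1 p.2|).
    by case: (_ \in _); rewrite ?normr1 ?mul1r// normr0 mul0r.
  by rewrite lerDl sumr_ge0.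
move=> e e0; have [F [LF F0 GF]] := H e e0; exists F; split=> //.
have -> : (fun x => \1_A x * F x p.1 p.2) = (0 : R3 R -> R).
  apply/funext => x; rewrite indicE; case: (boolP (x \in A)) => [/set_mem/F0 ->|_].
    by rewrite mxE mulr0.
  by rewrite mul0r.
by rewrite (si_eq0 (si0 (semi_inner_L2 leb3))) ?(si0l (semi_inner_L2 leb3))//; exact: L2_0.
Qed.

Lemma nrm_trace_le G : mL2 leb3 G -> nrm (ipL2 leb3) (fun x => \tr (G x)) <= 3 * nrm mip3 G.
Proof.
move=> LG; have S := semi_inner_L2 (@leb3 R).
have -> : (fun x => \tr (G x)) = \sum_(i < 3) ent (i, i) G by apply/funext => x; rewrite fct_sumE.
apply: (@le_trans _ _ (\sum_(i < 3) nrm (ipL2 leb3) (ent (i, i) G))).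
  by apply: (nrm_sum_le S) => i; exact: (LG (i, i)).
have h i := nrm_ent_le (i, i) LG; rewrite sum3.
have := h (@Ordinal 3 0 isT); have := h (@Ordinal 3 1 isT); have := h (@Ordinal 3 2 isT).
move: (nrm _ _) (nrm _ _) (nrm _ _) (nrm _ _) => *; lra.
Qed.

(** The operator [T] of [extension_test] is applied to test fields tending to [w]. It respects
    differences and is bounded for the energy, so the gradients of the images are Cauchy, and each
    property passes to their limit. *)
Lemma extension th : 1 < th -> exists2 C : R, 0 < C & forall X rho, 0 < rho ->
  forall w, hdot1s w -> exists u, [/\ hdot1s u,
    {ae leb3, forall x, eball X rho x -> wgrad u x = wgrad w x},
    {ae leb3, forall x, ~ eball X (th * rho) x -> wgrad u x = 0}
  & nrm hinner u ^+ 2 <= C * nrm mip3 (cut (eball X (th * rho)) (wgrad w)) ^+ 2].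
Proof.
move=> th1; have [C C0 HC] := extension_test th1; exists C => // X rho rho0 w [hw trw].
have [T [TB TP]] := HC X rho rho0; set A := eball X (th * rho) in TP *.
have mA : measurable A := measurable_eball _ _.
have S := semi_inner_L2 (@leb3 R).
have [_ _ Lw [phi [Cphi _ cphi]]] := hdot1_elim hw.
have LJ n : mL2 leb3 (jacobian (phi n)) := jacobian_mL2 (Cphi n).
have CT n : vCcinfty (T (phi n)) by have [] := TP _ (Cphi n).
have LT n : mL2 leb3 (jacobian (T (phi n))) := jacobian_mL2 (CT n).
pose s := Num.sqrt C; have s0 : 0 <= s by exact: sqrtr_ge0.
have sC : s ^+ 2 = C by rewrite sqr_sqrtr// ltW.
have Tle psi : vCcinfty psi ->
    nrm mip3 (jacobian (T psi)) <= s * nrm mip3 (cut A (jacobian psi)).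
  move=> Cpsi; have [CTp _ _ + _] := TP _ Cpsi.
  have Lp := jacobian_mL2 Cpsi; have LTp := jacobian_mL2 CTp.
  rewrite -(nrm_mip_mdot LTp) -(nrm_cut mA Lp) -EFinM lee_fin -sC -exprMn.
  by rewrite ler_pXn2r ?nnegrE ?mulr_ge0 ?nrm_ge0.
have trT psi : vCcinfty psi -> nrm (ipL2 leb3) (fun x => \tr (jacobian (T psi) x)) <=
    s * nrm (ipL2 leb3) (fun x => \tr (jacobian psi x)).
  move=> Cpsi; have [CTp _ _ _ +] := TP _ Cpsi.
  have Lp := trace_L2 (jacobian_mL2 Cpsi); have LTp := trace_L2 (jacobian_mL2 CTp).
  move=> H; have := nrmL2 LTp; have := nrmL2 Lp.
  have := nrm_ge0 (ipL2 leb3) (fun x => \tr (jacobian psi x)).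
  have := nrm_ge0 (ipL2 leb3) (fun x => \tr (jacobian (T psi) x)).
  move: (nrm _ _) (nrm _ _) => p q p0 q0 eq ep.
  rewrite -(@ler_pXn2r _ 2%N) ?nnegrE ?mulr_ge0// exprMn sC -lee_fin ep EFinM eq.
  apply: le_trans H _; have C0E : (0 <= C%:E)%E by rewrite lee_fin ltW.
  apply: (lee_wpmul2l C0E); apply: ge0_subset_integral => //.
    by apply/measurable_EFinP; apply: measurable_funX; exact: L2_measurable Lp.
  by move=> x _; rewrite lee_fin sqr_ge0.
have TBn n m : jacobian (T (phi n)) - jacobian (T (phi m)) = jacobian (T (phi n - phi m)).
  by rewrite TB// jacobianB.
have s1 : 0 < s + 1 by rewrite ltr_wpDl.
have [|G LG cG] := scomplete_mL2 LT.
  move=> e e0; have e2 : 0 < e / 2 / (s + 1) by rewrite !divr_gt0.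
  have [N NP] := cphi _ e2; exists N => n m /NP hn /NP hm; rewrite TBn.
  have Cnm := vCcinftyB (Cphi n) (Cphi m).
  apply: (le_lt_trans (Tle _ Cnm)).
  have h1 := cut_le mA (jacobian_mL2 Cnm); move: h1; rewrite (jacobianB (Cphi n) (Cphi m)) => h1.
  have h2 := nrm_triang SM (LJ n) Lw (LJ m); rewrite (nrmBC SM Lw (LJ m)) in h2.
  have h3 : nrm mip3 (cut A (jacobian (phi n) - jacobian (phi m))) <= e / (s + 1).
    have -> : e / (s + 1) = e / 2 / (s + 1) + e / 2 / (s + 1) by field; rewrite gt_eqF.
    exact: (le_trans h1 (le_trans h2 (lerD (ltW hn) (ltW hm)))).
  apply: (@le_lt_trans _ _ (s * (e / (s + 1)))); first exact: (ler_wpM2l s0 h3).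
  by rewrite mulrCA gtr_pMr// ltr_pdivrMr// mul1r ltrDl.
have [u [hu aeG d0]] := hdot1_lim CT LG cG.
have Lu := hdot1_L2 hu.
(* The divergences of [phi n] tend in L^2 to that of [w], which is 0, and the divergence bound for
   [T] transmits this to [G]. *)
have trG : {ae leb3, forall x, \tr (G x) = 0}.
  apply: trace_closed => // e e0.
  (* 3 from [nrm_trace_le] and [s] from [trT]; the added 1 makes the final inequality strict. *)
  have e2 : 0 < e / (3 * (s + 1)) by rewrite divr_gt0// mulr_gt0.
  have [N1 NP1] := cG _ e0; have [N2 NP2] := cphi _ e2.
  pose n := maxn N1 N2; exists (jacobian (T (phi n))); split; first exact: LT.
    apply: (le_lt_trans (trT _ (Cphi n))).
    have Ld := siB SM (LJ n) Lw.
    have h1 := nrm_trace_le Ld.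
    have h2 : nrm (ipL2 leb3) (fun x => \tr (jacobian (phi n) x)) <= 3 * nrm mip3 (jacobian (phi n) - wgrad w).
      apply: (le_trans _ h1); have t1 := trace_L2 (LJ n); have t2 := trace_L2 Lw; have t3 := trace_L2 Ld.
      have -> : (fun x => \tr (jacobian (phi n) x)) =
          (fun x => \tr ((jacobian (phi n) - wgrad w) x)) + (fun x => \tr (wgrad w x)).
        by apply/funext => x; rewrite !fctE -mxtraceD subrK.
      by apply: (le_trans (nrmD S t3 t2)); rewrite (nrmL2_eq0 t2 trw) addr0.
    have h3 := NP2 n (leq_maxr _ _).
    apply: (@le_lt_trans _ _ (s * (3 * (e / (3 * (s + 1)))))).
      have three0 : 0 <= 3 :> R by []; exact: (ler_wpM2l s0 (le_trans h2 (ler_wpM2l three0 (ltW h3)))).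
    rewrite [ltLHS](_ : _ = s / (s + 1) * e); last by field; rewrite gt_eqF.
    by rewrite gtr_pMl// ltr_pdivrMr// mul1r ltrDl.
  by rewrite (nrmBC SM LG (LT n)); exact: NP1 _ (leq_maxl _ _).
have mB : measurable (eball X rho) := measurable_eball _ _.
(* On the inner ball [jacobian (T (phi n)) - jacobian (phi n)] vanishes for every [n], and it tends
   to [G - wgrad w]. *)
have aeB : {ae leb3, forall x, eball X rho x -> (G - wgrad w) x = 0}.
  apply: ae_cut_closed => // [|e e0]; first exact: (siB SM LG Lw).
  have e2 : 0 < e / 2 by rewrite divr_gt0.
  have [N1 NP1] := cG _ e2; have [N2 NP2] := cphi _ e2.
  pose n := maxn N1 N2; exists (jacobian (T (phi n)) - jacobian (phi n)); split.
  - exact: (siB SM (LT n) (LJ n)).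
  - by move=> x xB; have [_ TE _ _ _] := TP _ (Cphi n); rewrite !fctE TE// subrr.
  have -> : G - wgrad w - (jacobian (T (phi n)) - jacobian (phi n)) =
      (G - jacobian (T (phi n))) - (wgrad w - jacobian (phi n)).
    by rewrite !opprB addrACA [RHS]addrACA; congr (_ + _); exact: addrC.
  apply: (le_lt_trans (nrmB SM (siB SM LG (LT n)) (siB SM Lw (LJ n)))).
  have := NP1 n (leq_maxl _ _); have := NP2 n (leq_maxr _ _).
  rewrite (nrmBC SM (LT n) LG) (nrmBC SM (LJ n) Lw) => h1 h2.
  by rewrite [ltRHS]splitr; exact: (ltrD h2 h1).
have aeC : {ae leb3, forall x, (~` A) x -> G x = 0}.
  apply: ae_cut_closed => // [|e e0]; first exact: measurableC.
  have [N NP] := cG _ e0; exists (jacobian (T (phi N))); split; first exact: LT.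
    by move=> x xA; have [_ _ T0 _ _] := TP _ (Cphi N); exact: T0.
  by rewrite (nrmBC SM LG (LT N)); exact: NP.
exists u; split.
- split; first exact: hu.
  by apply: filterS2 aeG trG => x ->.
- by apply: filterS2 aeG aeB => x -> h xB; apply/eqP; rewrite -subr_eq0; apply/eqP; exact: h.
- by apply: filterS2 aeG aeC => x -> h xA; exact: h.
have -> : nrm hinner u = nrm mip3 (wgrad u) by rewrite /nrm (hinner_mip hu hu).
have LcW := cut_mL2 mA Lw.
rewrite -sC -exprMn ler_pXn2r ?nnegrE ?mulr_ge0 ?nrm_ge0//.
apply/ler_addgt0Pr => e e0.
have e2 : 0 < e / (s + 1) by rewrite divr_gt0.
have [N1 NP1] := cG _ e2; have [N2 NP2] := cphi _ e2.
pose n := maxn N1 N2.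
have h1 : nrm mip3 (wgrad u) <= nrm mip3 G by rewrite (nrm_dist0 SM Lu LG d0).
have h2 := nrm_triang SM LG (LT n) (si0 SM); rewrite !subr0 (nrmBC SM LG (LT n)) in h2.
have h3 := Tle _ (Cphi n); have h4 := NP1 n (leq_maxl _ _); have h5 := NP2 n (leq_maxr _ _).
have LcJ := cut_mL2 mA (LJ n).
have h6 := nrm_triang SM LcJ LcW (si0 SM); rewrite !subr0 -cutB in h6.
have h7 := cut_le mA (siB SM (LJ n) Lw).
have h8 : s * nrm mip3 (cut A (jacobian (phi n))) <= s * (e / (s + 1) + nrm mip3 (cut A (wgrad w))).
  by apply: (ler_wpM2l s0); apply: (le_trans h6); rewrite lerD2r; exact: (le_trans h7 (ltW h5)).
apply: (le_trans h1); apply: (le_trans h2).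
apply: (@le_trans _ _ (e / (s + 1) + s * (e / (s + 1) + nrm mip3 (cut A (wgrad w))))).
  exact: (lerD (ltW h4) (le_trans h3 h8)).
move: (nrm _ _) => p; rewrite le_eqVlt; apply/orP; left; apply/eqP; field.
by rewrite gt_eqF.
Qed.

End Extension.

(** * The iteration *)

Section Main.
Context {R : realType}.
Implicit Types (w u v : vfield R) (F G : mfield R) (A : set (R3 R)).

Local Notation mip3 := (@mip _ (R3 R) R leb3 3 3).
Local Notation SM := (semi_inner_mL2 (m := 3) (n := 3) (@leb3 R)).

Lemma sum_indic_le1 (I : eqType) (s : seq I) (A : I -> set (R3 R)) x : uniq s ->
  (forall i j, i != j -> A i `&` A j = set0) -> \sum_(i <- s) \1_(A i) x <= 1 :> R.
Proof.
move=> us dA; have [/hasP[i is_ xi]|/hasPn h] := boolP (has (fun i => x \in A i) s); last first.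
  by rewrite big_seq big1 ?ler01// => i /h; rewrite indicE => /negbTE ->.
rewrite (bigD1_seq i)//= big1 ?addr0 => [|j ji].
  by rewrite indicE xi.
rewrite indicE (_ : (x \in A j) = false)//; apply/negbTE; rewrite notin_setE => xj.
have : (A j `&` A i) x by split=> //; exact: set_mem.
by rewrite dA.
Qed.

(** At each point at most one of the disjoint sets contributes, so the sum of the indicators is at
    most 1. *)
Lemma sum_nrm_cut_le (I : choiceType) (s : {fset I}) (A : I -> set (R3 R)) G :
  (forall i, measurable (A i)) -> (forall i j, i != j -> A i `&` A j = set0) -> mL2 leb3 G ->
  \sum_(i <- s) nrm mip3 (cut (A i) G) ^+ 2 <= nrm mip3 G ^+ 2.
Proof.
move=> mA dA LG; rewrite -lee_fin -sumEFin (nrm_mip_mdot LG).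
rewrite (eq_bigr _ (fun i _ => nrm_cut (mA i) LG)).
have g0 x : 0 <= mdot (G x) (G x).
  by rewrite mdot_sum; apply: sumr_ge0 => p _; rewrite -expr2 sqr_ge0.
have mg : measurable_fun setT (fun x => mdot (G x) (G x)).
  under eq_fun do rewrite mdot_sum; apply: measurable_sum => p.
  by apply: measurable_funM; exact: (L2_measurable (LG p)).
rewrite (eq_bigr _ (fun i _ => integral_indicM leb3 (A i) (fun x => (mdot (G x) (G x))%:E))).
have mi i : measurable_fun setT (fun x => (\1_(A i) x)%:E * (mdot (G x) (G x))%:E)%E.
  by apply/measurable_EFinP; apply: measurable_funM => //; exact: measurable_indic.
rewrite -ge0_integral_sum//; last first.
  by move=> i x _; rewrite -EFinM lee_fin mulr_ge0// indicE.
apply: ge0_le_integral => //.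
- by move=> x _; apply: sume_ge0 => i _; rewrite -EFinM lee_fin mulr_ge0// indicE.
- by apply: emeasurable_sum => i; exact: mi.
- exact/measurable_EFinP.
move=> x _; rewrite -ge0_sume_distrl; last by move=> i _; rewrite lee_fin indicE.
by rewrite sumEFin -EFinM lee_fin ler_piMl// sum_indic_le1.
Qed.

Lemma rigid_of_eq A u v : hdot1s u -> hdot1s v ->
  {ae leb3, forall x, A x -> wgrad u x = wgrad v x} -> rigid_in A (u - v).
Proof.
move=> hu hv uv; split; first exact: (siB (@semi_inner_hdot1s R) hu hv).
have [_ + _] := hdot1_lin (-1) hv.1 hu.1; rewrite scaleN1r addrC => g.
apply: filterS2 uv g => x uvx gx Ax; apply/sgrad_eq0 => p.
by rewrite gx (uvx Ax) scaleN1r addNr !mxE addr0.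
Qed.

Lemma rigid_of_eq0 A u : hdot1s u -> {ae leb3, forall x, A x -> wgrad u x = 0} -> rigid_in A u.
Proof.
move=> hu u0; split=> //; apply: filterS u0 => x ux Ax; apply/sgrad_eq0 => p.
by rewrite ux// !mxE addr0.
Qed.

Lemma hinner_disjoint A B u v : A `&` B = set0 -> hdot1s u -> hdot1s v ->
  {ae leb3, forall x, ~ A x -> wgrad u x = 0} -> {ae leb3, forall x, ~ B x -> wgrad v x = 0} ->
  hinner u v = 0.
Proof.
move=> AB hu hv u0 v0; rewrite (hinner_mip hu.1 hv.1); apply: big1 => p _.
have Lu := hdot1_L2 hu.1 p; have Lv := hdot1_L2 hv.1 p.
rewrite /ipL2 /Rintegral (_ : (\int[leb3]_x _ = 0)%E)// -[RHS](integral0 leb3 setT).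
apply: ae_eq_integral => //; first exact: measurable_int (L2M_integrable Lu Lv).
apply: filterS2 u0 v0 => x ux vx _; congr EFin; rewrite /ent.
have [xA|xA] := pselect (A x); last by rewrite ux// mxE mul0r.
rewrite vx ?mxE ?mulr0// => xB; have : (A `&` B) x by [].
by rewrite AB.
Qed.

End Main.

Theorem theorem2p4 (R : realType) (theta : R) (htheta : 1 < theta) :
  exists c C : R, [/\ 0 < c, c < C &
    forall (I : countType) (X : I -> R3 R) (rho : I -> R),
      (forall i, 0 < rho i) ->
      (forall i j, i != j ->
        eball (X i) (theta * rho i) `&` eball (X j) (theta * rho j) = set0) ->
      forall (gamma : R) (k : nat), 0 < gamma ->
        (opnorm (fun w : vfield R =>
           (iter k (fun v => v - gamma *: Lop X rho v) w - Pop X rho w)%R)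
         <= ((Num.max (1 - c * gamma) `|1 - C * gamma|) ^+ k)%:E)%E].
Proof.
have [C C0 ext_ex] := @extension R theta htheta.
(* For any [C > 0], [C + 1] and its inverse lie on either side of 1; this gives the strict
   inequality between the two constants. *)
have C1 : 0 < C + 1 by rewrite addr_gt0.
exists (C + 1)^-1, (C + 1); split; first by rewrite invr_gt0.
  by rewrite invf_plt ?posrE//; apply: lt_trans (_ : 1 < _); rewrite ?invf_lt1// ltrDr.
move=> I X rho rho0 disj gamma k g0.
have S := @semi_inner_hdot1s R; have cplt := @scomplete_hdot1s R.
pose A i := eball (X i) (theta * rho i).
have mA i : measurable (A i) := measurable_eball _ _.
have BA i x : eball (X i) (rho i) x -> A i x.
  by move=> h; apply: (lt_trans h); rewrite ltr_pMl.
pose P i w u := [/\ hdot1s u,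
    {ae leb3, forall x, eball (X i) (rho i) x -> wgrad u x = wgrad w x},
    {ae leb3, forall x, ~ A i x -> wgrad u x = 0}
  & nrm hinner u ^+ 2 <= C * nrm (mip leb3) (cut (A i) (wgrad w)) ^+ 2].
(* For [w] in [hdot1s] the default 0 is never taken, by [ext_ex]; the choice is made separately for
   each [w]. *)
pose ext i (w : vfield R) := xget 0 (P i w).
have extP i w : hdot1s w -> P i w (ext i w).
  by move=> hw; apply: xgetPex; exact: ext_ex (X i) (rho i) (rho0 i) w hw.
pose nl i (w : vfield R) : R := nrm (mip leb3) (cut (A i) (wgrad w)) ^+ 2.
have cW i := closed_Wsub X rho i.
have off_rigid i j w : i != j -> hdot1s w -> Wsub X rho j (ext i w).
  move=> ij hw; have [hu _ u0 _] := extP i w hw; apply: rigid_of_eq0 => //.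
  apply: filterS u0 => x ux xj; apply: ux => xi.
  have : (A i `&` A j) x by split=> //; exact: BA.
  by rewrite /A disj.
(* The projections are values of [xget]; completeness and closedness show that the set it picks from
   is nonempty for [w] in [hdot1s]. *)
have QP i w : hdot1s w -> is_oproj hinner (orthc hdot1s hinner (Wsub X rho i)) w (Qop X rho i w).
  move=> hw; have WH : Wsub X rho i `<=` @hdot1s R by move=> v [].
  exact: (xgetPex 0 (oproj_exists S cplt (closed_orthc S WH) hw)).
have PP w : hdot1s w -> is_oproj hinner (Wspace X rho) w (Pop X rho w).
  by move=> hw; exact: (xgetPex 0 (oproj_exists S cplt (closed_Wspace X rho) hw)).
have nl_sum (F : {fset I}) w : hdot1s w -> \sum_(i <- F) nl i w <= nrm hinner w ^+ 2.
  move=> hw; have -> : nrm hinner w = nrm (mip leb3) (wgrad w) by rewrite /nrm (hinner_mip hw.1 hw.1).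
  exact: (sum_nrm_cut_le F mA disj (hdot1_L2 hw.1)).
have ext_H i w : hdot1s w -> hdot1s (ext i w) by move=> /(extP i)[].
have ext_W i w : hdot1s w -> Wsub X rho i (ext i w - w).
  by move=> hw; have [hu e _ _] := extP i w hw; exact: rigid_of_eq.
have ext_orth i j w z : i != j -> hdot1s w -> hdot1s z -> hinner (ext i w) (ext j z) = 0.
  move=> ij hw hz; have [hu _ u0 _] := extP i w hw; have [hv _ v0 _] := extP j z hz.
  exact: (hinner_disjoint (disj i j ij) hu hv u0 v0).
have ext_le i w : hdot1s w -> nrm hinner (ext i w) ^+ 2 <= C * nl i w by move=> /(extP i)[].
(* Likewise [Lop] is a genuine unconditional sum and not the default of [hsum], because the sum
   exists by [Q_usum]. *)
have LP w : hdot1s w -> is_usum hdot1s hinner (fun i => Qop X rho i w) (Lop X rho w).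
  move=> hw; apply: (xgetPex 0).
  exact: (Q_usum S cplt cW C0 nl_sum ext_H ext_W ext_le QP hw).
have cC : (C + 1)^-1 * C <= 1 by rewrite mulrC ler_pdivrMr// mul1r lerDl.
have CC : C <= C + 1 by rewrite lerDl.
apply: ub_ereal_sup => _ [w [hw w1] <-]; rewrite lee_fin.
have m0 : 0 <= Num.max (1 - (C + 1)^-1 * gamma) `|1 - (C + 1) * gamma|.
  by rewrite le_max normr_ge0 orbT.
apply: (le_trans (iterate_bound S cplt cW (WspaceP X rho) C0 nl_sum ext_H ext_W off_rigid ext_orth
  ext_le QP LP PP cC CC g0 k hw)).
by apply: ler_piMr; [exact: exprn_ge0|exact: w1].
Qed.
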